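(* Let $G$ be a nilpotent FAR-group and let $p$ be a prime such that $G$ has no subgroup isomorphic to $C_{p^\infty}$. Then for every discrete $\hat{G}_p$-module $M$ of finite $p$-power order, the pro-$p$ completion map $G\to\hat{G}_p$ induces an isomorphism $H^n(\hat{G}_p,M)\to H^n(G,M)$ for all $n\geq 0$.
   Context: A section of a group is a quotient of one of its subgroups. An abelian group has finite $p$-rank ($p$ prime) if its $p$-torsion subgroup is a direct sum of finitely many cyclic and quasicyclic groups. An FAR-group (group with finite abelian section rank) is a group each of whose abelian sections has finite torsion-free rank and finite $p$-rank for every prime $p$. $C_{p^\infty}$ is the quasicyclic (Prüfer) $p$-group. $\hat{G}_p$ is the pro-$p$ completion of $G$ (the inverse limit of the quotients $G/N$ over normal subgroups $N$ of finite $p$-power index). A discrete $\hat{G}_p$-module is a discrete abelian group with a continuous $\hat{G}_p$-action; it is viewed as a $G$-module via $G\to\hat{G}_p$. $H^\ast(\hat{G}_p,M)$ is the continuous cohomology of the profinite group $\hat{G}_p$, and $H^\ast(G,M)$ is ordinary group cohomology. *)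

(* Defs.v *)
From HB Require Import structures.
From mathcomp Require Import all_boot all_order all_algebra all_field.
From mathcomp Require Import all_classical.
From mathcomp Require Import topology.

Set Implicit Arguments.
Unset Strict Implicit.
Unset Printing Implicit Defensive.

Import GRing.Theory.
Local Open Scope classical_set_scope.
Local Open Scope quotient_scope.
Local Open Scope group_scope.

HB.mixin Record isNormalClosed (G : groupType) (S : {pred G}) := {
  gpredJ_normal : forall x y : G, x \in S -> x ^ y \in S
}.

#[short(type="normalClosed")]
HB.structure Definition NormalClosed (G : groupType) :=
  {S of GroupClosed G S & isNormalClosed G S}.

Record subgroup_type (G : groupType) (H : groupClosed G) : Type :=
  SubgroupElt { sg_val : G; sg_valP : sg_val \in H }.

Section SubgroupType.
Variables (G : groupType) (H : groupClosed G).

Fact subgroup_group_closed : group_closed (fun x : G => x \in H).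
Proof. by split=> [|x y]; [exact: gpred1 | exact: gpredF]. Qed.

HB.instance Definition _ := [isSub for @sg_val G H].
HB.instance Definition _ := [Choice of subgroup_type H by <:].
HB.instance Definition _ :=
  SubChoice_isSubGroup.Build G _ (subgroup_type H) subgroup_group_closed.
End SubgroupType.

Section QuotientGroup.
Variables (G : groupType) (N : normalClosed G).

Definition coset_eq (x y : G) : bool := x^-1 * y \in N.

Fact coset_eq_equiv : equiv_class_of coset_eq.
Proof.
split=> [x|x y|y x z]; rewrite /coset_eq ?mulVg ?gpred1 //.
  by rewrite -[LHS]gpredV invgM invgK.
by move=> xy yz; rewrite -[z](mulVKg y) mulgA gpredM.
Qed.

Canonical coset_eq_rel := EquivRelPack coset_eq_equiv.
Canonical coset_eq_encModRel := defaultEncModRel coset_eq.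

Definition quotient_group : Type := {eq_quot coset_eq}.

HB.instance Definition _ := Choice.on quotient_group.
HB.instance Definition _ := EqQuotient.on quotient_group.

Lemma eq_cosetE (x y : G) :
  (\pi_quotient_group x == \pi_quotient_group y) = (x^-1 * y \in N).
Proof. by rewrite piE. Qed.

Definition qmul (u v : quotient_group) : quotient_group :=
  \pi_quotient_group (repr u * repr v).
Definition qinv (u : quotient_group) : quotient_group :=
  \pi_quotient_group (repr u)^-1.
Definition qone : quotient_group := \pi_quotient_group 1.

Lemma repr_coset (x : G) : x^-1 * repr (\pi_quotient_group x) \in N.
Proof. by rewrite -eq_cosetE reprK. Qed.

Lemma pi_qmul (x y : G) :
  qmul (\pi_quotient_group x) (\pi_quotient_group y) =
  \pi_quotient_group (x * y).
Proof.
apply/esym/eqP; rewrite eq_cosetE invgM.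
set x' := repr (\pi_quotient_group x); set y' := repr (\pi_quotient_group y).
have -> : y^-1 * x^-1 * (x' * y') = (x^-1 * x') ^ y * (y^-1 * y').
  by rewrite /conjg !mulgA mulgK.
by rewrite gpredM ?gpredJ_normal ?repr_coset.
Qed.

Lemma pi_qinv (x : G) :
  qinv (\pi_quotient_group x) = \pi_quotient_group x^-1.
Proof.
apply/esym/eqP; rewrite eq_cosetE invgK.
have := repr_coset x; set x' := repr _ => Nx.
have -> : x * x'^-1 = ((x^-1 * x')^-1) ^ x^-1.
  by rewrite /conjg !invgM !invgK !mulgA mulgK.
by rewrite gpredJ_normal // gpredV.
Qed.

Fact qmulA : associative qmul.
Proof.
elim/quotW=> x; elim/quotW=> y; elim/quotW=> z.
by rewrite (pi_qmul y z) (pi_qmul x y) !pi_qmul mulgA.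
Qed.
Fact qmul1 : left_id qone qmul.
Proof. by elim/quotW=> x; rewrite pi_qmul mul1g. Qed.
Fact qmulr1 : right_id qone qmul.
Proof. by elim/quotW=> x; rewrite pi_qmul mulg1. Qed.
Fact qmulV : left_inverse qone qinv qmul.
Proof. by elim/quotW=> x; rewrite pi_qinv pi_qmul mulVg. Qed.
Fact qmulrV : right_inverse qone qinv qmul.
Proof. by elim/quotW=> x; rewrite pi_qinv pi_qmul mulgV. Qed.

HB.instance Definition _ :=
  isGroup.Build quotient_group qmulA qmul1 qmulr1 qmulV qmulrV.

Definition qpi (x : G) : quotient_group := \pi_quotient_group x.

Lemma qpiK : cancel (repr : quotient_group -> G) qpi.
Proof. by move=> u; rewrite /qpi reprK. Qed.

Lemma qpiV (x : G) : qpi x^-1 = (qpi x)^-1.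
Proof. by rewrite /qpi -pi_qinv. Qed.

Fact qpiM : {morph qpi : x y / x * y}.
Proof. by move=> x y; rewrite /qpi -pi_qmul. Qed.
HB.instance Definition _ := isMultiplicative.Build G quotient_group qpi qpiM.

End QuotientGroup.

Definition isomorphic (G H : groupType) : Prop :=
  exists f : {multiplicative G -> H}, bijective f.

Definition abelian_group (A : groupType) : Prop :=
  forall x y : A, commute x y.

Definition generated (G : groupType) (A : set G) : set G :=
  smallest [set B : set G | group_closed (fun x : G => x \in B)] A.

Fixpoint lower_central (G : groupType) (n : nat) : set G :=
  if n is n'.+1 then
    generated [set [~ x, y] | x in @lower_central G n' & y in [set: G]]
  else [set: G].

Definition nilpotent_group (G : groupType) : Prop :=
  exists n, @lower_central G n = [set 1].

(* The Prüfer group C_{p^oo}, as the group of complex roots of unity of p-power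
   order.  The condition z != 0 only matters for p = 0. *)
Definition prufer_pred (p : nat) : {pred algC} :=
  fun z => (z != 0%R) && `[< exists n, (z ^+ (p ^ n))%R = 1%R >].

Record prufer (p : nat) : Type :=
  PruferElt { prufer_val : algC; prufer_valP : prufer_val \in prufer_pred p }.

Section Prufer.
Variable p : nat.

HB.instance Definition _ := [isSub for @prufer_val p].
HB.instance Definition _ := [Choice of prufer p by <:].

Fact prufer1_subproof : 1%R \in prufer_pred p.
Proof.
by rewrite unfold_in oner_eq0; apply/asboolP; exists 0%N; rewrite expr1.
Qed.

Fact pruferM_subproof (x y : prufer p) : (val x * val y)%R \in prufer_pred p.
Proof.
have /andP[x0 /asboolP[m xm]] := valP x.
have /andP[y0 /asboolP[n yn]] := valP y.
rewrite unfold_in; apply/andP; split; first by rewrite mulf_neq0.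
apply/asboolP; exists (m + n)%N.
by rewrite exprMn expnD exprM xm mulnC exprM yn !expr1n mulr1.
Qed.

Fact pruferV_subproof (x : prufer p) : ((val x)^-1)%R \in prufer_pred p.
Proof.
have /andP[x0 /asboolP[m xm]] := valP x.
rewrite unfold_in; apply/andP; split; first by rewrite invr_eq0.
by apply/asboolP; exists m; rewrite exprVn xm invr1.
Qed.

Definition prufer1 : prufer p := PruferElt prufer1_subproof.
Definition pruferM (x y : prufer p) : prufer p :=
  PruferElt (pruferM_subproof x y).
Definition pruferV (x : prufer p) : prufer p := PruferElt (pruferV_subproof x).

Fact pruferA : associative pruferM.
Proof. by move=> x y z; apply: val_inj; rewrite /= mulrA. Qed.
Fact prufer1l : left_id prufer1 pruferM.
Proof. by move=> x; apply: val_inj; rewrite /= mul1r. Qed.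
Fact prufer1r : right_id prufer1 pruferM.
Proof. by move=> x; apply: val_inj; rewrite /= mulr1. Qed.
Fact pruferVl : left_inverse prufer1 pruferV pruferM.
Proof.
by move=> x; apply: val_inj; have /andP[x0 _] := valP x; rewrite /= mulVf.
Qed.
Fact pruferVr : right_inverse prufer1 pruferV pruferM.
Proof.
by move=> x; apply: val_inj; have /andP[x0 _] := valP x; rewrite /= mulfV.
Qed.

HB.instance Definition _ :=
  isGroup.Build (prufer p) pruferA prufer1l prufer1r pruferVl pruferVr.
End Prufer.

Section AbelianRanks.
Variable A : groupType.

Definition zpow (x : A) (k : int) : A :=
  match k with Posz n => x ^+ n | Negz n => x ^- n.+1 end.

Definition independent (m : nat) (x : 'I_m -> A) : Prop :=
  forall k : 'I_m -> int,
    \prod_(i < m) zpow (x i) (k i) = 1 -> forall i, k i = 0%R.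

Definition finite_torsion_free_rank : Prop :=
  exists r : nat, forall (m : nat) (x : 'I_m -> A), independent x -> (m <= r)%N.

Definition cyclic_subgroup (C : groupClosed A) : Prop :=
  exists x : A, [set y : A | y \in C] = generated [set x].

Definition quasicyclic_subgroup (C : groupClosed A) : Prop :=
  exists2 q : nat, prime q & isomorphic (subgroup_type C) (prufer q).

(* The p-primary component: the elements of p-power order. *)
Definition p_torsion (p : nat) : set A := [set x | exists n, x ^+ (p ^ n) = 1].

Definition internal_direct_sum (T : set A) (m : nat)
    (C : 'I_m -> groupClosed A) : Prop :=
  (forall i x, x \in C i -> T x) /\
  (forall x, T x -> exists! c : 'I_m -> A,
     (forall i, c i \in C i) /\ x = \prod_(i < m) c i).

Definition finite_p_rank (p : nat) : Prop :=
  exists (m : nat) (C : 'I_m -> groupClosed A),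
    (forall i, cyclic_subgroup (C i) \/ quasicyclic_subgroup (C i)) /\
    internal_direct_sum (p_torsion p) C.
End AbelianRanks.

Definition FAR_group (G : groupType) : Prop :=
  forall (H : groupClosed G) (K : normalClosed (subgroup_type H)),
    abelian_group (quotient_group K) ->
    finite_torsion_free_rank (quotient_group K) /\
    (forall p, prime p -> finite_p_rank (quotient_group K) p).


HB.structure Definition PreTopologicalGroup :=
  {G of Topological G & Group G}.

HB.mixin Record PreTopologicalGroup_isTopologicalGroup G
    & PreTopologicalGroup G := {
  mulg_continuous : continuous (fun x : G * G => x.1 * x.2);
  invg_continuous : continuous (fun x : G => x^-1)
}.

#[short(type="topologicalGroupType")]
HB.structure Definition TopologicalGroup :=
  {G of PreTopologicalGroup G & PreTopologicalGroup_isTopologicalGroup G}.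


(* The predicate is stored unbundled, rather than as a normalClosed, to keep
   the type in the universe of G: it indexes a product topology below. *)
Record normal_subgroup (G : groupType) := NormalSubgroup {
  ns_pred : G -> bool;
  ns_group : group_closed ns_pred;
  ns_normal : forall x y : G, ns_pred x -> ns_pred (x ^ y)
}.

HB.instance Definition _ (G : groupType) (N : normal_subgroup G) :=
  isMulClosed.Build G (ns_pred N) (group_closedM (ns_group N)).
HB.instance Definition _ (G : groupType) (N : normal_subgroup G) :=
  isMul1Closed.Build G (ns_pred N) (ns_group N).1.
HB.instance Definition _ (G : groupType) (N : normal_subgroup G) :=
  isInvClosed.Build G (ns_pred N) (group_closedV (ns_group N)).
HB.instance Definition _ (G : groupType) (N : normal_subgroup G) :=
  isNormalClosed.Build G (ns_pred N) (@ns_normal G N).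
Definition normal_closed (G : groupType) (N : normal_subgroup G) :
  normalClosed G := NormalClosed.clone G (ns_pred N) _.
Coercion normal_closed : normal_subgroup >-> NormalClosed.type.

Record p_normal (G : groupType) (p : nat) := PNormal {
  pn_group :> normal_subgroup G;
  pn_index : exists k : nat,
    ([set: quotient_group pn_group] #= `I_(p ^ k))%card
}.

HB.instance Definition _ (G : groupType) (p : nat) :=
  gen_eqMixin (p_normal G p).
HB.instance Definition _ (G : groupType) (p : nat) :=
  gen_choiceMixin (p_normal G p).

Section ProPCompletion.
Variables (G : groupType) (p : nat).

Definition p_quotients : Type :=
  prod_topology
    (fun N : p_normal G p => discrete_topology (quotient_group N)).

(* qpi M \o repr is the transition map G/N -> G/M: see qpi_repr. *)
Definition compatible (x : forall N : p_normal G p, quotient_group N) : Prop :=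
  forall N M : p_normal G p, {subset N <= M} -> qpi M (repr (x N)) = x M.

Record pro_completion : Type := ProCompletion {
  pro_val : p_quotients;
  pro_valP : `[< compatible pro_val >]
}.

HB.instance Definition _ := [isSub for pro_val].
HB.instance Definition _ := [Choice of pro_completion by <:].
HB.instance Definition _ :=
  Topological.copy pro_completion (initial_topology pro_val).

Fact qpi_repr (N M : p_normal G p) (g : G) :
  {subset N <= M} -> qpi M (repr (qpi N g)) = qpi M g.
Proof.
by move=> NM; apply/esym/eqP; rewrite eq_cosetE; apply: NM; exact: repr_coset.
Qed.

Fact pro_mul_subproof (x y : pro_completion) :
  `[< compatible (fun N => pro_val x N * pro_val y N) >].
Proof.
apply/asboolP => N M NM; have /asboolP cx := pro_valP x.
have /asboolP cy := pro_valP y.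
rewrite -(cx _ _ NM) -(cy _ _ NM) -gmulfM -[RHS](qpi_repr _ NM).
by rewrite gmulfM /= !qpiK.
Qed.

Fact pro_inv_subproof (x : pro_completion) :
  `[< compatible (fun N => (pro_val x N)^-1) >].
Proof.
apply/asboolP => N M NM; have /asboolP cx := pro_valP x.
by rewrite -(cx _ _ NM) -qpiV -[RHS](qpi_repr _ NM) qpiV qpiK.
Qed.

Fact pro_one_subproof :
  `[< compatible (fun N : p_normal G p => 1 : quotient_group N) >].
Proof. by apply/asboolP => N M NM; exact: (qpi_repr 1 NM). Qed.

Definition pro_mul (x y : pro_completion) : pro_completion :=
  ProCompletion (pro_mul_subproof x y).
Definition pro_inv (x : pro_completion) : pro_completion :=
  ProCompletion (pro_inv_subproof x).
Definition pro_one : pro_completion := ProCompletion pro_one_subproof.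

Fact pro_mulA : associative pro_mul.
Proof.
by move=> x y z; apply/val_inj/functional_extensionality_dep => N /=; rewrite mulgA.
Qed.
Fact pro_mul1 : left_id pro_one pro_mul.
Proof.
by move=> x; apply/val_inj/functional_extensionality_dep => N /=; rewrite mul1g.
Qed.
Fact pro_mulr1 : right_id pro_one pro_mul.
Proof.
by move=> x; apply/val_inj/functional_extensionality_dep => N /=; rewrite mulg1.
Qed.
Fact pro_mulV : left_inverse pro_one pro_inv pro_mul.
Proof.
by move=> x; apply/val_inj/functional_extensionality_dep => N /=; rewrite mulVg.
Qed.
Fact pro_mulrV : right_inverse pro_one pro_inv pro_mul.
Proof.
by move=> x; apply/val_inj/functional_extensionality_dep => N /=; rewrite mulgV.
Qed.

HB.instance Definition _ :=
  isGroup.Build pro_completion pro_mulA pro_mul1 pro_mulr1 pro_mulV pro_mulrV.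

Fact pro_near (x : pro_completion) (N : p_normal G p) :
  \forall y \near x, pro_val y N = pro_val x N.
Proof.
have c1 : continuous (pro_val : pro_completion -> p_quotients).
  exact: initial_continuous.
have c2 := @proj_continuous _
  (fun N : p_normal G p => discrete_topology (quotient_group N)) N.
have h := @continuous_comp _ _ _ _ _ x (c1 x) (c2 (pro_val x)).
exact: (h _ (@discrete_set1 (discrete_topology _) (pro_val x N))).
Qed.

Fact pro_cvg (T : Type) (F : set_system T) (f : T -> pro_completion)
    (x : pro_completion) :
  Filter F -> (forall N, \forall t \near F, pro_val (f t) N = pro_val x N) ->
  f @ F --> x.
Proof.
move=> FF h; have hv : (pro_val \o f) @ F --> (pro_val x : p_quotients).
  apply/cvg_sup => N U [/= _ [[V oV <-] Vx]] sVU.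
  rewrite nbhs_filterE /=; near=> t; apply: sVU.
  suff : pro_val (f t) N = pro_val x N by rewrite /= => ->.
  by near: t; exact: h.
move=> U [/= _ [[V oV <-] Vx]] sVU.
have hV := hv V (open_nbhs_nbhs (conj oV Vx)).
exact: (@filterS _ F FF _ _ (fun t Vt => sVU (f t) Vt) hV).
Unshelve. all: by end_near. Qed.

Fact pro_mul_continuous :
  continuous (fun x : pro_completion * pro_completion => x.1 * x.2).
Proof.
case=> x y; apply: pro_cvg => N.
exists ([set z | pro_val z N = pro_val x N],
        [set z | pro_val z N = pro_val y N]).
  by split; exact: pro_near.
by case=> a b /= [-> ->].
Qed.

Fact pro_inv_continuous : continuous (fun x : pro_completion => x^-1).
Proof.
move=> x; apply: (@pro_cvg _ _ _ _ (nbhs_filter x)) => N.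
have h : [set y | pro_val y N = pro_val x N] `<=`
    [set y | pro_val y^-1 N = pro_val x^-1 N] by move=> y /= ->.
exact: (@filterS _ (nbhs x) _ _ _ h (pro_near x N)).
Qed.

HB.instance Definition _ := PreTopologicalGroup_isTopologicalGroup.Build
  pro_completion pro_mul_continuous pro_inv_continuous.

Fact completion_map_subproof (g : G) :
  `[< compatible (fun N : p_normal G p => qpi N g) >].
Proof. by apply/asboolP => N M NM; exact: qpi_repr. Qed.

Definition completion_map (g : G) : pro_completion :=
  ProCompletion (completion_map_subproof g).

Fact completion_mapM : {morph completion_map : x y / x * y}.
Proof.
move=> x y; apply/val_inj/functional_extensionality_dep => N /=.
by rewrite gmulfM.
Qed.

HB.instance Definition _ :=
  isMultiplicative.Build G pro_completion completion_map completion_mapM.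

End ProPCompletion.

Record gmodule (G : groupType) (M : zmodType) := GModule {
  gact :> G -> M -> M;
  gact1 : forall m, gact 1 m = m;
  gactM : forall g h m, gact (g * h) m = gact g (gact h m);
  gactD : forall g m m', gact g (m + m')%R = (gact g m + gact g m')%R
}.

Definition discrete_gmodule (G : topologicalGroupType) (M : zmodType)
    (a : gmodule G M) : Prop :=
  continuous (fun u : G * discrete_topology M =>
                a u.1 u.2 : discrete_topology M).

Definition pullback_gmodule (G H : groupType) (phi : {multiplicative G -> H})
  (M : zmodType) (a : gmodule H M) : gmodule G M.
Proof.
refine (@GModule G M (fun g => a (phi g)) _ _ _) => [m|g h m|g m m'].
- suff -> : phi 1 = 1 by rewrite gact1.
  by apply: (mulgI (phi 1)); rewrite -gmulfM !mulg1.
- by rewrite gmulfM gactM.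
- by rewrite gactD.
Defined.

Section Cochains.
Variables (G : groupType) (M : zmodType) (a : gmodule G M).

Definition cochain (n : nat) : Type := ('I_n -> G) -> M.
HB.instance Definition _ n := GRing.Zmodule.on (cochain n).

(* (g_0, ..., g_n) |-> (g_0, ..., g_i g_(i+1), ..., g_n) *)
Definition contract (n : nat) (i : 'I_n) (g : 'I_n.+1 -> G) : 'I_n -> G :=
  fun j => if (j < i)%N then g (lift ord_max j)
           else if j == i then g (lift ord_max j) * g (lift ord0 j)
           else g (lift ord0 j).

Definition coboundary (n : nat) (f : cochain n) : cochain n.+1 :=
  fun g => (a (g ord0) (f (fun j => g (lift ord0 j)))
            + \sum_(i < n) f (contract i g) *~ (-1) ^+ i.+1
            + f (fun j => g (lift ord_max j)) *~ (-1) ^+ n.+1)%R.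

Fact coboundaryB n : {morph @coboundary n : f h / (f - h)%R}.
Proof.
have aB g : {morph a g : m m' / (m - m')%R}.
  by move=> m m'; apply: (addIr (a g m')); rewrite -gactD !subrK.
move=> f h; apply/funext => g.
have E k (u v : cochain k) x : (u - v)%R x = (u x - v x)%R by [].
rewrite E /coboundary !E aB mulrzBl.
under eq_bigr do rewrite E mulrzBl.
by rewrite sumrB opprD [RHS]addrACA; congr (_ + _)%R;
  rewrite opprD [RHS]addrACA.
Qed.

Fact coboundary0 n : @coboundary n 0%R = 0%R.
Proof. by rewrite -[X in coboundary X](subrr 0%R) coboundaryB subrr. Qed.

Section Cohomology.
(* A family of subgroups of the groups of inhomogeneous cochains: all cochains
   for abstract groups, continuous cochains for topological groups. *)
Variable P : forall n : nat, zmodClosed (cochain n).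

Record cocycle (n : nat) := Cocycle {
  cocycle_val : cochain n;
  cocycleP : (cocycle_val \in P n) && (coboundary cocycle_val == 0%R)
}.

Fact cocycle_zmod_closed n :
  zmod_closed (fun f : cochain n => (f \in P n) && (coboundary f == 0%R)).
Proof.
split=> [|f h]; first by apply/andP; rewrite rpred0 coboundary0.
move=> /andP[Pf /eqP df] /andP[Ph /eqP dh]; apply/andP.
by rewrite rpredB // coboundaryB df dh subrr.
Qed.

HB.instance Definition _ n := [isSub for @cocycle_val n].
HB.instance Definition _ n := [Choice of cocycle n by <:].
HB.instance Definition _ n :=
  GRing.SubChoice_isSubZmodule.Build _ _ (cocycle n) (cocycle_zmod_closed n).

Definition is_coboundary (n : nat) : cochain n -> Prop :=
  match n with
  | 0 => fun f => f = 0%R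
  | m.+1 => fun f => exists2 c : cochain m, c \in P m & f = coboundary c
  end.

(* Exact cochains among the cocycles; the differential squares to zero, so the
   cocycle condition is automatic and removes nothing. *)
Definition coboundaries (n : nat) : {pred cocycle n} :=
  fun z => `[< is_coboundary (val z) >].

Fact coboundaries_zmod_closed n : zmod_closed (@coboundaries n).
Proof.
case: n => [|n]; split=> [|z w]; rewrite !unfold_in.
- exact/asboolP.
- by move=> /asboolP/= -> /asboolP/= ->; apply/asboolP; rewrite /= subrr.
- by apply/asboolP; exists 0%R; rewrite ?rpred0 // coboundary0.
move=> /asboolP/=[c Pc zc] /asboolP/=[e Pe we]; apply/asboolP.
by exists (c - e)%R; rewrite ?rpredB // coboundaryB -zc -we.
Qed.

HB.instance Definition _ n :=
  GRing.isZmodClosed.Build (cocycle n) (@coboundaries n)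
    (coboundaries_zmod_closed n).

Definition cohomology (n : nat) : zmodType := Quotient.quot (@coboundaries n).

Definition cohomology_class (n : nat) (z : cocycle n) : cohomology n :=
  \pi_(Quotient.quot (@coboundaries n)) z.

Fact cohomology_classB n : {morph @cohomology_class n : z w / (z - w)%R}.
Proof. by move=> z w; rewrite /cohomology_class raddfB. Qed.

Fact cohomology_classP n (z w : cocycle n) :
  cohomology_class z = cohomology_class w <-> is_coboundary (val z - val w)%R.
Proof.
split=> [/eqP|h]; last apply/eqP.
  by rewrite -Quotient.idealrBE => /asboolP; rewrite raddfB.
by rewrite -Quotient.idealrBE; apply/asboolP; rewrite raddfB.
Qed.
End Cohomology.

Definition all_cochains (n : nat) : {pred cochain n} := fun=> true.

Fact all_cochains_zmod_closed n : zmod_closed (@all_cochains n).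
Proof. by []. Qed.

HB.instance Definition _ n :=
  GRing.isZmodClosed.Build (cochain n) (@all_cochains n)
    (all_cochains_zmod_closed n).

Definition group_cohomology (n : nat) : zmodType :=
  cohomology (fun n => @all_cochains n) n.

End Cochains.

Section ContinuousCohomology.
Variables (G : topologicalGroupType) (M : zmodType) (a : gmodule G M).

Definition continuous_cochains (n : nat) : {pred cochain G M n} :=
  fun f => `[< continuous (f : {ptws 'I_n -> G} -> discrete_topology M) >].

Fact continuous_cochains_zmod_closed n : zmod_closed (@continuous_cochains n).
Proof.
split=> [|f h]; rewrite !unfold_in.
  apply/asboolP => x U hU.
  apply: (@filterS _ (nbhs (x : {ptws 'I_n -> G})) _ setT) filterT => y _.
  exact: (@nbhs_singleton (discrete_topology M)).
move=> /asboolP cf /asboolP ch; apply/asboolP => x.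
pose T : topologicalType := {ptws 'I_n -> G}.
have loc (u : T -> discrete_topology M) : continuous u ->
    nbhs (x : T) [set y | u y = u x].
  by move=> cu; exact: (cu x _ (@discrete_set1 (discrete_topology M) (u x))).
move=> U hU.
have hfh := @filterI _ _ (nbhs_filter (x : T)) _ _ (loc f cf) (loc h ch).
have sub : [set y | f y = f x] `&` [set y | h y = h x] `<=`
    [set y | U (f y - h y)%R].
  move=> y [/= -> ->].
  exact: (@nbhs_singleton (discrete_topology M)).
exact: (@filterS _ _ (nbhs_filter (x : T)) _ _ sub hfh).
Qed.

HB.instance Definition _ n :=
  GRing.isZmodClosed.Build (cochain G M n) (@continuous_cochains n)
    (@continuous_cochains_zmod_closed n).

Definition continuous_cohomology (n : nat) : zmodType :=
  cohomology a (fun n => @continuous_cochains n) n.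
End ContinuousCohomology.

Section InducedMap.
Variables (G : groupType) (H : topologicalGroupType).
Variables (phi : {multiplicative G -> H}) (M : zmodType) (a : gmodule H M).

Definition pullback_cochain (n : nat) (f : cochain H M n) : cochain G M n :=
  fun g => f (phi \o g).

Fact pullback_cochainB n : {morph @pullback_cochain n : f h / (f - h)%R}.
Proof. by []. Qed.

Fact pullback_coboundary n (f : cochain H M n) :
  pullback_cochain (coboundary a f) =
  coboundary (pullback_gmodule phi a) (pullback_cochain f).
Proof.
apply/funext => g; rewrite /pullback_cochain /coboundary /=.
congr (_ + _ + _)%R; apply: eq_bigr => i _; congr (f _ *~ _)%R.
apply/funext => j; rewrite /contract /=.
by case: ifP => // _; case: ifP => // _; rewrite gmulfM.
Qed.

Fact pullback_cocycle_subproof n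
    (z : cocycle a (fun n => @continuous_cochains H M n) n) :
  (pullback_cochain (val z) \in @all_cochains G M n) &&
  (coboundary (pullback_gmodule phi a) (pullback_cochain (val z)) == 0%R).
Proof.
have /andP[_ /eqP dz] := cocycleP z.
by rewrite -pullback_coboundary dz; apply/eqP.
Qed.

Definition pullback_cocycle n
    (z : cocycle a (fun n => @continuous_cochains H M n) n) :
    cocycle (pullback_gmodule phi a) (fun n => @all_cochains G M n) n :=
  Cocycle (pullback_cocycle_subproof z).

Definition cohomology_map (n : nat) (x : continuous_cohomology a n) :
    group_cohomology (pullback_gmodule phi a) n :=
  cohomology_class (pullback_cocycle (repr x)).

Lemma cohomology_map_class n
    (z : cocycle a (fun n => @continuous_cochains H M n) n) :
  cohomology_map (cohomology_class z) = cohomology_class (pullback_cocycle z).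
Proof.
apply/cohomology_classP; rewrite /= -pullback_cochainB.
set w := repr _; have : cohomology_class w = cohomology_class z.
  exact: reprK.
move=> /cohomology_classP; case: n z @w => [|n] z w /=.
  by move=> ->.
by case=> c _ ->; exists (pullback_cochain c); rewrite // pullback_coboundary.
Qed.

Fact cohomology_map_zmod_morphism n : zmod_morphism (@cohomology_map n).
Proof.
move=> x y; rewrite -[x]reprK -[y]reprK.
rewrite -!/(cohomology_class _) -cohomology_classB !cohomology_map_class.
rewrite -cohomology_classB; congr cohomology_class; exact/val_inj.
Qed.

HB.instance Definition _ n :=
  GRing.isZmodMorphism.Build _ _ (@cohomology_map n)
    (@cohomology_map_zmod_morphism n).

End InducedMap.

Definition zmod_isomorphism (U V : zmodType) (f : U -> V) : Prop :=
  zmod_morphism f /\ bijective f.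

(* Main.v *)
From HB Require Import structures.
From mathcomp Require Import fingroup perm cyclic pgroup.
From mathcomp Require Import all_boot all_order all_algebra all_field.
From mathcomp Require Import all_classical topology.
Require Import Defs.

Set Implicit Arguments.
Unset Strict Implicit.
Unset Printing Implicit Defensive.

Import GRing.Theory.
Local Open Scope classical_set_scope.
Local Open Scope ring_scope.

(** Continuous cochains of the completion are the cochains of the finite
    p-quotients of [G], inflated to [G]; these are the [uniform] cochains.  So
    the theorem compares all cochains with uniform ones, for the coefficients
    that are finite p-groups on which [G] acts through a p-group ([pmod]).

    The comparison holds as soon as [G] is [effaceable]: each class of positive
    degree with such coefficients M dies in Map(X,M) for some finite set X on
    which [G] acts through a p-group.  The coefficients Map(X,M) are again of
    the same kind, so one can shift degrees along M -> Map(X,M) -> cokernel: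
    every cocycle is cohomologous to a uniform one ([uniform_representative])
    and a uniform coboundary bounds a uniform cochain ([uniform_injective]).

    A nilpotent group is built from the trivial group by central extensions
    with kernel a factor L of the upper central series.  For an FAR-group
    without quasicyclic p-subgroup the p-torsion of L has bounded exponent: this
    is clear in the centre, and commutators carry the bound upwards
    ([ucs_bounded]).  By finiteness of the p-rank the p-torsion of L is then
    finite and L/L^p is finite as well, so L is, from bottom to top, a finite
    p-group, a free abelian group of finite rank, and a uniquely p-divisible
    group ([effaceable_central]).  It remains to pass from G/C to G when C is
    central and either cyclic, of p-power or infinite order, or uniquely
    p-divisible.

    In both cases it is enough to make a given cocycle constant along C,
    possibly after enlarging the coefficients ([effaceable_extension]).  The
    tool for this is [kill_chain_level], an elementary form of the argument of
    Hochschild and Serre: it asks that the derivations of C, with coefficients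
    in iterated function modules, become inner in the larger module.
    - If C is generated by z, effaceability of G/C in degree 2 applies to the
      extension by C modulo p^k.  It gives a finite set X as above with a
      function tau to the integers modulo p^k such that tau(zx) = tau(x) + 1
      ([affine_coordinate]), and derivations of C become inner in Map(X,M)
      ([coind_kills_finite], [coind_kills_infinite]).
    - If C is uniquely p-divisible, it acts trivially on M.  The isolator in C
      of one element is an increasing union of cyclic groups, on each of which
      derivations are inner; a limit along an ultrafilter does the rest
      ([hull_killsn]).  Treating finitely many elements one after the other
      and taking another limit gives all of C ([divisible_level]). *)

(** * Additive maps and twisted modules *)

Section AdditiveMaps.
Variables (V W : zmodType) (j : V -> W).
Hypothesis jD : {morph j : x y / x + y}.

Lemma addf0 : j 0 = 0.
Proof. by apply: (addIr (j 0)); rewrite -jD !add0r. Qed.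

Lemma addfN : {morph j : x / - x}.
Proof. by move=> x; apply: (addIr (j x)); rewrite -jD !addNr addf0. Qed.

Lemma addfB : {morph j : x y / x - y}.
Proof. by move=> x y; rewrite jD addfN. Qed.

Lemma addf_sum (I : Type) (r : seq I) (P : pred I) (F : I -> V) :
  j (\sum_(i <- r | P i) F i) = \sum_(i <- r | P i) j (F i).
Proof. exact: (big_morph _ jD addf0). Qed.

Lemma addfMn n : {morph j : x / x *+ n}.
Proof.
move=> x; elim: n => [|n IHn]; first by rewrite !mulr0n addf0.
by rewrite !mulrS jD IHn.
Qed.

Lemma addfMz (k : int) : {morph j : x / x *~ k}.
Proof. by move=> x; case: k => n; rewrite /intmul ?addfN addfMn. Qed.

End AdditiveMaps.

Section GroupMorphisms.
Variables (G H : groupType) (f : {multiplicative G -> H}).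

Lemma mor1 : f 1%g = 1%g.
Proof. by apply: (mulgI (f 1%g)); rewrite -gmulfM !mulg1. Qed.

Lemma morV x : f x^-1%g = (f x)^-1%g.
Proof. by apply: (mulgI (f x)); rewrite -gmulfM !mulgV mor1. Qed.

Lemma morX x n : f (x ^+ n)%g = (f x ^+ n)%g.
Proof.
by elim: n => [|n IH]; rewrite ?expg0 ?mor1 // !expgS gmulfM IH.
Qed.

Lemma morJ x y : f (x ^ y)%g = (f x ^ f y)%g.
Proof. by rewrite !gmulfM morV. Qed.
End GroupMorphisms.

(** The unit of the group may act as a proper projection: this keeps the
    twisted module [twist] below on the whole function space. *)
Record nmod (G : groupType) (V : zmodType) := NMod {
  nact :> G -> V -> V;
  nactM : forall g h v, nact (g * h)%g v = nact g (nact h v);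
  nactD : forall g, {morph nact g : v w / v + w}
}.

Lemma nactB G V (a : nmod G V) g : {morph a g : v w / v - w}.
Proof. exact: (addfB (nactD a g)). Qed.
Lemma nactN G V (a : nmod G V) g : {morph a g : v / - v}.
Proof. exact: (addfN (nactD a g)). Qed.
Lemma nact0 G V (a : nmod G V) g : a g 0 = 0.
Proof. exact: (addf0 (nactD a g)). Qed.

Definition nmod_of (G : groupType) (V : zmodType) (a : gmodule G V) : nmod G V :=
  NMod (gactM a) (gactD a).
Coercion nmod_of : gmodule >-> nmod.

Lemma gactB G V (a : gmodule G V) g : {morph gact a g : v w / v - w}.
Proof. exact: (addfB (gactD a g)). Qed.
Lemma gactN G V (a : gmodule G V) g : {morph gact a g : v / - v}.
Proof. exact: (addfN (gactD a g)). Qed.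

Fact twistM (G : groupType) (V : zmodType) (a : nmod G V) (g h : G)
    (f : G -> V) :
  (fun x => f (x * (g * h))%g - a x (f (g * h)%g)) =
  (fun x => (f (x * g * h)%g - a (x * g)%g (f h))
            - a x (f (g * h)%g - a g (f h))).
Proof.
by apply/funext => x; rewrite nactB -nactM mulgA opprB addrA addrNK.
Qed.

Fact twistD (G : groupType) (V : zmodType) (a : nmod G V) (g : G) :
  {morph (fun (f : G -> V) x => f (x * g)%g - a x (f g)) : f h / f + h}.
Proof.
move=> f h; apply/funext => x.
change (f (x * g)%g + h (x * g)%g - a x (f g + h g) =
  f (x * g)%g - a x (f g) + (h (x * g)%g - a x (h g))).
by rewrite nactD opprD addrACA.
Qed.

Definition twist (G : groupType) (V : zmodType) (a : nmod G V) :
    nmod G (G -> V) :=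
  @NMod G (G -> V : zmodType) (fun g f x => f (x * g)%g - a x (f g))
    (twistM a) (twistD a).

(** * Cochains and their differential *)

Section Tuples.
Variable T : Type.

Definition vcons n (x : T) (h : 'I_n -> T) : 'I_n.+1 -> T :=
  fun i => if unlift ord0 i is Some j then h j else x.

Definition vtail n (g : 'I_n.+1 -> T) : 'I_n -> T := fun j => g (lift ord0 j).

Lemma vcons0 n x (h : 'I_n -> T) : vcons x h ord0 = x.
Proof. by rewrite /vcons unlift_none. Qed.

Lemma vconsS n x (h : 'I_n -> T) i : vcons x h (lift ord0 i) = h i.
Proof. by rewrite /vcons liftK. Qed.

Lemma vtailK n x (h : 'I_n -> T) : vtail (vcons x h) = h.
Proof. by apply/funext => i; rewrite /vtail vconsS. Qed.

Lemma vcons_eta n (g : 'I_n.+1 -> T) : vcons (g ord0) (vtail g) = g.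
Proof.
by apply/funext => i; case: (unliftP ord0 i) => [j|] ->; rewrite ?vconsS ?vcons0.
Qed.

Lemma tuple0_eq (g h : 'I_0 -> T) : g = h.
Proof. by apply/funext => -[]. Qed.

End Tuples.

Lemma comp_vcons T U (p : T -> U) n x (h : 'I_n -> T) :
  p \o vcons x h = vcons (p x) (p \o h).
Proof. by apply/funext => i; rewrite /vcons /=; case: unliftP. Qed.

Definition dif (G : groupType) (V : zmodType) (a : nmod G V) n
    (f : cochain G V n) : cochain G V n.+1 :=
  fun g => a (g ord0) (f (fun j => g (lift ord0 j)))
            + \sum_(i < n) f (contract i g) *~ (-1) ^+ i.+1
            + f (fun j => g (lift ord_max j)) *~ (-1) ^+ n.+1.

Definition cur (G : groupType) (V : zmodType) n (f : cochain G V n.+1) :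
  cochain G (G -> V) n := fun h x => f (vcons x h).

Definition unc (G : groupType) (V : zmodType) n (f : cochain G (G -> V) n) :
  cochain G V n.+1 := fun g => f (vtail g) (g ord0).

Lemma curK G V n (f : cochain G V n.+1) : unc (cur f) = f.
Proof. by apply/funext => g; rewrite /unc /cur vcons_eta. Qed.

Lemma uncK G V n (f : cochain G (G -> V : zmodType) n) : cur (unc f) = f.
Proof.
by apply/funext => g; apply/funext => x; rewrite /unc /cur vtailK vcons0.
Qed.

Section Differential.
Variable G : groupType.

Lemma contract0_vcons n (g : 'I_n.+1 -> G) (x : G) :
  contract ord0 (vcons x g) = vcons (x * g ord0)%g (vtail g).
Proof.
apply/funext => i; rewrite /contract.
case: (unliftP ord0 i) => [j|] ->.
  by rewrite !vconsS.
rewrite /= vcons0 vconsS; congr (_ * _)%g.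
have -> : lift ord_max (ord0 : 'I_n.+1) = ord0 by apply/val_inj.
by rewrite vcons0.
Qed.

Lemma contractS_vcons n (g : 'I_n.+1 -> G) (x : G) (i : 'I_n) :
  contract (lift ord0 i) (vcons x g) = vcons x (contract i g).
Proof.
apply/funext => k; rewrite /contract.
case: (unliftP ord0 k) => [j|] ->.
  rewrite vconsS [(lift ord0 j < _)%N]/= /bump /= !add1n ltnS.
  have -> : lift ord_max (lift ord0 j) = lift ord0 (lift ord_max j).
    by apply/val_inj; rewrite /= /bump /= !add1n [in RHS]leqNgt ltn_ord
         [in LHS]leqNgt ltnS ltn_ord.
  by rewrite !vconsS (inj_eq lift_inj).
rewrite vcons0 /= /bump /=.
have -> : lift ord_max (ord0 : 'I_n.+1) = ord0 by apply/val_inj.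
by rewrite vcons0.
Qed.

Lemma init_vcons n (g : 'I_n.+1 -> G) (x : G) :
  (fun j => vcons x g (lift ord_max j)) =
  vcons x (fun j => g (lift ord_max j)).
Proof.
apply/funext => k; case: (unliftP ord0 k) => [j|] ->.
  have -> : lift ord_max (lift ord0 j) = lift ord0 (lift ord_max j).
    by apply/val_inj; rewrite /= /bump /= !add1n [in RHS]leqNgt ltn_ord
         [in LHS]leqNgt ltnS ltn_ord.
  by rewrite !vconsS.
have -> : lift ord_max (ord0 : 'I_n.+1) = ord0 by apply/val_inj.
by rewrite !vcons0.
Qed.

Lemma funE (T : Type) (V : zmodType) (f h : T -> V) x : (f + h) x = f x + h x.
Proof. by []. Qed.

Lemma fun_sumE (T I : Type) (V : zmodType) (r : seq I) (F : I -> T -> V) x :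
  (\sum_(i <- r) F i) x = \sum_(i <- r) F i x.
Proof. by rewrite fct_sumE. Qed.

Lemma fun_mulzE (T : Type) (V : zmodType) (f : T -> V) (k : int) x :
  (f *~ k) x = f x *~ k.
Proof. exact: (@addfMz (T -> V : zmodType) V (fun h => h x)). Qed.

Lemma fun_mulnE (T : Type) (V : zmodType) (f : T -> V) (n : nat) x :
  (f *+ n) x = f x *+ n.
Proof. exact: (@addfMn (T -> V : zmodType) V (fun h => h x)). Qed.

(** The differential of a cochain is that of the cochain with one variable
    less and twisted coefficients, up to sign.  The inductions on the degree
    below all rest on this: they allow arbitrary coefficients and trade the
    first variable for a twist. *)
Lemma dif_vcons (V : zmodType) (a : nmod G V) n (f : cochain G V n.+1) x g :
  dif a f (vcons x g) = - dif (twist a) (cur f) g x.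
Proof.
rewrite /dif !funE fun_sumE !fun_mulzE !opprD big_ord_recl.
rewrite vcons0 contract0_vcons.
have -> : (fun j => vcons x g (lift ord0 j)) = g.
  by apply/funext => i; rewrite vconsS.
congr (_ + _); last first.
  by rewrite init_vcons exprS mulN1r mulrNz.
rewrite addrA; congr (_ + _).
  rewrite /= expr1 mulrNz mulr1z /cur opprK [RHS]addrC.
  by have -> : vcons (g ord0) (fun j => g (lift ord0 j)) = g
    by exact: vcons_eta.
rewrite -sumrN; apply: eq_bigr => i _.
by rewrite contractS_vcons fun_mulzE lift0 exprS mulN1r mulrNz.
Qed.

Lemma cur_dif (V : zmodType) (a : nmod G V) n (f : cochain G V n.+1) :
  cur (dif a f) = - dif (twist a) (cur f).
Proof. by apply/funext => g; apply/funext => x; rewrite /cur dif_vcons. Qed.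

Lemma unc_dif (V : zmodType) (a : nmod G V) n (f : cochain G (G -> V) n) :
  unc (dif (twist a) f) = - dif a (unc f).
Proof.
have := cur_dif a (unc f); rewrite uncK => /(congr1 -%R); rewrite opprK => <-.
by rewrite -[in RHS](curK (dif a (unc f))).
Qed.

Lemma dif0E (V : zmodType) (a : nmod G V) (f : cochain G V 0) g h :
  dif a f g = a (g ord0) (f h) - f h.
Proof.
rewrite /dif big_ord0 addr0 expr1 mulrNz mulr1z.
by congr (a _ (f _) - f _); exact: tuple0_eq.
Qed.

Lemma difD (V : zmodType) (a : nmod G V) n :
  {morph @dif G V a n : f h / f + h}.
Proof.
move=> f h; apply/funext => g; rewrite funE /dif !funE nactD mulrzDl.
under eq_bigr do rewrite funE mulrzDl.
by rewrite big_split /= [RHS]addrACA; congr (_ + _); rewrite [RHS]addrACA.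
Qed.

Lemma difN (V : zmodType) (a : nmod G V) n : {morph @dif G V a n : f / - f}.
Proof. exact: (addfN (@difD V a n)). Qed.
Lemma difB (V : zmodType) (a : nmod G V) n :
  {morph @dif G V a n : f h / f - h}.
Proof. exact: (addfB (@difD V a n)). Qed.
Lemma dif_0 (V : zmodType) (a : nmod G V) n : dif a (0 : cochain G V n) = 0.
Proof. exact: (addf0 (@difD V a n)). Qed.

Lemma dif_dif n : forall (V : zmodType) (a : nmod G V) (f : cochain G V n),
  dif a (dif a f) = 0.
Proof.
elim: n => [|n IH] V a f; apply/funext => g; rewrite -(vcons_eta g) dif_vcons.
  pose e : 'I_0 -> G := fun i => g ord0.
  set g' := vtail g.
  rewrite (dif0E _ _ _ e).
  change (- (dif a f (vcons (g ord0 * g' ord0)%g e)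
    - a (g ord0) (dif a f (vcons (g' ord0) e)) - dif a f (vcons (g ord0) e)) = 0).
  rewrite !(dif0E _ _ _ e) !vcons0 nactB nactM.
  set A := a _ (a _ _); set B := a _ (f e).
  have -> : A - f e - (A - B) = B - f e.
    by rewrite opprB [LHS]addrC addrA subrK.
  by rewrite subrr oppr0.
by rewrite cur_dif difN IH oppr0 oppr0.
Qed.

End Differential.

Definition equivariant (G Q : groupType) (p : G -> Q) (V W : zmodType)
    (b : nmod Q V) (a : nmod G W) (j : V -> W) : Prop :=
  {morph j : v w / v + w} /\ forall g v, a g (j v) = j (b (p g) v).

Lemma dif_natural (G Q : groupType) (p : {multiplicative G -> Q})
    (V W : zmodType) (b : nmod Q V) (a : nmod G W) (j : V -> W) n
    (f : cochain Q V n) :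
  equivariant p b a j ->
  dif a (fun g => j (f (p \o g))) = (fun g => j (dif b f (p \o g))).
Proof.
move=> [jD jE]; apply/funext => g; rewrite /dif !jD (addf_sum jD).
rewrite (addfMz jD) jE; congr (_ + _ + _); apply: eq_bigr => i _.
rewrite (addfMz jD); congr (j (f _) *~ _).
apply/funext => k; rewrite /contract /=.
by case: ifP => // _; case: ifP => // _; rewrite gmulfM.
Qed.

Definition bdry (G : groupType) (V : zmodType) (a : nmod G V) n :
    cochain G V n -> Prop :=
  match n with
  | 0 => fun f => f = 0
  | m.+1 => fun f => exists c : cochain G V m, f = dif a c
  end.

Section Boundaries.
Variable G : groupType.

Lemma bdryD (V : zmodType) (a : nmod G V) n (f h : cochain G V n) :
  bdry a f -> bdry a h -> bdry a (f + h).
Proof.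
case: n f h => [|n] f h /=; first by move=> -> ->; rewrite addr0.
by move=> [c ->] [e ->]; exists (c + e); rewrite difD.
Qed.

Lemma bdry0 (V : zmodType) (a : nmod G V) n : bdry a (0 : cochain G V n).
Proof. by case: n => //= n; exists 0; rewrite dif_0. Qed.

Lemma bdry_dif (V : zmodType) (a : nmod G V) n (f : cochain G V n) :
  bdry a f -> dif a f = 0.
Proof.
by case: n f => [|n] f /= => [->|[c ->]]; [exact: dif_0 | exact: dif_dif].
Qed.

Lemma bdry_natural (Q : groupType) (p : {multiplicative G -> Q})
    (V W : zmodType) (b : nmod Q V) (a : nmod G W) (j : V -> W) n
    (f : cochain Q V n) :
  equivariant p b a j -> bdry b f -> bdry a (fun g => j (f (p \o g))).
Proof.
move=> E; case: n f => [|n] f /=.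
  by move=> ->; apply/funext => g; exact: (addf0 E.1).
by move=> [c ->]; exists (fun g => j (c (p \o g))); exact/esym/dif_natural.
Qed.

Lemma bdry_map (V W : zmodType) (b : nmod G V) (a : nmod G W) (j : V -> W) n
    (f : cochain G V n) :
  equivariant id b a j -> bdry b f -> bdry a (fun g => j (f g)).
Proof. exact: (@bdry_natural G idfun). Qed.

Lemma dif_map (V W : zmodType) (b : nmod G V) (a : nmod G W) (j : V -> W) n
    (f : cochain G V n) :
  equivariant id b a j -> dif a (fun g => j (f g)) = (fun g => j (dif b f g)).
Proof. exact: (@dif_natural G G idfun). Qed.

Lemma bdry_cur (V : zmodType) (a : nmod G V) n (f : cochain G (G -> V) n) :
  bdry (twist a) f -> bdry a (unc f).
Proof.
case: n f => [|n] f /=.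
  by move=> ->; exists 0; rewrite dif_0; apply/funext.
by move=> [c ->]; exists (- unc c); rewrite unc_dif difN.
Qed.

End Boundaries.

(** * Making cocycles constant along a normal subgroup *)

(** Subgroups are predicates here, so that isolators and other subgroups given
    by existence statements need no boolean form. *)
Record nsub (G : groupType) (S : G -> Prop) : Prop := NSub {
  nsub1 : S 1%g;
  nsubM : forall x y, S x -> S y -> S (x * y)%g;
  nsubV : forall x, S x -> S (x^-1)%g;
  nsubJ : forall x y, S x -> S (x ^ y)%g
}.

Definition tcong (G : groupType) (S : G -> Prop) n (g h : 'I_n -> G) : Prop :=
  forall i, S ((g i)^-1 * h i)%g.

Definition level (G : groupType) (S : G -> Prop) (V : Type) n
    (f : ('I_n -> G) -> V) : Prop :=
  forall g h, tcong S g h -> f g = f h.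

Lemma level0 (G : groupType) S V (f : ('I_0 -> G) -> V) : @level G S V 0 f.
Proof. by move=> g h _; congr f; exact: tuple0_eq. Qed.

Lemma level_sub (G : groupType) (S T : G -> Prop) V n (f : ('I_n -> G) -> V) :
  (forall x, T x -> S x) -> level S f -> level T f.
Proof. by move=> TS Lf g h gh; apply: Lf => i; exact: TS. Qed.

Section Level.
Variables (G : groupType) (S : G -> Prop).
Hypothesis NS : nsub S.

Lemma tcong_contract n (i : 'I_n) (g h : 'I_n.+1 -> G) :
  tcong S g h -> tcong S (contract i g) (contract i h).
Proof.
move=> gh j; rewrite /contract; case: ifP => _; first exact: gh.
case: ifP => _; last exact: gh.
set x := g _; set x' := h (lift ord_max j).
set y := g _; set y' := h (lift ord0 j).
have -> : ((x * y)^-1 * (x' * y') = ((x^-1 * x') ^ y) * (y^-1 * y'))%g.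
  by rewrite /conjg !invgM !mulgA mulgK.
by apply: nsubM => //; [apply: nsubJ => //|]; exact: gh.
Qed.

(** All the terms of the differential but the first one are values of the
    cochain at products of the arguments. *)
Lemma level_dif_tail (V : zmodType) (a : nmod G V) n (f : cochain G V n) g h :
  level S f -> tcong S g h ->
  dif a f g - a (g ord0) (f (vtail g)) = dif a f h - a (h ord0) (f (vtail h)).
Proof.
move=> Lf gh; have E (A B C : V) : A + B + C - A = B + C.
  by rewrite [LHS]addrC !addrA addNr add0r.
rewrite /dif (E (a (g ord0) (f (vtail g)))) (E (a (h ord0) (f (vtail h)))).
congr (_ + _ *~ _); last by apply: Lf => j; exact: gh.
by apply: eq_bigr => i _; congr (_ *~ _); apply: Lf; exact: tcong_contract.
Qed.

Lemma tcong_refl n (g : 'I_n -> G) : tcong S g g.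
Proof. by move=> i; rewrite mulVg; exact: nsub1. Qed.

Lemma tcong_vcons n x y (g h : 'I_n -> G) :
  S (x^-1 * y)%g -> tcong S g h -> tcong S (vcons x g) (vcons y h).
Proof.
move=> xy gh i; case: (unliftP ord0 i) => [j|] ->.
  by rewrite !vconsS.
by rewrite !vcons0.
Qed.

(** In the cocycle identity at (x, g), all terms but the first are unchanged
    when x is replaced by 1. *)
Lemma level_cocycle_fixed (V : zmodType) (a : nmod G V) n (f : cochain G V n) :
  level S f -> dif a f = 0 -> forall g x, S x -> a x (f g) = a 1%g (f g).
Proof.
move=> Lf df g x Sx.
have := @level_dif_tail V a n f (vcons x g) (vcons 1%g g) Lf.
rewrite df !vcons0 !vtailK !sub0r => h; apply: oppr_inj; apply: h.
apply: tcong_vcons; last exact: tcong_refl.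
by rewrite mulg1; exact: nsubV.
Qed.

Lemma level_dif (V : zmodType) (a : nmod G V) n (f : cochain G V n) :
  (forall x y v, S (x^-1 * y)%g -> a x v = a y v) ->
  level S f -> level S (dif a f).
Proof.
move=> aS Lf g h gh; have := level_dif_tail a Lf gh.
have -> : f (vtail g) = f (vtail h) by apply: Lf => j; exact: gh.
by rewrite (aS (g ord0) (h ord0)); [move/addIr | exact: gh].
Qed.

(** [killsn q a b j]: the map induced by [j] on the first cohomology of [S]
    vanishes after twisting [q] times, that is on H^(q+1) when [S] is the
    whole group.  Derivations vanish at 1 so as to ignore the part of the
    module on which 1 acts as zero. *)
Fixpoint killsn q : forall V W : zmodType,
    nmod G V -> nmod G W -> (V -> W) -> Prop :=
  match q with
  | 0 => fun V W a b j => forall phi : G -> V, phi 1%g = 0 ->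
      (forall x y, S x -> S y -> phi (x * y)%g = phi x + a x (phi y)) ->
      exists w, forall x, S x -> j (phi x) = b x w - w
  | q'.+1 => fun V W a b j => @killsn q' (G -> V) (G -> W) (twist a) (twist b)
      (fun f x => j (f x))
  end.

Definition kills V W (a : nmod G V) (b : nmod G W) j :=
  equivariant id a b j /\ forall q, killsn q a b j.

(** One killing map for each degree to be treated. *)
Fixpoint kill_chain n (V W : zmodType) (a : nmod G V) (b : nmod G W)
    (j : V -> W) : Prop :=
  match n with
  | 0 => equivariant id a b j
  | m.+1 => exists (X : zmodType) (c : nmod G X) (j1 : V -> X) (j2 : X -> W),
      [/\ kill_chain m a c j1, kills c b j2 & forall v, j v = j2 (j1 v)]
  end.

Lemma twist_equivariant (V W : zmodType) (a : nmod G V) (b : nmod G W) j :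
  equivariant id a b j ->
  equivariant id (twist a) (twist b) (fun f x => j (f x)).
Proof.
move=> [jD jE]; split=> [f h|g f]; apply/funext => x; first exact: jD.
by rewrite /twist /= jE -(addfB jD).
Qed.

Lemma kills_twist (V W : zmodType) (a : nmod G V) (b : nmod G W) j :
  kills a b j -> kills (twist a) (twist b) (fun f x => j (f x)).
Proof.
by move=> [jE jk]; split=> [|q]; [exact: twist_equivariant | exact: (jk q.+1)].
Qed.

Lemma kill_chain_equivariant n : forall V W (a : nmod G V) (b : nmod G W) j,
  kill_chain n a b j -> equivariant id a b j.
Proof.
elim: n => [|n IH] V W a b j //= [X [c [j1 [j2 [/IH[D1 E1] [[D2 E2] _] jj]]]]].
split=> [v w|g v]; first by rewrite !jj D1 D2.
by rewrite !jj E2 E1.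
Qed.

Lemma kill_chain_twist n : forall V W (a : nmod G V) (b : nmod G W) j,
  kill_chain n a b j -> kill_chain n (twist a) (twist b) (fun f x => j (f x)).
Proof.
elim: n => [|n IH] V W a b j /=; first exact: twist_equivariant.
move=> [X [c [j1 [j2 [/IH h1 /kills_twist h2 jj]]]]].
exists (G -> X : zmodType), (twist c), (fun f x => j1 (f x)),
  (fun f x => j2 (f x)); split=> // f; apply/funext => x; exact: jj.
Qed.

(** The substitute for the Hochschild-Serre spectral sequence.  In the step,
    a cocycle of degree n+1 is a cocycle F of degree n with twisted
    coefficients; once F is constant along [S], the function F(h) restricts to
    a derivation of [S], which becomes inner, say given by w(F(h)).  Then
    subtracting the differential of w(F) makes the remaining variable
    constant along [S] and keeps the others so. *)
Theorem kill_chain_level n : forall V W (a : nmod G V) (b : nmod G W) j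
    (f : cochain G V n),
  kill_chain n a b j -> dif a f = 0 ->
  exists2 F : cochain G W n, level S F & bdry b ((fun g => j (f g)) - F).
Proof.
elim: n => [|n IH] V W a b j f.
  by move=> _ _; exists (fun g => j (f g)); [exact: level0 | rewrite subrr].
move=> [X [c [j1 [j2 [h1 [E2 /(_ 0%N) k2] jj]]]]] df.
have dcf : dif (twist a) (cur f) = 0.
  by apply: oppr_inj; rewrite -cur_dif df oppr0.
have [F LF bF] := IH _ _ _ _ _ _ (kill_chain_twist h1) dcf.
have E1 := kill_chain_equivariant h1.
have dF : dif (twist c) F = 0.
  have := bdry_dif bF; rewrite difB (dif_map _ (twist_equivariant E1)) dcf.
  have -> : (fun g => (fun f x => j1 (f x)) ((0 : cochain G (G -> V) n.+1) g))
      = (0 : cochain G (G -> X) n.+1).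
    by apply/funext => g; apply/funext => x; exact: (addf0 E1.1).
  by rewrite sub0r => /(congr1 -%R); rewrite opprK oppr0.
have fixF := level_cocycle_fixed LF dF.
have [w wP] : exists w : (G -> X) -> W, forall h : 'I_n -> G, forall x, S x ->
    j2 (F h x) - j2 (F h 1%g) = b x (w (F h)) - w (F h).
  suff /choice[w wP] : forall psi : G -> X, exists w : W,
      (forall x, S x -> twist c x psi = twist c 1%g psi) ->
      forall x, S x -> j2 (psi x) - j2 (psi 1%g) = b x w - w.
    by exists w => h; apply: wP; exact: fixF.
  move=> psi; case: (pselect (forall x, S x -> twist c x psi = twist c 1%g psi));
    last by exists 0.
  move=> psiP; have [|x y Sx Sy|w wP] := k2 (fun x => psi x - psi 1%g).
  - by rewrite subrr.
  - have := congr1 (fun u => u x) (psiP y Sy); rewrite /twist /= mulg1.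
    move/(canRL (subrK _)) ->; rewrite nactB.
    by rewrite [RHS](AC (2*2) (1*4*3*2)).
  by exists w => _ x Sx; rewrite -(addfB E2.1) wP.
pose u : cochain G W n := fun h => w (F h).
have Lu : level S u by move=> g h gh; rewrite /u (LF _ _ gh).
exists ((fun g => j2 (unc F g)) - dif b u).
  move=> g h gh; have := level_dif_tail b Lu gh.
  have tgh : tcong S (vtail g) (vtail h) by move=> i; exact: gh.
  change (dif b u g - b (g ord0) (w (F (vtail g))) =
    dif b u h - b (h ord0) (w (F (vtail h))) ->
    j2 (F (vtail g) (g ord0)) - dif b u g =
    j2 (F (vtail h) (h ord0)) - dif b u h).
  rewrite -(LF _ _ tgh); set psi := F (vtail g) => tailE.
  have key : j2 (psi (g ord0)) - b (g ord0) (w psi) =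
             j2 (psi (h ord0)) - b (h ord0) (w psi).
    set x := g ord0; have Sx := gh ord0; rewrite -/x in Sx.
    have -> : h ord0 = (x * (x^-1 * h ord0))%g by rewrite mulVKg.
    move: (_ * _)%g Sx => s Ss.
    have := congr1 (fun u => u x) (fixF (vtail g) s Ss).
    rewrite -/psi /twist /= mulg1 => /(canRL (subrK _)) ->.
    rewrite nactM -addrA [- c x _ + _]addrC -nactB E2.1 -E2.2 (addfB E2.1).
    rewrite (wP (vtail g) s Ss) -/psi nactB -!addrA; congr (_ + _).
    by rewrite addrC subrK.
  rewrite -[dif b u g](subrK (b (g ord0) (w psi))).
  rewrite -[dif b u h](subrK (b (h ord0) (w psi))).
  have E (A T B : W) : A - (T + B) = (A - B) - T by rewrite opprD addrA addrAC.
  by rewrite tailE !E key.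
have -> : (fun g => j (f g)) - ((fun g => j2 (unc F g)) - dif b u) =
    (fun g => j2 (((unc (fun g => (fun f x => j1 (f x)) (cur f g))) - unc F) g))
     + dif b u.
  apply/funext => g; rewrite !funE.
  change (j (f g) - (j2 (unc F g) - dif b u g) =
    j2 (j1 (f (vcons (g ord0) (vtail g))) - unc F g) + dif b u g).
  by rewrite vcons_eta jj (addfB E2.1) opprB addrA addrAC.
apply: bdryD; last by exists u.
by apply: (bdry_map E2); exact: bdry_cur bF.
Qed.

End Level.

HB.saturate finfun_of.

(** * Finite modules and finite permutation sets *)

Record gset (G : groupType) (X : Type) := GSet {
  sact :> G -> X -> X;
  sact1 : forall x, sact 1%g x = x;
  sactM : forall g h x, sact (g * h)%g x = sact g (sact h x)
}.

Definition pset (p : nat) (G : groupType) X (s : gset G X) : Prop :=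
  exists k, forall g x, s (g ^+ (p ^ k))%g x = x.

Definition pmod (p : nat) (G : groupType) (M : zmodType) (a : gmodule G M) :=
  exists k, (forall m : M, m *+ (p ^ k) = 0) /\
            forall g m, a (g ^+ (p ^ k))%g m = m.

Section Coinduced.
Variables (G : groupType) (X : finType) (s : gset G X).
Variables (M : finZmodType) (a : gmodule G M).

Definition coind_act (g : G) (psi : {ffun X -> M}) : {ffun X -> M} :=
  [ffun x => a g (psi (s g^-1%g x))].

Fact coind_act1 psi : coind_act 1%g psi = psi.
Proof. by apply/ffunP => x; rewrite ffunE gact1 invg1 sact1. Qed.

Fact coind_actM g h psi : coind_act (g * h)%g psi = coind_act g (coind_act h psi).
Proof. by apply/ffunP => x; rewrite !ffunE gactM invgM sactM. Qed.

Fact coind_actD g psi psi' :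
  coind_act g (psi + psi') = coind_act g psi + coind_act g psi'.
Proof. by apply/ffunP => x; rewrite !ffunE gactD. Qed.

Definition coind : gmodule G {ffun X -> M} :=
  GModule coind_act1 coind_actM coind_actD.

Definition constf (m : M) : {ffun X -> M} := [ffun=> m].

Lemma constf_equivariant : equivariant id a coind constf.
Proof.
split=> [m m'|g m]; first by apply/ffunP => x; rewrite !ffunE.
by apply/ffunP => x; rewrite /= /coind_act !ffunE.
Qed.
End Coinduced.
Arguments constf {X M} m.

Lemma coindE (G : groupType) (X : finType) (s : gset G X) (M : finZmodType)
    (a : gmodule G M) g psi x :
  nact (coind s a) g psi x = nact a g (psi (s g^-1%g x)).
Proof. by rewrite /= /coind_act ffunE. Qed.

Lemma pexp_mul (p k l : nat) (G : groupType) (g : G) :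
  (g ^+ (p ^ (k + l)) = (g ^+ (p ^ l)) ^+ (p ^ k))%g.
Proof. by rewrite expnD mulnC expgnA. Qed.

Lemma pmod_coind p (G : groupType) (X : finType) (s : gset G X)
    (M : finZmodType) (a : gmodule G M) :
  pset p s -> pmod p a -> pmod p (coind s a).
Proof.
move=> [k sk] [l [Ml al]]; exists (k + l)%N; split=> [psi|g psi].
  apply/ffunP => x; rewrite ffunMnE ffunE expnD mulnC mulrnA Ml.
  by rewrite mul0rn.
apply/ffunP => x; rewrite /= /coind_act ffunE -expVgn (pexp_mul p k l g^-1) sk.
by rewrite addnC pexp_mul al.
Qed.

(** The closure proof is a parameter of the type so that the instances below
    can be found by unification. *)
Record sub_zmod (W : finZmodType) (P : W -> bool) (closedP : zmod_closed P) :=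
  SubZmod { sub_val : W; sub_valP : P sub_val }.

Section SubModule.
Variables (W : finZmodType) (P : W -> bool) (closedP : zmod_closed P).

HB.instance Definition _ := [isSub for @sub_val W P closedP].
HB.instance Definition _ := [Countable of sub_zmod closedP by <:].
HB.instance Definition _ := [Finite of sub_zmod closedP by <:].
HB.instance Definition _ :=
  GRing.SubChoice_isSubZmodule.Build _ _ (sub_zmod closedP) closedP.
End SubModule.

(** * Classes that die in a coinduced module *)

Definition dies (p : nat) (G : groupType) (M : finZmodType) (a : gmodule G M)
    n (f : cochain G M n) : Prop :=
  exists (X : finType) (s : gset G X),
    [/\ pset p s, inhabited X & bdry (coind s a) (fun g => constf (f g))].

(** By Shapiro's lemma this says that each class of positive degree vanishes on
    a normal subgroup of p-power index. *)
Definition effaceable (p : nat) (G : groupType) : Prop :=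
  forall (M : finZmodType) (a : gmodule G M), pmod p a ->
  forall n (f : cochain G M n.+1), dif a f = 0 -> dies p a f.

(** [j] is dominated by the embedding of [M] as constant functions. *)
Definition coindlike (p : nat) (G : groupType) (M W : finZmodType)
    (a : gmodule G M) (b : gmodule G W) (j : M -> W) : Prop :=
  exists (Y : finType) (t : gset G Y) (iota : W -> {ffun Y -> M}),
    [/\ pset p t, inhabited Y, equivariant id b (coind t a) iota
      & forall m, iota (j m) = constf m].

Section ProductSet.
Variables (G : groupType) (X Y : Type) (s : gset G X) (t : gset G Y).

Fact prod_act1 (u : X * Y) : (s 1%g u.1, t 1%g u.2) = u.
Proof. by rewrite !sact1; case: u. Qed.

Fact prod_actM g h (u : X * Y) :
  (s (g * h)%g u.1, t (g * h)%g u.2) = (s g (s h u.1), t g (t h u.2)).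
Proof. by rewrite !sactM. Qed.

Definition prod_gset : gset G (X * Y) :=
  @GSet G (X * Y)%type (fun g u => (s g u.1, t g u.2)) prod_act1 prod_actM.

Lemma pset_prod p : pset p s -> pset p t -> pset p prod_gset.
Proof.
move=> [k sk] [l tl]; exists (k + l)%N => g [x y] /=.
by congr pair; [rewrite pexp_mul sk | rewrite addnC pexp_mul tl].
Qed.
End ProductSet.

(** Functions on X with values in functions on Y are functions on X * Y. *)
Lemma coind_iter (G : groupType) (X Y : finType) (s : gset G X) (t : gset G Y)
    (M W : finZmodType) (a : gmodule G M) (b : gmodule G W)
    (iota : W -> {ffun Y -> M}) :
  equivariant id b (coind t a) iota ->
  equivariant id (coind s b) (coind (prod_gset s t) a)
    (fun psi : {ffun X -> W} => [ffun u => iota (psi u.1) u.2]).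
Proof.
move=> [iD iE]; split=> [psi psi'|g psi]; apply/ffunP => u.
  by rewrite !ffunE iD ffunE.
by rewrite coindE !ffunE -iE coindE.
Qed.

Lemma coindlike_refl p (G : groupType) (M : finZmodType) (a : gmodule G M) :
  coindlike p a a id.
Proof.
exists unit, (@GSet G unit (fun _ x => x) (fun=> erefl) (fun _ _ _ => erefl)),
  constf; split=> //; first by exists 0%N.
exact: constf_equivariant.
Qed.

Lemma coindlike_constf p (G : groupType) (M W : finZmodType)
    (a : gmodule G M) (b : gmodule G W) j (X : finType) (s : gset G X) :
  pset p s -> inhabited X -> coindlike p a b j ->
  @coindlike p G M {ffun X -> W} a (coind s b) (fun m => constf (j m)).
Proof.
move=> ps [x0] [Y [t [iota [pt [y0] iE ij]]]].
exists (X * Y)%type, (prod_gset s t),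
  (fun psi : {ffun X -> W} => [ffun u => iota (psi u.1) u.2]); split.
- exact: pset_prod.
- by split; exact: (x0, y0).
- exact: coind_iter.
by move=> m; apply/ffunP => u; rewrite !ffunE ij ffunE.
Qed.

Lemma coindlike_dies p (G : groupType) (M W : finZmodType)
    (a : gmodule G M) (b : gmodule G W) j n (f : cochain G M n) :
  coindlike p a b j -> dies p b (fun g => j (f g)) -> dies p a f.
Proof.
move=> [Y [t [iota [pt [y0] iE ij]]]] [X [s [ps [x0] bf]]].
exists (X * Y)%type, (prod_gset s t); split; first exact: pset_prod.
  by split; exact: (x0, y0).
have := bdry_map (coind_iter s iE) bf; congr bdry; apply/funext => g.
by apply/ffunP => u; rewrite !ffunE ij ffunE.
Qed.

Lemma dies_bdry p (G : groupType) (M : finZmodType) (a : gmodule G M) n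
    (f F : cochain G M n) :
  bdry a (f - F) -> dies p a F -> dies p a f.
Proof.
move=> bfF [X [s [ps x0 bF]]]; exists X, s; split=> //.
have := bdryD (bdry_map (constf_equivariant s a) bfF) bF; congr bdry.
by apply/funext => g; apply/ffunP => x; rewrite funE !ffunE subrK.
Qed.

(** * Inflation from a quotient *)

Section Inflation.
Variables (G Q : groupType) (q : {multiplicative G -> Q}).
Hypothesis q_surj : forall y, exists x, q x = y.

Definition kernel (x : G) : Prop := q x = 1%g.

Lemma kernel_nsub : nsub kernel.
Proof.
split=> [|x y qx qy|x qx|x y qx]; rewrite /kernel ?mor1 //.
- by rewrite gmulfM qx qy mulg1.
- by rewrite morV qx invg1.
by rewrite morJ qx conj1g.
Qed.

Definition lift_q (y : Q) : G := xget 1%g [set x | q x = y].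

Lemma lift_qK : cancel lift_q q.
Proof.
move=> y; rewrite /lift_q; case: xgetP => // /(_ _)/= h.
by have [x] := q_surj y; move/h.
Qed.

Lemma kernel_div x y : q x = q y -> kernel (x^-1 * y)%g.
Proof. by move=> qxy; rewrite /kernel gmulfM morV qxy mulVg. Qed.

Fact pull_act1 X (s : gset Q X) x : s (q 1%g) x = x.
Proof. by rewrite mor1 sact1. Qed.

Fact pull_actM X (s : gset Q X) g h x :
  s (q (g * h)%g) x = s (q g) (s (q h) x).
Proof. by rewrite gmulfM sactM. Qed.

Definition pull_gset X (s : gset Q X) : gset G X :=
  @GSet G X (fun g => s (q g)) (pull_act1 s) (pull_actM s).

Lemma pset_pull p X (s : gset Q X) : pset p s -> pset p (pull_gset s).
Proof. by move=> [k sk]; exists k => g x /=; rewrite morX sk. Qed.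

Variables (W : finZmodType) (b : gmodule G W).

Definition fixed (w : W) : bool := `[< forall x, kernel x -> b x w = w >].

Fact fixed_closed : zmod_closed fixed.
Proof.
split=> [|v w]; rewrite !unfold_in.
  by apply/asboolP => x _; exact: (nact0 b).
move=> /asboolP fv /asboolP fw; apply/asboolP => x kx.
by rewrite gactB fv ?fw.
Qed.

Local Notation fixW := (sub_zmod fixed_closed).

Lemma fixedE (w : fixW) x y : q x = q y -> b x (val w) = b y (val w).
Proof.
move=> qxy; rewrite -[y](mulVKg x) gactM; congr (b x _).
by have /asboolP -> := valP w; last exact: kernel_div.
Qed.

Fact fixed_act_subproof y (w : fixW) : fixed (b (lift_q y) (val w)).
Proof.
apply/asboolP => x kx; rewrite -gactM; apply: fixedE.
by rewrite gmulfM kx mul1g.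
Qed.

Definition fixed_act y (w : fixW) : fixW := SubZmod _ (fixed_act_subproof y w).

Fact fixed_act1 w : fixed_act 1%g w = w.
Proof.
apply: val_inj; rewrite /= -[RHS](gact1 b); apply: fixedE.
by rewrite lift_qK mor1.
Qed.

Fact fixed_actM y z w : fixed_act (y * z)%g w = fixed_act y (fixed_act z w).
Proof.
apply: val_inj; rewrite /= -gactM; apply: fixedE.
by rewrite gmulfM !lift_qK.
Qed.

Fact fixed_actD y w w' :
  fixed_act y (w + w') = fixed_act y w + fixed_act y w'.
Proof. by apply: val_inj; rewrite /= gactD. Qed.

Definition fixed_gmodule : gmodule Q fixW :=
  GModule fixed_act1 fixed_actM fixed_actD.

Lemma fixed_gmoduleE x w : val (nact fixed_gmodule (q x) w) = nact b x (val w).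
Proof. by apply: fixedE; rewrite lift_qK. Qed.

Lemma pmod_fixed p : pmod p b -> pmod p fixed_gmodule.
Proof.
move=> [k [Wk bk]]; exists k; split=> [w|y w]; apply: val_inj.
  by rewrite raddfMn Wk.
by rewrite -[y]lift_qK -morX; apply: etrans (fixed_gmoduleE _ _) (bk _ _).
Qed.

Lemma fixed_equivariant : equivariant q fixed_gmodule b val.
Proof. by split=> // x w; rewrite -fixed_gmoduleE. Qed.

Lemma coind_fixed_equivariant (X : finType) (s : gset Q X) :
  equivariant q (coind s fixed_gmodule) (coind (pull_gset s) b)
    (fun psi : {ffun X -> fixW} => [ffun x => val (psi x)]).
Proof.
split=> [psi psi'|g psi]; apply/ffunP => x; first by rewrite !ffunE.
by rewrite coindE !ffunE -fixed_gmoduleE /= morV.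
Qed.

Lemma level_factor (V : Type) n (F : ('I_n -> G) -> V) :
  level kernel F -> forall g, F g = F (lift_q \o (q \o g)).
Proof. by move=> LF g; apply: LF => i; apply: kernel_div; rewrite /= lift_qK. Qed.

(** Such a cocycle takes values in the elements fixed by the kernel, hence it
    is inflated from [Q]. *)
Lemma level_dies p n (F : cochain G W n.+1) :
  effaceable p Q -> pmod p b -> level kernel F -> dif b F = 0 -> dies p b F.
Proof.
move=> effQ pb LF dF.
have fF g : fixed (F g).
  apply/asboolP => x kx.
  by apply: etrans (level_cocycle_fixed kernel_nsub LF dF _ kx) (gact1 b _).
pose F' : cochain Q fixW n.+1 := fun y => SubZmod _ (fF (lift_q \o y)).
have FE : F = (fun g => val (F' (q \o g))).
  by apply/funext => g; rewrite /= (level_factor LF).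
have dF' : dif fixed_gmodule F' = 0.
  apply/funext => y; apply: val_inj; have -> : y = q \o (lift_q \o y).
    by apply/funext => i /=; rewrite lift_qK.
  have := dif_natural F' fixed_equivariant; rewrite -FE dF.
  by move/(congr1 (fun u => u (lift_q \o y))) => <-.
have [X [s [ps x0 bF']]] := effQ _ _ (pmod_fixed pb) _ _ dF'.
exists X, (pull_gset s); split=> //; first exact: pset_pull.
have := bdry_natural (coind_fixed_equivariant s) bF'; congr bdry.
by apply/funext => g; apply/ffunP => x; rewrite !ffunE [in RHS]FE.
Qed.

End Inflation.

Section Descent.
Variables (G Q : groupType) (q : {multiplicative G -> Q}).
Hypothesis q_surj : forall y, exists x, q x = y.
Variables (M : zmodType) (a : gmodule G M).
Hypothesis a_ker : forall x m, kernel q x -> a x m = m.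

Lemma descentE x y m : q x = q y -> a x m = a y m.
Proof.
move=> qxy; rewrite -[y](mulVKg x) gactM.
by rewrite [a (x^-1 * y)%g m]a_ker //; exact: kernel_div.
Qed.

Fact descent_act1 m : a (lift_q q 1%g) m = m.
Proof. by rewrite a_ker // /kernel lift_qK. Qed.

Fact descent_actM y z m :
  a (lift_q q (y * z)%g) m = a (lift_q q y) (a (lift_q q z) m).
Proof. by rewrite -gactM; apply: descentE; rewrite gmulfM !lift_qK. Qed.

Definition descent_gmodule : gmodule Q M :=
  @GModule Q M (fun y => a (lift_q q y)) descent_act1 descent_actM
    (fun y => gactD a (lift_q q y)).

Lemma descent_gmoduleE x m : descent_gmodule (q x) m = a x m.
Proof. by apply: descentE; rewrite lift_qK. Qed.

Lemma descent_equivariant : equivariant q descent_gmodule a id.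
Proof. by split=> // x m; exact/esym/descent_gmoduleE. Qed.

Lemma pmod_descent p : pmod p a -> pmod p descent_gmodule.
Proof.
move=> [k [Mk ak]]; exists k; split=> // y m.
by rewrite -[y](lift_qK q_surj) -morX descent_gmoduleE.
Qed.

Lemma descent_cocycle n (F : cochain G M n) :
  level (kernel q) F -> dif a F = 0 ->
  dif descent_gmodule (fun y => F (lift_q q \o y)) = 0.
Proof.
move=> LF dF; apply/funext => y; have -> : y = q \o (lift_q q \o y).
  by apply/funext => i /=; rewrite lift_qK.
have := dif_natural (fun y => F (lift_q q \o y)) descent_equivariant.
have -> : (fun g : 'I_n -> G => F (lift_q q \o (q \o g))) = F.
  by apply/funext => g; rewrite -(level_factor q_surj LF).
by rewrite dF => /(congr1 (fun u => u (lift_q q \o y))) => <-.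
Qed.
End Descent.

(** The shape of all the induction steps: it is enough to make cocycles
    constant along the kernel of [q]. *)
Lemma effaceable_extension p (G Q : groupType) (q : {multiplicative G -> Q}) :
  (forall y, exists x, q x = y) -> effaceable p Q ->
  (forall (M : finZmodType) (a : gmodule G M), pmod p a ->
   forall n (f : cochain G M n.+1), dif a f = 0 ->
   exists (W : finZmodType) (b : gmodule G W) (j : M -> W),
     [/\ pmod p b, coindlike p a b j, equivariant id a b j &
       exists2 F : cochain G W n.+1, level (kernel q) F &
         bdry b ((fun g => j (f g)) - F)]) ->
  effaceable p G.
Proof.
move=> q_surj effQ H M a pa n f df.
have [W [b [j [pb cj jE [F LF bF]]]]] := H _ _ pa _ _ df.
apply: (coindlike_dies cj); apply: (dies_bdry bF); apply: (level_dies q_surj) => //.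
have := bdry_dif bF; rewrite difB (dif_map _ jE) df.
have -> : (fun g => j ((0 : cochain G M n.+2) g)) = (0 : cochain G W n.+2).
  by apply/funext => g; exact: (addf0 jE.1).
by rewrite sub0r => /(congr1 -%R); rewrite opprK oppr0.
Qed.

(** A cocycle constant along [S] dies explicitly in the functions on [G/S],
    and it does so through a cochain constant along [S].  The set [X], with
    its representatives [rep], plays the role of [G/S]. *)
Lemma level_dies_level (G : groupType) (S : G -> Prop) (M : finZmodType)
    (a : gmodule G M) (X : finType) (s : gset G X) (rep : X -> G) n
    (f : cochain G M n.+1) :
  nsub S -> (forall x m, S x -> a x m = m) ->
  (forall g x, S ((g * rep x)^-1 * rep (s g x))%g) ->
  level S f -> dif a f = 0 ->
  exists2 c : cochain G {ffun X -> M} n, level S c &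
    (fun g => constf (f g)) = dif (coind s a) c.
Proof.
move=> NS aS repE Lf df.
have aE x y m : S (x^-1 * y)%g -> a x m = a y m.
  by move=> Sxy; rewrite -[y](mulVKg x) gactM (aS _ m Sxy).
exists (fun h => [ffun x => a (rep x) (f (vcons (rep x)^-1%g h))]).
  move=> g h gh; apply/ffunP => x; rewrite !ffunE; congr (a _ _); apply: Lf.
  by apply: tcong_vcons => //; rewrite mulVg; exact: nsub1.
apply/funext => g; apply/ffunP => x; rewrite ffunE.
pose ev (psi : {ffun X -> M}) := psi x.
have evD : {morph ev : u v / u + v} by move=> u v; rewrite /ev ffunE.
set r := rep x.
have h0 : nact a r (dif a f (vcons r^-1%g g)) = 0 by rewrite df (nact0 a).
rewrite dif_vcons (nactN a) /dif !funE fun_sumE fun_mulzE in h0.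
rewrite !(nactD a) (addf_sum (nactD a _)) (addfMz (nactD a _)) in h0.
have {}h0 : f g = nact a r (f (vcons (r^-1 * g ord0)%g (vtail g))) +
    \sum_(i < n) nact a r (cur f (contract i g) r^-1%g) *~ (-1) ^+ i.+1 +
    nact a r (cur f (fun j => g (lift ord_max j)) r^-1%g) *~ (-1) ^+ n.+1.
  apply/esym/eqP; rewrite -subr_eq0; apply/eqP/oppr_inj; rewrite oppr0.
  rewrite -{2}h0; congr (- _).
  under [in RHS]eq_bigr do rewrite fun_mulzE (addfMz (nactD a _)).
  rewrite /cur -[fun j => g (lift ord0 j)]/(vtail g) vcons_eta.
  rewrite (nactN a) -(nactM a) mulgV.
  have -> : nact a 1%g (f g) = f g by exact: gact1.
  by rewrite -!addrA; congr (_ + _); rewrite [RHS]addrC !addrA.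
rewrite {}h0 -/(ev _) !evD (addf_sum evD) (addfMz evD); congr (_ + _ + _).
- rewrite /ev coindE ffunE -[gact a]/(nact a) -nactM.
  set y := s _ x; have Sy : S ((r^-1 * g ord0) * rep y)%g.
    by have := repE (g ord0)^-1%g x; rewrite invgM invgK.
  rewrite [RHS](aE _ r); last first.
    by have := nsubV NS Sy; rewrite !invgM invgK !mulgA.
  congr (nact a r _); apply: Lf; apply: tcong_vcons => //; last first.
    exact: tcong_refl.
  have := nsubV NS (nsubJ NS (rep y)^-1%g Sy).
  by rewrite /conjg invgK mulgK invgM.
- by apply: eq_bigr => i _; rewrite (addfMz evD) /ev ffunE.
by rewrite /ev ffunE.
Qed.

(** * Cyclic subgroups *)

Section IntegerPowers.
Variables (G : groupType) (z : G).

Lemma zpow0 : zpow z 0 = 1%g. Proof. by []. Qed.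
Lemma zpow1 : zpow z 1 = z. Proof. by []. Qed.

Lemma zpowN k : zpow z (- k) = (zpow z k)^-1%g.
Proof.
case: k => [[|n]|n]; first by rewrite oppr0 zpow0 invg1.
  by rewrite -NegzE.
by rewrite NegzE opprK /= invgK.
Qed.

Lemma zpowSr k : zpow z (k + 1) = (zpow z k * z)%g.
Proof.
case: k => n; first by rewrite -PoszD addn1 /= expgSr.
case: n => [|n]; first by rewrite NegzE addNr /= mulVg.
rewrite [in LHS]NegzE -{1}addn1 PoszD opprD addrNK zpowN /=.
by rewrite [in RHS]expgS invgM mulgVK.
Qed.

Lemma zpowD k l : zpow z (k + l) = (zpow z k * zpow z l)%g.
Proof.
elim/int_ind: l => [|n IH|n IH]; first by rewrite addr0 zpow0 mulg1.
  by rewrite -addn1 PoszD addrA !zpowSr IH mulgA.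
apply: (mulIg z); rewrite -zpowSr -mulgA -zpowSr -addn1 PoszD opprD.
by rewrite addrA !addrNK.
Qed.

Definition cyc (x : G) : Prop := exists k, x = zpow z k.

Lemma cyc_zpow k : cyc (zpow z k). Proof. by exists k. Qed.
Lemma cyc_exp n : cyc (z ^+ n)%g. Proof. by exists n%:Z. Qed.
Lemma cyc_gen : cyc z. Proof. by exists 1. Qed.
Lemma cyc1 : cyc 1%g. Proof. by exists 0. Qed.
Lemma cycM x y : cyc x -> cyc y -> cyc (x * y)%g.
Proof. by move=> [k ->] [l ->]; exists (k + l); rewrite zpowD. Qed.
Lemma cycV x : cyc x -> cyc x^-1%g.
Proof. by move=> [k ->]; exists (- k); rewrite zpowN. Qed.

Lemma zpow_central k x : (forall y, commute z y) -> commute (zpow z k) x.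
Proof.
move=> zC; case: k => n /=; first exact/commute_sym/commuteX/commute_sym.
by apply/commute_sym/commuteV/commuteX/commute_sym.
Qed.

(** Coordinates along the cosets of the subgroup generated by [z].  They are
    determined modulo the order of [z] only, hence the comparison of powers. *)
Lemma coset_coordinates : exists (rep : G -> G) (i : G -> int),
  (forall x, x = (rep x * zpow z (i x))%g) /\
  forall x k, zpow z (i (x * zpow z k)%g) = zpow z (i x + k).
Proof.
pose rep x := xget 1%g [set y | cyc (y^-1 * x)%g].
have repP x : cyc ((rep x)^-1 * x)%g.
  rewrite /rep; case: xgetP => [y _ //|/(_ x)/=].
  by rewrite mulVg => /(_ cyc1).
have [i iP] := choice repP; exists rep, i.
have E x : x = (rep x * zpow z (i x))%g by rewrite -iP mulVKg.
split=> // x k; have rE : rep (x * zpow z k)%g = rep x.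
  rewrite /rep; congr xget; apply/funext => y /=; apply/propext.
  rewrite mulgA; split=> [h|h]; last exact: cycM (cyc_zpow k).
  rewrite -[(y^-1 * x)%g](mulgK (zpow z k)).
  by apply: cycM => //; apply/cycV/cyc_zpow.
by apply: (mulgI (rep x)); rewrite -{1}rE -E zpowD mulgA -E.
Qed.

(** A derivation of a cyclic group is determined by its value at the
    generator. *)
Lemma cyc_inner (W : zmodType) (b : nmod G W) (phi : G -> W) (w : W) :
  phi 1%g = 0 ->
  (forall x y, cyc x -> cyc y -> phi (x * y)%g = phi x + b x (phi y)) ->
  phi z = b z w - w ->
  exists u, forall x, cyc x -> phi x = b x u - u.
Proof.
move=> phi1 phiM phiz; exists (b 1%g w); set u := b 1%g w.
have b1 x : cyc x -> b 1%g (phi x) = phi x.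
  by move=> cx; rewrite -[in RHS](mul1g x) phiM ?phi1 ?add0r //; exact: cyc1.
have phizu : phi z = b z u - u.
  by rewrite -b1 ?phiz ?nactB -?nactM ?mul1g ?mulg1 //; exact: cyc_gen.
have pos n : phi (z ^+ n)%g = b (z ^+ n)%g u - u.
  elim: n => [|n IH].
    by rewrite expg0 phi1 /u -nactM mulg1 subrr.
  rewrite expgS phiM ?IH ?phizu ?nactB ?nactM; last 2 first.
  - exact: cyc_gen.
  - exact: cyc_exp.
  by rewrite addrC addrA subrK.
move=> _ [[n|n] ->]; first exact: pos.
set c := (z ^+ n.+1)%g; have cc : cyc c^-1%g by exact/cycV/cyc_exp.
have := phiM _ _ cc (cyc_exp n.+1); rewrite mulVg phi1 => /esym/eqP.
rewrite addr_eq0 => /eqP -> /=; rewrite pos nactB -nactM mulVg.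
by rewrite {1}/u -nactM mulg1 opprB.
Qed.

Lemma killsn_cyc (V W : zmodType) (a : nmod G V) (b : nmod G W) j :
  equivariant id a b j ->
  (forall phi : G -> V, phi 1%g = 0 ->
     (forall x y, cyc x -> cyc y -> phi (x * y)%g = phi x + a x (phi y)) ->
     exists w, j (phi z) = b z w - w) ->
  killsn cyc 0 a b j.
Proof.
move=> [jD jE] H phi phi1 phiM; have [w jw] := H phi phi1 phiM.
apply: (@cyc_inner W b (fun x => j (phi x)) w) => //.
  by rewrite phi1 (addf0 jD).
by move=> x y cx cy; rewrite phiM // jD jE.
Qed.

End IntegerPowers.

Section Kills.
Variables (G : groupType) (S : G -> Prop).

Lemma killsn_source q : forall (V W : zmodType) (a : nmod G V) (b : nmod G W) j,
  equivariant id a b j -> killsn S q a a id -> killsn S q a b j.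
Proof.
elim: q => [|q IH] V W a b j jE /=.
  move=> k phi phi1 phiM; have [w wP] := k phi phi1 phiM.
  by exists (j w) => x Sx; rewrite wP // (addfB jE.1) jE.2.
by move=> k; apply: IH => //; exact: twist_equivariant.
Qed.

Lemma killsn_target q : forall (V W : zmodType) (a : nmod G V) (b : nmod G W) j,
  equivariant id a b j -> killsn S q b b id -> killsn S q a b j.
Proof.
elim: q => [|q IH] V W a b j jE /=.
  move=> k phi phi1 phiM; apply: k => [|x y Sx Sy].
    by rewrite phi1 (addf0 jE.1).
  by rewrite phiM // jE.1 jE.2.
by move=> k; apply: IH => //; exact: twist_equivariant.
Qed.
End Kills.

(** * Infinite cyclic subgroups *)

Section InfiniteCyclic.
Variables (G : groupType) (z : G).
Hypothesis z_inf : forall k, zpow z k = 1%g -> k = 0.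

(** Functions on [G] form a coinduced module of the infinite cyclic group, whose
    first cohomology vanishes: the difference equation is solved by summing
    along each coset. *)
Lemma shift_solve (V : zmodType) (psi : G -> V) :
  exists h : G -> V, forall x, h (x * z)%g - h x = psi x.
Proof.
have [rep [i [E iE]]] := coset_coordinates z.
have inj k l : zpow z k = zpow z l -> k = l.
  move=> kl; apply/eqP; rewrite -subr_eq0; apply/eqP/z_inf.
  by rewrite zpowD zpowN kl mulgV.
have iS x : i (x * z)%g = i x + 1 by exact: inj (iE x 1).
have rS x : rep (x * z)%g = rep x.
  apply: (mulIg (zpow z (i (x * z)%g))); rewrite -E iS zpowD mulgA -E.
  by [].
pose s t (k : int) := match k with
  | Posz n => \sum_(j < n) psi (t * zpow z j)%g
  | Negz n => - \sum_(j < n.+1) psi (t * zpow z (Negz j))%g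
  end.
have sS t k : s t (k + 1) - s t k = psi (t * zpow z k)%g.
  case: k => n; first by rewrite -PoszD addn1 /= big_ord_recr /= [LHS]addrC addKr.
  case: n => [|n].
    by rewrite NegzE addNr /= big_ord0 big_ord_recl big_ord0 addr0 sub0r opprK.
  have -> : Negz n.+1 + 1 = Negz n.
    by rewrite !NegzE -[in LHS]addn1 PoszD opprD addrNK.
  by rewrite /= [X in _ - - X]big_ord_recr /= opprK addKr.
exists (fun x => s (rep x) (i x)) => x.
by rewrite rS iS sS -E.
Qed.

Lemma killsn_infinite q : forall (V : zmodType) (a : nmod G V),
  killsn (cyc z) q (twist a) (twist a) id.
Proof.
elim: q => [|q IH] V a; last exact: (IH _ (twist a)).
apply: killsn_cyc => // phi phi1 phiM.
set psi := phi z; have [h hP] := shift_solve psi.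
have psi1 x : a x (psi 1%g) = 0.
  have := phiM _ _ (cyc1 z) (cyc_gen z); rewrite mul1g phi1 add0r -/psi.
  move=> /(congr1 (fun u => u x)); rewrite /twist /= mulg1.
  by move/eqP; rewrite -subr_eq0 opprD opprK addrA subrr add0r => /eqP.
exists (fun x => h x - h 1%g); apply/funext => x.
change (psi x = (h (x * z)%g - h 1%g) - a x (h z - h 1%g) - (h x - h 1%g)).
have -> : h z - h 1%g = psi 1%g by rewrite -hP mul1g.
by rewrite psi1 subr0 opprB addrA subrK hP.
Qed.

End InfiniteCyclic.

(** * Weakly projective modules for a finite cyclic subgroup *)

Section WeaklyProjective.
Variables (G : groupType) (z : G) (r : nat).
Hypothesis zr : (z ^+ r)%g = 1%g.

(** The identity is a norm from the additive endomorphisms of the module. *)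
Definition wproj (V : zmodType) (a : nmod G V) : Prop :=
  exists2 theta : V -> V, {morph theta : v w / v + w} &
    forall v, \sum_(i < r) a (z ^+ i)%g (theta (a (z ^- i)%g v)) = a 1%g v.

(** The element bounding a derivation phi of a finite cyclic group is its
    average, the sum of z^i theta(z^-i phi(z^i)) with the sign changed. *)
Lemma wproj_killsn0 (V : zmodType) (a : nmod G V) :
  wproj a -> killsn (cyc z) 0 a a id.
Proof.
move=> [theta tD tP]; apply: killsn_cyc => // phi phi1 phiM.
pose T i := a (z ^+ i)%g (theta (a (z ^- i)%g (phi (z ^+ i)%g))).
exists (- \sum_(i < r) T i).
rewrite nactN (addf_sum (nactD a z)) opprK.
have TS i : a z (T i) =
    T i.+1 - a (z ^+ i.+1)%g (theta (a (z ^- i.+1)%g (phi z))).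
  rewrite /T -nactB -(addfB tD) -nactB expgS phiM; last 2 first.
  - exact: cyc_gen.
  - exact: cyc_exp.
  rewrite [phi z + _]addrC addrK -!nactM; congr (a _ (theta (a _ _))).
  by rewrite invgM mulgVK.
under eq_bigr do rewrite TS.
rewrite sumrB opprB -addrA [- \sum_(i < r) T i.+1 + _]addrC addrA.
have shift (F : nat -> V) : F r = F 0%N -> \sum_(i < r) F i.+1 = \sum_(i < r) F i.
  move=> Fr; apply: (addrI (F 0%N)); rewrite -{2}Fr.
  by rewrite -(big_ord_recl r (fun i => F i)) big_ord_recr /= addrC.
rewrite (shift T); last by rewrite /T zr expg0.
rewrite (shift (fun i => a (z ^+ i)%g (theta (a (z ^- i)%g (phi z)))));
  last by rewrite zr expg0.
rewrite addrK tP -[in LHS](mul1g z) phiM ?phi1 ?add0r //; first exact: cyc1.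
exact: cyc_gen.
Qed.

(** The weight [chi] takes care of the part of [V] on which 1 acts as zero;
    on the other part the endomorphism is conjugated pointwise. *)
Lemma wproj_twist (chi : G -> nat) (V : zmodType) (a : nmod G V) :
  (forall x, \sum_(i < r) chi (x * z ^+ i)%g = 1%N) ->
  wproj a -> wproj (twist a).
Proof.
move=> chiE [theta tD tP]; pose e v := v - a 1%g v.
have ea x v : e (a x v) = 0 by rewrite /e -nactM mul1g subrr.
have ae x v : a x (e v) = 0 by rewrite /e nactB -nactM mulg1 subrr.
have eD : {morph e : v w / v + w}.
  by move=> v w; rewrite /e nactD opprD addrACA.
exists (fun phi x => a x (theta (a x^-1%g (phi x))) + e (phi x) *+ chi x).
  move=> phi psi; apply/funext => x; rewrite !funE.
  by rewrite nactD tD nactD eD mulrnDl addrACA.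
move=> phi; apply/funext => x; rewrite fun_sumE.
rewrite [RHS]/(phi (x * 1)%g - a x (phi 1%g)) mulg1.
transitivity (\sum_(i < r) (a x (a (z ^+ i)%g (theta (a (z ^- i)%g
   (a x^-1%g (phi x))))) - a x (a (z ^+ i)%g (theta (a (z ^- i)%g (phi 1%g))))
   + e (phi x) *+ chi (x * z ^+ i)%g)).
  apply: eq_bigr => i _; set c := (z ^+ i)%g.
  pose psi y := phi (y * c^-1)%g - a y (phi c^-1%g).
  change (a (x * c)%g (theta (a (x * c)^-1%g (psi (x * c)%g))) +
    e (psi (x * c)%g) *+ chi (x * c)%g -
    a x (a c (theta (a c^-1%g (psi c))) + e (psi c) *+ chi c) = 
    a x (a c (theta (a c^-1%g (a x^-1%g (phi x))))) -
    a x (a c (theta (a c^-1%g (phi 1%g)))) + e (phi x) *+ chi (x * c)%g).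
  rewrite /psi mulgK mulgV (addfB eD) ea subr0.
  rewrite !nactB (nactD a x) (addfMn (nactD a x)) ae mul0rn addr0.
  rewrite -!nactM !mulVg invgM !(addfB tD) !nactB opprB.
  by rewrite [LHS](AC (3*2) (1*5*3*4*2)) /= addrK.
rewrite big_split sumrB /= -!(addf_sum (nactD a x)) !tP -!nactM !mulg1 mulgV.
by rewrite sumrMnr chiE mulr1n /e addrC addrA subrK.
Qed.

Lemma wproj_killsn (chi : G -> nat) q : 
  (forall x, \sum_(i < r) chi (x * z ^+ i)%g = 1%N) ->
  forall (V : zmodType) (a : nmod G V), wproj a -> killsn (cyc z) q a a id.
Proof.
move=> chiE; elim: q => [|q IH] V a wa; first exact: wproj_killsn0.
exact/IH/(wproj_twist chiE).
Qed.

End WeaklyProjective.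

(** * Limits along an ultrafilter *)

Lemma directed_ultra (T : Type) (R : T -> T -> Prop) :
  inhabited T -> (forall s, R s s) ->
  (forall s t, exists u, forall v, R u v -> R s v /\ R t v) ->
  exists F : set_system T, UltraFilter F /\ forall s, F (R s).
Proof.
move=> [t0] Rr Rd.
have FF : ProperFilter (filter_from [set: T] R).
  apply: filter_from_proper => [|s _]; last by exists s; exact: Rr.
  apply: filter_fromT_filter; first by exists t0.
  by move=> s t; have [u uP] := Rd s t; exists u => v /uP[].
have [F [FU sF]] := ultraFilterLemma FF.
by exists F; split=> // s; apply: sF; exists s.
Qed.

Section UltraLimit.
Variables (T : Type) (F : set_system T).
Context {FU : UltraFilter F}.

Lemma ultra_finite (X : finType) (h : T -> X) :
  exists x : X, F [set t : T | h t = x].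
Proof.
suff H (s : seq X) :
    F [set t : T | h t \in s] -> exists x : X, F [set t : T | h t = x].
  apply: (H (enum X)); apply: filterS filterT => t _ /=.
  by rewrite mem_enum.
elim: s => [|x s IH] Fs.
  by have [t /=] := filter_ex Fs; rewrite in_nil.
have [Fx|Fnx] := in_ultra_setVsetC [set t | h t = x] FU; first by exists x.
apply: IH; apply: filterS (filterI Fs Fnx) => t /= [].
by rewrite inE => /predU1P[].
Qed.

Lemma ultra_uniq (X : Type) (h : T -> X) x y :
  F [set t : T | h t = x] -> F [set t : T | h t = y] -> x = y.
Proof.
by move=> Fx Fy; have [t /= [<- <-]] := filter_ex (filterI Fx Fy).
Qed.

(** An additive, equivariant retraction of the families onto the constant
    ones that sees only what happens almost everywhere. *)
Record limop (G : groupType) (V : zmodType) (a : nmod G V) (L : (T -> V) -> V)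
    : Prop := LimOp {
  limD : forall h k, L (fun t => h t + k t) = L h + L k;
  limE : forall g h, L (fun t => a g (h t)) = a g (L h);
  lim_ae : forall h v, F [set t : T | h t = v] -> L h = v
}.

(** A function to a finite set is constant almost everywhere. *)
Lemma limop_finite (G : groupType) (M : finZmodType) (a : nmod G M) :
  exists L, limop a L.
Proof.
have [L LP] := choice (fun h : T -> M => ultra_finite h).
have Leq h v : F [set t : T | h t = v] -> L h = v by exact/ultra_uniq/LP.
exists L; split=> // [h k|g h]; apply: Leq.
  by apply: filterS (filterI (LP h) (LP k)) => t /= [-> ->].
by apply: filterS (LP h) => t /= ->.
Qed.

Lemma limop_twist (G : groupType) (V : zmodType) (a : nmod G V) L :
  limop a L -> limop (twist a) (fun h x => L (fun t => h t x)).
Proof.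
move=> [LD LE Lae]; split=> [h k|g h|h v Fh]; apply/funext => x.
- exact: LD.
- have LN h' : L (fun t => - h' t) = - L h'.
    by apply: (addIr (L h')); rewrite addNr -LD; apply: Lae;
       apply: filterS filterT => t _ /=; rewrite addNr.
  by rewrite /twist /= LD LN LE.
by apply: Lae; apply: filterS Fh => t /= ->.
Qed.

Lemma lim_dif (G : groupType) (V : zmodType) (a : nmod G V) L n
    (c : T -> cochain G V n) :
  limop a L ->
  dif a (fun g => L (fun t => c t g)) = (fun g => L (fun t => dif a (c t) g)).
Proof.
move=> [LD LE _]; apply/funext => g; have LD' : {morph (L : (T -> V) -> V) :
  h k / (h + k) >-> h + k} by move=> h k; exact: LD.
rewrite [RHS](_ : _ = L ((fun t => a (g ord0) (c t (vtail g))) +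
  \sum_(i < n) (fun t => c t (contract i g)) *~ (-1) ^+ i.+1 +
  (fun t => c t (fun j => g (lift ord_max j))) *~ (-1) ^+ n.+1)).
  rewrite !LD' LE (addf_sum LD') (addfMz LD'); congr (_ + _ + _).
  by apply: eq_bigr => i _; rewrite (addfMz LD').
congr L; apply/funext => t; rewrite !funE fun_sumE fun_mulzE.
by congr (_ + _ + _); apply: eq_bigr => i _; rewrite fun_mulzE.
Qed.
End UltraLimit.

(** * Uniquely p-divisible central subgroups *)

Lemma zpow_exp (G : groupType) (x : G) n k :
  zpow (x ^+ n)%g k = (zpow x k ^+ n)%g.
Proof.
case: k => m /=; first exact: expgnAC.
by rewrite expgnAC expVgn.
Qed.

Lemma zpowMn (G : groupType) (x : G) n k : zpow x (k *+ n) = (zpow x k ^+ n)%g.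
Proof.
elim: n => [|n IH]; first by rewrite mulr0n expg0.
by rewrite mulrS zpowD IH expgS.
Qed.

Lemma zpowM (G : groupType) (x : G) k l : zpow x (k * l) = zpow (zpow x k) l.
Proof.
case: l => n; first by rewrite /= -zpowMn -mulrzz.
by rewrite NegzE mulrN !zpowN /= -zpowMn -mulrzz.
Qed.

Lemma cyc_trans (G : groupType) (x y z : G) : cyc x y -> cyc y z -> cyc x z.
Proof.
move=> [k ->] [l ->]; case: l => n /=; first by exists (k *+ n); rewrite zpowMn.
by exists (- (k *+ n.+1)); rewrite zpowN zpowMn.
Qed.

Section UniquelyDivisible.
Variables (p : nat) (p_pr : prime p) (G : groupType) (U : G -> Prop).
Hypotheses (NU : nsub U) (UC : forall u x, U u -> commute u x).
Hypothesis Udiv : forall u, U u -> exists2 v, U v & (v ^+ p = u)%g.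
Hypothesis Utf : forall u, U u -> (u ^+ p = 1)%g -> u = 1%g.

Lemma nsubX u n : U u -> U (u ^+ n)%g.
Proof.
by move=> Uu; elim: n => [|n IH]; rewrite ?expg0 ?expgS; [exact: nsub1|exact: nsubM].
Qed.

Lemma nsub_zpow u k : U u -> U (zpow u k).
Proof.
by move=> Uu; case: k => n /=; [|apply: nsubV => //]; exact: nsubX.
Qed.

Lemma Utfn n u : U u -> (u ^+ (p ^ n) = 1)%g -> u = 1%g.
Proof.
elim: n u => [|n IH] u Uu; first by rewrite expn0 expg1.
by rewrite expnSr expgnA => /Utf h; apply: (IH _ Uu); apply: h; exact: nsubX.
Qed.

(** The p-isolator in [U] of the subgroup generated by [v]. *)
Definition hull v x := U x /\ exists k, cyc v (x ^+ (p ^ k))%g.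

Lemma hull_nsub v : nsub (hull v).
Proof.
split=> [|x y [Ux [k xk]] [Uy [l yl]]|x [Ux [k xk]]|x y [Ux [k xk]]].
- by split; [exact: nsub1 | exists 0%N; rewrite expg1n; exact: cyc1].
- split; [exact: nsubM | exists (k + l)%N].
  rewrite expgMn; last exact: UC.
  rewrite pexp_mul addnC pexp_mul; apply: cycM.
    by rewrite -pexp_mul addnC pexp_mul; apply: cyc_trans xk (cyc_exp _ _).
  by rewrite -pexp_mul addnC pexp_mul; apply: cyc_trans yl (cyc_exp _ _).
- by split; [exact: nsubV | exists k; rewrite expVgn; exact: cycV].
have -> : (x ^ y = x)%g by rewrite /conjg (UC y Ux) mulKg.
by split=> //; exists k.
Qed.

Lemma hull_gen v : U v -> hull v v.
Proof. by move=> Uv; split=> //; exists 0%N; rewrite expg1; exact: cyc_gen. Qed.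

Section Roots.
Variable v : G.
Hypothesis Uv : U v.

Lemma roots_ex : exists w : nat -> G,
  [/\ w 0%N = v, forall k, U (w k) & forall k, (w k.+1 ^+ p = w k)%g].
Proof.
have [rt rtP] : exists rt : G -> G, forall u, U u -> U (rt u) /\ (rt u ^+ p = u)%g.
  suff /choice[rt rtP] : forall u, exists w, U u -> U w /\ (w ^+ p = u)%g.
    by exists rt.
  move=> u; case: (pselect (U u)) => [/Udiv[w Uw wu]|nU]; last by exists 1%g.
  by exists w.
have Uw k : U (iter k rt v) by elim: k => //= k IH; exact: (rtP _ IH).1.
by exists (fun k => iter k rt v); split=> // k; exact: (rtP _ (Uw k)).2.
Qed.

Variable w : nat -> G.
Hypotheses (w0 : w 0%N = v) (Uw : forall k, U (w k)).
Hypothesis wS : forall k, (w k.+1 ^+ p = w k)%g.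

Lemma rootsX k l : (w (k + l)%N ^+ (p ^ l) = w k)%g.
Proof.
elim: l => [|l IH]; first by rewrite addn0 expg1.
by rewrite addnS expnS expgnA wS.
Qed.

Lemma cyc_roots k l : (k <= l)%N -> cyc (w l) (w k).
Proof. by move=> kl; rewrite -(rootsX k (l - k)) subnKC //; exact: cyc_exp. Qed.

Lemma hull_roots x : hull v x -> exists k, forall l, (k <= l)%N -> cyc (w l) x.
Proof.
move=> [Ux [k [j xj]]]; exists k => l kl; apply: cyc_trans (cyc_roots kl) _.
exists j; apply: divg1_eq; apply: (@Utfn k).
  by apply: nsubM => //; apply: nsubV => //; exact: nsub_zpow.
rewrite expgMn; last exact: UC.
rewrite xj expVgn -zpow_exp; have := rootsX 0 k; rewrite add0n w0 => ->.
by rewrite mulgV.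
Qed.

Lemma hull_cyc_roots k x : cyc (w k) x -> hull v x.
Proof.
move=> [j ->]; split; first exact: nsub_zpow.
exists k; rewrite -zpow_exp; have := rootsX 0 k; rewrite add0n w0 => ->.
exact: cyc_zpow.
Qed.

(** Whether a derivation is inner on each of the cyclic groups whose union is
    the isolator. *)
Definition locally_inner (V : zmodType) (a : nmod G V) : Prop :=
  forall k (phi : G -> V), phi 1%g = 0 ->
  (forall x y, hull v x -> hull v y -> phi (x * y)%g = phi x + a x (phi y)) ->
  exists h, phi (w k) = a (w k) h - h.

(** [U] has no p-torsion. *)
Lemma root_order k : (forall j, zpow (w k) j = 1%g -> j = 0) \/
  exists r, [/\ (0 < r)%N, coprime p r & (w k ^+ r = 1)%g].
Proof.
case: (pselect (exists2 r, (0 < r)%N & (w k ^+ r = 1)%g)) => [[r r0 wr]|nr].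
  right; exists (r`_(p^'))%N; split; first exact: part_gt0.
    by apply: (@pnat_coprime p); [exact: pnat_id | exact: part_pnat].
  apply: (@Utfn (logn p r)); first exact: nsubX.
  by rewrite -expgnA -p_part mulnC partnC.
left=> [[[|n]|n]] //= wn; case: nr; exists n.+1 => //.
by rewrite -[LHS]invgK wn invg1.
Qed.

(** In infinite order, the twisted module is coinduced; in finite order, which
    is prime to p, one can average because a multiple of the order is 1 modulo
    the exponent. *)
Lemma locally_inner_twist e (V : zmodType) (a : nmod G V) :
  (forall x : V, x *+ (p ^ e) = 0) -> locally_inner (twist a).
Proof.
move=> Ve k phi phi1 phiM.
have phiM' x y : cyc (w k) x -> cyc (w k) y ->
    phi (x * y)%g = phi x + twist a x (phi y).
  by move=> cx cy; apply: phiM; apply: (@hull_cyc_roots k).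
suff [h hP] : exists h, forall x, cyc (w k) x -> phi x = twist a x h - h.
  by exists h; rewrite hP //; exact: cyc_gen.
have [w_inf|[r [r0 pr wr]]] := root_order k.
  exact: (@killsn_infinite G (w k) w_inf 0 V a) phi1 phiM'.
suff wp : wproj (w k) r (twist a) by exact: (wproj_killsn0 wr wp) phi1 phiM'.
have [u uE] : exists u, u * r = 1 %[mod p ^ e].
  have cpr : coprime (p ^ e) r by exact: coprimeXl.
  exists (chinese (p ^ e) r 1 0 %/ r)%N.
  rewrite divnK; first exact: chinese_modl.
  by rewrite /dvdn (chinese_modr cpr) mod0n.
have Ve' (f : G -> V) c d : c = d %[mod p ^ e] -> f *+ c = f *+ d.
  move=> cd; rewrite (divn_eq c (p ^ e)) (divn_eq d (p ^ e)) cd !mulrnDr.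
  suff E m : f *+ (m * p ^ e) = 0 by rewrite !E.
  rewrite mulrnA; apply/funext => x.
  by rewrite fun_mulnE Ve.
exists (fun f => f *+ u) => [f h|f]; first exact: mulrnDl.
under eq_bigr do rewrite (addfMn (nactD _ _)) -nactM mulgV.
by rewrite sumr_const card_ord -mulrnA -[RHS]mulr1n; exact: Ve'.
Qed.

(** A derivation is now a homomorphism from a p-divisible group to a group of
    bounded p-power exponent. *)
Lemma locally_inner_trivial e (V : zmodType) (a : nmod G V) :
  (forall x : V, x *+ (p ^ e) = 0) ->
  (forall x m, hull v x -> a x m = m) -> locally_inner a.
Proof.
move=> Ve triv k phi phi1 phiM; exists 0; rewrite nact0 subr0.
rewrite -(rootsX k e); set y := w _.
suff E n : phi (y ^+ n)%g = phi y *+ n by rewrite E.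
have hy i : hull v (y ^+ i)%g.
  by apply: (@hull_cyc_roots (k + e)%N); exact: cyc_exp.
elim: n => [|n IH]; first by rewrite expg0.
have hy1 : hull v y by have := hy 1%N; rewrite expg1.
by rewrite expgS phiM // triv // IH mulrS.
Qed.

(** The elements that make the derivation inner on the cyclic subgroups need
    not be compatible, but they have a limit. *)
Lemma locally_inner_killsn0 (V : zmodType) (a : nmod G V) :
  (forall F : set_system nat, UltraFilter F -> exists L, limop F a L) ->
  locally_inner a -> killsn (hull v) 0 a a id.
Proof.
move=> limV innV phi phi1 phiM.
have /choice[u uP] : forall k, exists u, forall x, cyc (w k) x ->
    phi x = a x u - u.
  move=> k; have [h hP] := innV k phi phi1 phiM.
  apply: cyc_inner hP => // x y cx cy.
  by apply: phiM; apply: (@hull_cyc_roots k).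
have [||s t|F [FU FR]] := @directed_ultra nat (fun k l => (k <= l)%N).
- by split; exact: 0%N.
- by [].
- exists (maxn s t) => l; rewrite geq_max => /andP[]; by split.
have [L LP] := limV F FU; exists (L u) => x hx.
have [k kP] := hull_roots hx.
have -> : phi x = L (fun l => a x (u l) - u l).
  apply/esym/(lim_ae LP); apply: filterS (FR k) => l kl /=.
  by rewrite -uP //; exact: kP.
apply/eqP; rewrite eq_sym subr_eq -(limE LP) -(limD LP); apply/eqP; congr L.
by apply/funext => l; rewrite subrK.
Qed.

Lemma hull_killsn_twist q : forall e (V : zmodType) (a : nmod G V),
  (forall F : set_system nat, UltraFilter F -> exists L, limop F a L) ->
  (forall x : V, x *+ (p ^ e) = 0) -> killsn (hull v) q (twist a) (twist a) id.
Proof.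
elim: q => [|q IH] e V a limV Ve.
  apply: locally_inner_killsn0; last exact: locally_inner_twist Ve.
  move=> F FU; have [L LP] := limV F FU.
  by exists (fun h x => L (fun t => h t x)); exact: limop_twist.
apply: (IH e (G -> V : zmodType) (twist a)) => [F FU|f].
  have [L LP] := limV F FU.
  by exists (fun h x => L (fun t => h t x)); exact: limop_twist.
apply/funext => x.
by rewrite fun_mulnE Ve.
Qed.
End Roots.

Lemma hull_killsn q v e (M : finZmodType) (a : nmod G M) :
  U v -> (forall x : M, x *+ (p ^ e) = 0) ->
  (forall x m, U x -> a x m = m) -> killsn (hull v) q a a id.
Proof.
move=> Uv Me triv; have [w [w0 Uw wS]] := roots_ex Uv.
have limM (F : set_system nat) : UltraFilter F -> exists L, limop F a L.
  by move=> FU; exact: limop_finite.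
case: q => [|q]; last exact: (hull_killsn_twist w0 Uw wS q limM Me).
apply: (locally_inner_killsn0 w0 Uw wS limM).
by apply: (locally_inner_trivial w0 Uw wS Me) => x m [Ux _]; exact: triv.
Qed.

End UniquelyDivisible.

(** * Quotients by normal subgroups *)

Section NormalOf.
Variables (G : groupType) (S : G -> Prop) (NS : nsub S).

Fact normal_of_group : group_closed (fun x : G => `[< S x >]).
Proof.
split=> [|x y]; rewrite !unfold_in.
  by apply/asboolP; exact: nsub1.
move=> /asboolP Sx /asboolP Sy; apply/asboolP.
by apply: nsubM => //; exact: nsubV.
Qed.

Fact normal_of_normal x y : `[< S x >] -> `[< S (x ^ y)%g >].
Proof. by move=> /asboolP Sx; apply/asboolP; exact: nsubJ. Qed.

Definition normal_of : normal_subgroup G :=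
  NormalSubgroup normal_of_group normal_of_normal.

Lemma normal_ofP x : x \in normal_of <-> S x.
Proof. by split=> /asboolP. Qed.
End NormalOf.

Lemma nsub_normal (G : groupType) (N : normal_subgroup G) :
  nsub (fun x => x \in N).
Proof.
split=> [|x y|x|x y]; [exact: gpred1 | exact: gpredM | by rewrite gpredV|].
exact: (@gpredJ_normal G N).
Qed.

Lemma qpi_surj (G : groupType) (N : normalClosed G) (u : quotient_group N) :
  exists x, qpi N x = u.
Proof. by exists (repr u); exact: qpiK. Qed.

Lemma qpi_eq (G : groupType) (N : normalClosed G) x y :
  qpi N x = qpi N y <-> (x^-1 * y)%g \in N.
Proof. by split=> [/eqP|h]; [|apply/eqP]; rewrite eq_cosetE. Qed.

Lemma qpi_mul (G : groupType) (N : normalClosed G) x y :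
  qpi N (x * y)%g = (qpi N x * qpi N y)%g.
Proof. exact: gmulfM. Qed.

Lemma qpi_kernel (G : groupType) (N : normalClosed G) x :
  kernel (qpi N) x <-> x \in N.
Proof.
rewrite /kernel -[1%g]/(qpi N 1%g); split=> [/qpi_eq|Nx]; last apply/qpi_eq.
  by rewrite mulg1 gpredV.
by rewrite mulg1 gpredV.
Qed.

(** * Making cocycles constant along a uniquely p-divisible subgroup *)

Definition uniquely_divisible p (G : groupType) (U : G -> Prop) : Prop :=
  (forall u, U u -> exists2 v, U v & (v ^+ p = u)%g) /\
  (forall u, U u -> (u ^+ p = 1)%g -> u = 1%g).

Definition centralP (G : groupType) (U : G -> Prop) : Prop :=
  forall u x, U u -> commute u x.

Lemma kill_chain_id (G : groupType) (S : G -> Prop) n (V : zmodType)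
    (a : nmod G V) : (forall q, killsn S q a a id) -> kill_chain S n a a id.
Proof.
have idE : equivariant id a a id by split.
by move=> k; elim: n => //= n IH; exists V, a, id, id; split.
Qed.

Lemma divisible_root p (G : groupType) (U : G -> Prop) k x :
  uniquely_divisible p U -> U x -> exists2 y, U y & (y ^+ (p ^ k) = x)%g.
Proof.
move=> [Udiv _] Ux; elim: k => [|k [y Uy yx]]; first by exists x; rewrite ?expg1.
have [z Uz zy] := Udiv y Uy; exists z => //.
by rewrite expnS expgnA zy.
Qed.

(** Every element is a p^k-th power. *)
Lemma divisible_trivial p (G : groupType) (U : G -> Prop) (M : zmodType)
    (a : gmodule G M) :
  uniquely_divisible p U -> pmod p a -> forall x m, U x -> a x m = m.
Proof.
move=> dU [k [_ ak]] x m Ux.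
by have [y _ <-] := divisible_root k dU Ux; exact: ak.
Qed.

Section DivisibleLevel.
Variables (p : nat) (p_pr : prime p).

(** One isolated generator at a time, passing to the quotient. *)
Lemma divisible_level_seq N : forall (G : groupType) (U : G -> Prop)
    (M : finZmodType) (a : gmodule G M) n (f : cochain G M n) (vs : seq G),
  nsub U -> centralP U -> uniquely_divisible p U -> pmod p a ->
  dif a f = 0 -> size vs = N -> (forall v, v \in vs -> U v) ->
  exists2 F, level (fun x => x = 1%g \/ x \in vs) F & bdry a (f - F).
Proof.
elim: N => [|N IH] G U M a n f vs NU UC dU pa df.
  move/size0nil => -> _; exists f; last by rewrite subrr; exact: bdry0.
  move=> g h gh; congr f; apply/funext => i.
  have [gh1|] := gh i; last by rewrite in_nil.
  by rewrite -[RHS](mulVKg (g i)) gh1 mulg1.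
case: vs => // v vs [sz] Uvs.
have Uv : U v by apply: Uvs; rewrite inE eqxx.
have [e [Me ae]] := pa.
have triv := divisible_trivial dU pa.
pose A := hull p U v; have NA : nsub A by exact: hull_nsub.
have kA q : killsn A q a a id.
  by apply: (hull_killsn p_pr NU UC dU.1 dU.2 q Uv Me).
have [F1 LF1 bF1] := kill_chain_level NA (kill_chain_id n kA) df.
pose q := qpi (normal_of NA).
have kerA x : kernel q x <-> A x.
  by split=> [/qpi_kernel/normal_ofP | /(normal_ofP NA)/qpi_kernel].
have qs : forall y, exists x, q x = y by exact: qpi_surj.
have a_ker x m : kernel q x -> a x m = m by move=> /kerA[Ux _]; exact: triv.
have LF1q : level (kernel q) F1 by apply: level_sub LF1 => x /kerA.
have dF1 : dif a F1 = 0.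
  by have := bdry_dif bF1; rewrite difB df sub0r => /(congr1 -%R); rewrite opprK oppr0.
pose U' y := exists2 x, U x & q x = y.
have NU' : nsub U'.
  split=> [|_ _ [x Ux <-] [y Uy <-]|_ [x Ux <-]|_ y [x Ux <-]].
  - by exists 1%g; [exact: nsub1 | exact: mor1].
  - by exists (x * y)%g; [exact: nsubM | exact: gmulfM].
  - by exists x^-1%g; [exact: nsubV | exact: morV].
  have [z <-] := qs y.
  by exists (x ^ z)%g; [exact: nsubJ | exact: morJ].
have UC' : centralP U'.
  move=> _ y [x Ux <-]; have [z <-] := qs y.
  by rewrite /commute -!gmulfM (UC x z Ux).
have dU' : uniquely_divisible p U'.
  split=> [_ [x Ux <-]|_ [x Ux <-]].
    have [y Uy yx] := dU.1 x Ux; exists (q y); first by exists y.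
    by rewrite -morX yx.
  rewrite -morX => /kerA[_ [k kx]]; apply/kerA; split=> //.
  by exists k.+1; rewrite expnS expgnA.
have [F2 LF2 bF2] := IH _ U' M _ n _ [seq q x | x <- vs] NU' UC' dU'
  (pmod_descent qs a_ker pa) (descent_cocycle qs a_ker LF1q dF1)
  (etrans (size_map _ _) sz)
  (fun y => ltac:(move=> /mapP[x xs ->]; exists x => //;
     by apply: Uvs; rewrite inE xs orbT)).
exists (fun g => F2 (q \o g)).
  move=> g h gh; apply: LF2 => i /=; rewrite -morV -gmulfM.
  case: (gh i) => [->|]; first by left; exact: mor1.
  rewrite inE => /predU1P[->|ghi]; last by right; exact: map_f.
  by left; apply/kerA; exact: hull_gen.
have := bdryD bF1 (bdry_natural (descent_equivariant qs a_ker) bF2).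
congr bdry; apply/funext => g; rewrite !funE.
change (f g - F1 g + (F1 (lift_q q \o (q \o g)) - F2 (q \o g)) =
  f g - F2 (q \o g)).
by rewrite -(level_factor qs LF1q) addrA subrK.
Qed.

(** Compactness: a cochain that works for a finite subset of [U] exists for
    all of them, and these cochains have a limit. *)
Theorem divisible_level (G : groupType) (U : G -> Prop)
    (M : finZmodType) (a : gmodule G M) n (f : cochain G M n.+1) :
  nsub U -> centralP U -> uniquely_divisible p U -> pmod p a ->
  dif a f = 0 -> exists2 F, level U F & bdry a (f - F).
Proof.
move=> NU UC dU pa df.
pose flt (l : seq G) := [seq u <- l | `[< U u >]].
have /choice[c cP] : forall l, exists c : cochain G M n,
    level (fun x => x = 1%g \/ x \in flt l) (f - dif a c).
  move=> l; have [|F LF [c cE]] :=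
    @divisible_level_seq _ G U M a _ f (flt l) NU UC dU pa df erefl.
    by move=> v; rewrite mem_filter => /andP[/asboolP].
  by exists c; rewrite -cE opprB addrC subrK.
pose R (l l' : seq G) := {subset l <= l'}.
have [||s t|T [TU TR]] := @directed_ultra (seq G) R.
- by split; exact: [::].
- by move=> l x.
- exists (s ++ t) => v stv; split=> x xs; apply: stv.
    by rewrite mem_cat xs.
  by rewrite mem_cat xs orbT.
have [L LP] := @limop_finite _ T _ G M a.
exists (f - dif a (fun g => L (fun l => c l g))); last first.
  by rewrite opprB addrC subrK; exists (fun g => L (fun l => c l g)).
rewrite (lim_dif _ LP) => g h gh.
have LE k : (f - (fun g => L (fun l => dif a (c l) g))) k =
    L (fun l => (f - dif a (c l)) k).
  apply/eqP; rewrite subr_eq -(limD LP); apply/eqP/esym.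
  apply: (lim_ae LP); apply: filterS filterT => l _ /=.
  by rewrite subrK.
rewrite !LE; set l0 := [seq ((g i)^-1 * h i)%g | i <- enum 'I_n.+1].
have LD x y : L (fun l => x l - y l) = L x - L y.
  by apply/eqP; rewrite eq_sym subr_eq -(limD LP); apply/eqP; congr L;
     apply/funext => l; rewrite subrK.
apply/eqP; rewrite -subr_eq0 -LD; apply/eqP/(lim_ae LP).
apply: filterS (TR l0) => l l0l /=; apply/eqP; rewrite subr_eq0; apply/eqP.
apply: cP => i; right; rewrite mem_filter; apply/andP; split.
  by apply/asboolP; exact: gh.
by apply: l0l; apply/mapP; exists i => //; rewrite mem_enum.
Qed.

End DivisibleLevel.

Theorem effaceable_divisible p (G Q : groupType) (q : {multiplicative G -> Q}) :
  prime p -> (forall y, exists x, q x = y) ->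
  centralP (kernel q) -> uniquely_divisible p (kernel q) ->
  effaceable p Q -> effaceable p G.
Proof.
move=> p_pr qs kC kd effQ; apply: (effaceable_extension qs effQ).
move=> M a pa n f df; exists M, a, id; split=> //; first exact: coindlike_refl.
exact: (divisible_level p_pr (kernel_nsub q) kC kd pa df).
Qed.

(** * Cyclic central extensions *)

Section Zmodn.
Variable r : nat.
Hypothesis r1 : (1 < r)%N.

Lemma intr_Zp_eq0 (d : int) : (r %| d)%Z -> d%:~R = 0 :> 'Z_r.
Proof.
move=> /dvdzP[c ->]; rewrite intrM.
have -> : (r%:Z)%:~R = 0 :> 'Z_r by rewrite -[LHS]/(r%:R) pchar_Zp.
by rewrite mulr0.
Qed.

Lemma count_Zp (t : 'Z_r) : (\sum_(i < r) (t == i%:R) = 1)%N.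
Proof.
have tr : (t < r)%N by rewrite -[X in (_ < X)%N](Zp_cast r1).
rewrite (bigD1 (Ordinal tr)) //= natr_Zp eqxx big1 ?addn0 // => i it.
apply/eqP; rewrite eqb0; apply: contraNneq it => tE.
by apply/eqP/val_inj; rewrite /= tE val_Zp_nat // modn_small.
Qed.

Lemma val_Zp_succ (t : 'Z_r) : (t + 1)%R = (t.+1 %% r)%N :> nat.
Proof. by case: r r1 t => [|[|m]] // _ t; rewrite /= modnDmr addn1. Qed.
End Zmodn.

Definition triv_gmodule (G : groupType) (M : zmodType) : gmodule G M :=
  @GModule G M (fun _ m => m) (fun=> erefl) (fun _ _ _ => erefl)
    (fun _ _ _ => erefl).

Section AffineAction.
Variables (G : groupType) (V : zmodType) (a : gmodule G V) (delta : G -> V).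
Hypothesis deltaM : forall x y, delta (x * y)%g = delta x + a x (delta y).

Lemma delta1 : delta 1%g = 0.
Proof.
apply: (addIr (delta 1%g)); rewrite add0r -{3}[1%g](mul1g 1%g) deltaM.
by rewrite gact1.
Qed.

Fact affine_act1 v : a 1%g v + delta 1%g = v.
Proof. by rewrite gact1 delta1 addr0. Qed.

Fact affine_actM x y v :
  a (x * y)%g v + delta (x * y)%g = a x (a y v + delta y) + delta x.
Proof. by rewrite gactM gactD deltaM -!addrA [delta x + _]addrC. Qed.

Definition affine_gset : gset G V :=
  @GSet G V (fun x v => a x v + delta x) affine_act1 affine_actM.

Lemma affine_pset p : pmod p a -> pset p affine_gset.
Proof.
move=> [e [Ve ae]]; exists (e + e)%N => g v.
rewrite pexp_mul; set h := (g ^+ (p ^ e))%g.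
have ah w : a h w = w by exact: ae.
suff E n : affine_gset (h ^+ n)%g v = v + delta h *+ n by rewrite E Ve addr0.
elim: n => [|n IH]; first by rewrite expg0 sact1 addr0.
by rewrite expgS sactM IH /= ah -addrA -mulrSr.
Qed.
End AffineAction.

Section CyclicKernel.
Variables (p k : nat) (p_pr : prime p) (k0 : (0 < k)%N).
Variables (G Q : groupType) (q : {multiplicative G -> Q}).
Hypothesis qs : forall y, exists x, q x = y.
Variable z : G.
Hypothesis zC : forall x, commute z x.
Hypothesis kerz : forall x, kernel q x <-> cyc z x.
Hypothesis z_order : forall j, zpow z j = 1%g -> ((p ^ k)%N %| j)%Z.

Local Notation R := 'Z_(p ^ k).

Lemma pk1 : (1 < p ^ k)%N.
Proof.
apply: leq_trans (prime_gt1 p_pr) _.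
by rewrite -{1}(expn1 p) leq_exp2l ?prime_gt1.
Qed.

Lemma coset_function : exists Lam : G -> R,
  forall x j, Lam (x * zpow z j)%g = Lam x + j%:~R.
Proof.
have [rep [i [_ iE]]] := coset_coordinates z.
exists (fun x => (i x)%:~R) => x j; apply/eqP.
rewrite -rmorphD -subr_eq0 -rmorphB; apply/eqP/(intr_Zp_eq0 pk1)/z_order.
by rewrite zpowD zpowN iE mulgV.
Qed.

(** The class of the extension of [Q] by the cyclic group modulo p^k dies in
    some coinduced module; a cochain that bounds it corrects the coset
    function to a derivation of [G], that is to an affine action. *)
Lemma affine_coordinate : effaceable p Q ->
  exists (X : finType) (s : gset G X) (tau : X -> R),
    [/\ pset p s, inhabited X & forall x, tau (s z x) = tau x + 1].
Proof.
move=> effQ; have [Lam LamE] := coset_function.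
pose a := triv_gmodule G R.
pose lam : cochain G R 1 := fun g => Lam (g ord0).
have pa : pmod p a.
  exists k; split=> // m; rewrite -mulr_natr.
  by rewrite (pchar_Zp pk1) mulr0.
have a_ker x m : kernel q x -> a x m = m by [].
have dlamE g : dif a lam g =
    Lam (g (lift ord0 ord0)) - Lam (g ord0 * g (lift ord0 ord0))%g + Lam (g ord0).
  rewrite /dif big_ord1 expr1 mulrNz mulr1z /lam /contract /=.
  rewrite expr2 mulN1r opprK mulr1z.
  by rewrite (_ : lift ord_max ord0 = ord0) //; apply: val_inj.
have Llam : level (kernel q) (dif a lam).
  move=> g h gh; rewrite !dlamE.
  have /kerz[i hi] := gh ord0; have /kerz[j hj] := gh (lift ord0 ord0).
  rewrite -[h ord0](mulVKg (g ord0)) hi.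
  rewrite -[h (lift _ _)](mulVKg (g (lift ord0 ord0))) hj.
  rewrite -mulgA [(zpow z i * _)%g]mulgA (zpow_central i _ zC) -mulgA -zpowD.
  rewrite mulgA !LamE [i + j]addrC rmorphD /= opprD opprD.
  by rewrite [RHS](AC ((2*(1*2))*2) (1*3*6*2*4*7*5)) /= !addrK.
have dlam := dif_dif a lam.
have [XQ [s [ps [x0] [c bc]]]] := effQ _ _ (pmod_descent qs a_ker pa) _ _
  (descent_cocycle qs a_ker Llam dlam).
pose b := coind (pull_gset q s) a.
pose dl : cochain G {ffun XQ -> R} 1 :=
  (fun g => constf (lam g)) - (fun g => c (q \o g)).
have Eq : equivariant q (coind s (descent_gmodule qs a_ker)) b id.
  by split=> // g psi; apply/ffunP => x; rewrite !coindE /= morV.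
have ddl : dif b dl = 0.
  rewrite difB (dif_map _ (constf_equivariant _ _)) (dif_natural c Eq) -bc.
  apply/funext => g; rewrite funE.
  change (constf (dif a lam g) - constf (dif a lam (lift_q q \o (q \o g))) = 
    0 :> {ffun XQ -> R}).
  by rewrite -(level_factor qs Llam) subrr.
pose e0 : 'I_0 -> G := fun=> 1%g.
pose delta x := dl (vcons x e0).
have deltaE x : delta x = constf (Lam x) - c (vcons (q x) (q \o e0)).
  rewrite /delta /dl funE.
  change (constf (lam (vcons x e0)) - c (q \o vcons x e0) =
    constf (Lam x) - c (vcons (q x) (q \o e0))).
  by rewrite comp_vcons /lam vcons0.
have deltaM x y : delta (x * y)%g = delta x + b x (delta y).
  have := congr1 (fun u => u (vcons x (vcons y e0))) ddl.
  rewrite dif_vcons (dif0E _ _ _ e0) vcons0 => /(congr1 -%R).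
  rewrite opprK oppr0 => h; apply/eqP; rewrite -subr_eq0 -[X in _ == X]h.
  by apply/eqP; rewrite opprD addrA addrAC.
have qz : q z = 1%g by apply/kerz; exact: cyc_gen.
have bz m : b z m = m.
  by apply/ffunP => x; rewrite /= /coind_act ffunE /= morV qz invg1 sact1.
have dz : delta z = constf 1.
  have := delta1 deltaM; rewrite !deltaE mor1 qz => /eqP.
  rewrite subr_eq0 => /eqP <-; rewrite -{1}[z]mul1g.
  rewrite (LamE 1%g 1); apply/ffunP => x.
  by rewrite !ffunE addrC addKr.
exists {ffun XQ -> R}, (affine_gset deltaM), (fun m : {ffun XQ -> R} => m x0); split.
- by apply: affine_pset; apply: pmod_coind => //; exact: pset_pull.
- by split; exact: 0.
by move=> m; rewrite -[affine_gset deltaM z m]/(b z m + delta z) bz dz !ffunE.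
Qed.

Section Coordinate.
Variables (X : finType) (s : gset G X) (tau : X -> R).
Hypothesis tauE : forall x, tau (s z x) = tau x + 1.

Lemma tauX x n : tau (s (z ^+ n)%g x) = tau x + n%:R.
Proof.
elim: n => [|n IH]; first by rewrite expg0 sact1 addr0.
by rewrite expgS sactM tauE IH mulrSr addrA.
Qed.

Lemma tauV x n : tau (s (z ^- n)%g x) = tau x - n%:R.
Proof. by apply/eqP; rewrite eq_sym subr_eq -tauX -sactM mulgV sact1. Qed.

(** If [z] has order p^k it acts freely on [X], and the indicator of the fibre
    of the coordinate at 0 realizes the identity as a norm. *)
Lemma coind_wproj (M : finZmodType) (a : gmodule G M) :
  wproj z (p ^ k) (coind s a).
Proof.
exists (fun psi : {ffun X -> M} => [ffun x => psi x *+ (tau x == 0)%R]).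
  by move=> psi psi'; apply/ffunP => x; rewrite !ffunE mulrnDl.
move=> psi; apply/ffunP => x; rewrite sum_ffunE.
transitivity (\sum_(i < p ^ k) psi x *+ (tau x == i%:R)%R).
  apply: eq_bigr => i _; rewrite coindE ffunE coindE tauV subr_eq0.
  rewrite (addfMn (nactD _ _)) -nactM mulgV invgK -sactM mulgV sact1.
  by congr (_ *+ _); exact: gact1.
by rewrite sumrMnr (count_Zp pk1) -[nact (coind s a) 1%g psi]/(coind s a 1%g psi)
  gact1.
Qed.

Lemma coind_kills_finite (M : finZmodType) (a : gmodule G M) :
  (z ^+ (p ^ k) = 1)%g -> kills (cyc z) a (coind s a) constf.
Proof.
move=> zpk; split=> [|n]; first exact: constf_equivariant.
apply: killsn_target; first exact: constf_equivariant.
have [Lam LamE] := coset_function.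
apply: (wproj_killsn zpk (chi := fun x => (Lam x == 0)%R : nat)) => [x|].
  rewrite -[RHS](count_Zp pk1 (- Lam x)); apply: eq_bigr => i _.
  by rewrite (LamE x i%:Z) addr_eq0 eqr_oppLR.
exact: coind_wproj.
Qed.

(** The norm of a cyclic group of order p^k vanishes on [M] when k is large,
    so partial norms along the coordinate are well defined. *)
Lemma coind_kills_infinite e (M : finZmodType) (a : gmodule G M) :
  (e + e <= k)%N -> (forall m : M, m *+ (p ^ e) = 0) ->
  (forall g m, a (g ^+ (p ^ e))%g m = m) ->
  (forall j, zpow z j = 1%g -> j = 0) -> kills (cyc z) a (coind s a) constf.
Proof.
move=> ek Me ae z_inf; split=> [|[|n]]; first exact: constf_equivariant; last first.
  apply: killsn_source; first exact: constf_equivariant.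
  exact: (killsn_infinite z_inf n a).
apply: killsn_cyc; first exact: constf_equivariant.
move=> phi phi1 phiM; set m0 := phi z.
pose N t := \sum_(j < t) a (z ^+ j)%g m0.
have NS t : a z (N t) = N t.+1 - m0.
  rewrite /N big_ord_recl expg0 gact1 addrC addKr.
  rewrite (addf_sum (gactD a z)); apply: eq_bigr => j _.
  by rewrite -gactM -expgS.
have ND t : N (t + p ^ e)%N = N t + N (p ^ e)%N.
  rewrite addnC /N big_split_ord /= addrC; congr (_ + _).
  by apply: eq_bigr => j _; rewrite expgnDr gactM ae.
have NM c t : N (t + c * p ^ e)%N = N t + N (p ^ e)%N *+ c.
  elim: c => [|c IH]; first by rewrite mul0n addn0 addr0.
  by rewrite mulSnr addnA ND IH mulrSr addrA.
have Nk c t : N (t + c * p ^ k)%N = N t.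
  rewrite -(subnK ek) expnD expnD mulnA mulnA NM.
  by rewrite mulrnA Me addr0.
have Nmod t : N (t %% p ^ k)%N = N t by rewrite [in RHS](divn_eq t (p ^ k)) addnC Nk.
exists [ffun x => - N (tau x)]; apply/ffunP => x.
transitivity (a z (- N (tau (s z^-1%g x))) + N (tau x)); last first.
  by rewrite !ffunE opprK.
rewrite ffunE; set y := s z^-1%g x.
have -> : x = s z y by rewrite /y -sactM mulgV sact1.
rewrite tauE gactN NS.
have -> : N (tau y + 1)%R = N (tau y).+1.
  by rewrite (val_Zp_succ pk1) Nmod.
by rewrite opprB addrNK.
Qed.
End Coordinate.

End CyclicKernel.

Section EffaceableCyclic.
Variables (p : nat) (p_pr : prime p) (G Q : groupType).
Variable q : {multiplicative G -> Q}.
Hypothesis qs : forall y, exists x, q x = y.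
Variable z : G.
Hypothesis zC : forall x, commute z x.
Hypothesis kerz : forall x, kernel q x <-> cyc z x.

Lemma chain_of_kills :
  (forall (M : finZmodType) (a : gmodule G M), pmod p a ->
     exists (X : finType) (s : gset G X),
       [/\ pset p s, inhabited X & kills (cyc z) a (coind s a) constf]) ->
  forall n (M : finZmodType) (a : gmodule G M), pmod p a ->
  exists (W : finZmodType) (b : gmodule G W) (j : M -> W),
    [/\ pmod p b, coindlike p a b j & kill_chain (cyc z) n a b j].
Proof.
move=> H; elim=> [|n IH] M a pa.
  by exists M, a, id; split=> //; exact: coindlike_refl.
have [W [b [j [pb cj chj]]]] := IH M a pa.
have [X [s [ps X0 ks]]] := H W b pb.
exists {ffun X -> W}, (coind s b), (fun m => constf (j m)); split.
- exact: pmod_coind.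
- exact: coindlike_constf.
by exists W, b, j, constf.
Qed.

(** Each degree requires one more enlargement of the coefficients.  For [z] of
    infinite order the modulus of the coordinate has to grow with the exponent
    of the module reached so far. *)
Theorem effaceable_cyclic :
  (forall j, zpow z j = 1%g -> j = 0) \/
  (exists k, [/\ (0 < k)%N, (z ^+ (p ^ k) = 1)%g &
     forall j, zpow z j = 1%g -> ((p ^ k)%N %| j)%Z]) ->
  effaceable p Q -> effaceable p G.
Proof.
move=> z_ord effQ; apply: (effaceable_extension qs effQ) => M a pa n f df.
have [|W [b [j [pb cj chj]]]] := chain_of_kills _ n.+1 pa.
  move=> {n f df pa a M} M a [e [Me ae]].
  case: z_ord => [z_inf|[k [k0 zk z_ord]]].
    have z_ord i : zpow z i = 1%g -> ((p ^ (e + e).+1)%N %| i)%Z.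
      by move=> /z_inf ->; exact: dvdz0.
    have [X [s [tau [ps X0 tauE]]]] :=
      affine_coordinate p_pr (ltn0Sn _) qs zC kerz z_ord effQ.
    exists X, s; split=> //.
    by apply: (coind_kills_infinite p_pr (ltn0Sn _) tauE _ Me ae z_inf).
  have [X [s [tau [ps X0 tauE]]]] := affine_coordinate p_pr k0 qs zC kerz z_ord effQ.
  exists X, s; split=> //; exact: (coind_kills_finite p_pr k0 z_ord tauE).
have Ncyc : nsub (cyc z).
  split; [exact: cyc1 | exact: cycM | exact: cycV |].
  move=> _ y [i ->]; rewrite /conjg (zpow_central i y zC) mulKg.
  exact: cyc_zpow.
exists W, b, j; split=> //; first exact: kill_chain_equivariant chj.
have [F LF bF] := kill_chain_level Ncyc chj df.
by exists F => //; apply: level_sub LF => x /kerz.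
Qed.
End EffaceableCyclic.

(** * Central extensions of finite p-rank *)

Section InducedMap.
Variables (G Q : groupType) (q : {multiplicative G -> Q}).
Variables (N : normalClosed G).
Hypothesis Nq : forall x, x \in N -> q x = 1%g.

(** The proof is an argument so that the morphism structure below can be found
    by unification. *)
Definition induced_map (_ : forall x, x \in N -> q x = 1%g)
  (u : quotient_group N) : Q := q (repr u).

Lemma induced_mapE x : induced_map Nq (qpi N x) = q x.
Proof.
have := Nq (repr_coset N x); rewrite gmulfM morV => /(canRL (mulVKg _)).
by rewrite mulg1.
Qed.

Fact induced_mapM : {morph induced_map Nq : u v / u * v >-> u * v}%g.
Proof.
move=> u v; rewrite -[u]qpiK -[v]qpiK -gmulfM !induced_mapE.
exact: gmulfM.
Qed.
HB.instance Definition _ :=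
  isMultiplicative.Build (quotient_group N) Q (induced_map Nq) induced_mapM.
End InducedMap.

(** The trivial group is uniquely p-divisible. *)
Lemma effaceable_iso p (G Q : groupType) (q : {multiplicative G -> Q}) :
  prime p -> (forall y, exists x, q x = y) -> (forall x, q x = 1%g -> x = 1%g) ->
  effaceable p Q -> effaceable p G.
Proof.
move=> p_pr qs qi; apply: effaceable_divisible => //.
  by move=> x y /qi ->; exact/commute_sym/commute1.
split=> x /qi ->; last by [].
by exists 1%g; rewrite ?expg1n //; exact: mor1.
Qed.

Section CentralSubgroups.
Variables (p : nat) (p_pr : prime p) (G : groupType) (L : G -> Prop).
Hypotheses (NL : nsub L) (LC : centralP L).

Definition eff_mod (K : G -> Prop) : Prop :=
  exists NK : nsub K, effaceable p (quotient_group (normal_of NK)).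

Lemma eff_mod_ext (K K' : G -> Prop) :
  (forall x, K x <-> K' x) -> eff_mod K -> eff_mod K'.
Proof. by move=> KK'; have -> : K = K' by apply/funext => x; apply/propext. Qed.

Lemma central_nsub (K : G -> Prop) : (forall x, K x -> L x) -> K 1%g ->
  (forall x y, K x -> K y -> K (x * y)%g) -> (forall x, K x -> K x^-1%g) ->
  nsub K.
Proof.
move=> KL K1 KM KV; split=> // x y Kx.
by rewrite /conjg (LC y (KL x Kx)) mulKg.
Qed.

Lemma quotient_step (K K' : G -> Prop) (NK : nsub K) (NK' : nsub K') :
  (forall x, K x -> K' x) ->
  exists q : {multiplicative
      quotient_group (normal_of NK) -> quotient_group (normal_of NK')},
    [/\ forall y, exists x, q x = y, forall x, q (qpi _ x) = qpi _ x &
        forall x, kernel q (qpi _ x) <-> K' x].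
Proof.
move=> KK'.
have H x : x \in normal_of NK -> qpi (normal_of NK') x = 1%g.
  by move=> /normal_ofP/KK'/(normal_ofP NK')/qpi_kernel.
exists (induced_map H); split=> [y|x|x].
- by have [x <-] := qpi_surj y; exists (qpi _ x); exact: induced_mapE.
- exact: induced_mapE.
rewrite /kernel [X in X = _](induced_mapE H x).
by split=> [/qpi_kernel/normal_ofP|/(normal_ofP NK')/qpi_kernel].
Qed.

Lemma qpi_zpow (N : normalClosed G) z k : qpi N (zpow z k) = zpow (qpi N z) k.
Proof. by case: k => n /=; rewrite ?morV morX. Qed.

Definition adjoin (K : G -> Prop) z x := exists k, K (zpow z (- k) * x)%g.

Section Adjoin.
Variables (K : G -> Prop) (NK : nsub K).
Hypothesis KL : forall x, K x -> L x.
Variable z : G.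
Hypothesis Lz : L z.

Lemma adjoin_sub x : adjoin K z x -> L x.
Proof.
move=> [k /KL Lx]; rewrite -(mulKg (zpow z (- k)) x); apply: nsubM => //.
exact: (nsubV NL (nsub_zpow NL _ Lz)).
Qed.

Lemma adjoin_gen : adjoin K z z.
Proof. by exists 1; rewrite zpowN zpow1 mulVg; exact: nsub1. Qed.

Lemma sub_adjoin x : K x -> adjoin K z x.
Proof. by exists 0; rewrite oppr0 zpow0 mul1g. Qed.

Lemma adjoin_nsub : nsub (adjoin K z).
Proof.
apply: central_nsub => [x|||]; first exact: adjoin_sub.
- exact: (sub_adjoin (nsub1 NK)).
- move=> x y [k Kx] [l Ky]; exists (k + l).
  rewrite [X in K X](_ : _ = (zpow z (- k) * x) * (zpow z (- l) * y))%g.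
    exact: nsubM.
  rewrite opprD zpowD -!mulgA; congr (_ * _)%g; rewrite !mulgA.
  by congr (_ * _)%g; exact: (LC x (nsub_zpow NL (- l) Lz)).
move=> x [k Kx]; exists (- k); rewrite zpowN -invgM; apply: nsubV => //.
by rewrite -(LC x (nsub_zpow NL (- k) Lz)).
Qed.

Lemma eff_adjoin :
  (forall j, K (zpow z j) -> j = 0) \/
  (exists k, [/\ (0 < k)%N, K (z ^+ (p ^ k))%g &
     forall j, K (zpow z j) -> ((p ^ k)%N %| j)%Z]) ->
  eff_mod (adjoin K z) -> eff_mod K.
Proof.
move=> z_ord [NA effA]; exists NK.
have [q [qs qE kq]] := quotient_step NK NA sub_adjoin.
set N := normal_of NK; pose u := qpi N z.
have uK j : zpow u j = 1%g <-> K (zpow z j).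
  rewrite -qpi_zpow; split=> [/qpi_kernel/normal_ofP //|].
  by move=> /(normal_ofP NK)/qpi_kernel.
apply: (effaceable_cyclic p_pr qs (z := u)) effA.
- move=> y; have [x <-] := qpi_surj y.
  by rewrite /commute -!gmulfM (LC x Lz).
- move=> y; have [x <-] := qpi_surj y; rewrite kq.
  split=> [[k Kx]|[k /esym p0]]; exists k.
    rewrite /u -qpi_zpow; apply/esym/qpi_eq/(normal_ofP NK).
    by rewrite -zpowN.
  by move: p0; rewrite /u -qpi_zpow zpowN => /qpi_eq/normal_ofP.
case: z_ord => [z_inf|[k [k0 Kz z_ord]]]; [left|right; exists k].
  by move=> j /uK; exact: z_inf.
by split=> // [|j /uK]; [exact/(uK (p ^ k)%N%:Z) | exact: z_ord].
Qed.
End Adjoin.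

Lemma eff_divisible (K K' : G -> Prop) (NK : nsub K) :
  (forall x, K x -> K' x) -> (forall x, K' x -> L x) ->
  (forall x, K' x -> exists2 y, K' y & K (x^-1 * y ^+ p)%g) ->
  (forall x, K' x -> K (x ^+ p)%g -> K x) ->
  eff_mod K' -> eff_mod K.
Proof.
move=> KK' K'L dv tf [NK' eff']; exists NK.
have [q [qs qE kq]] := quotient_step NK NK' KK'.
apply: (effaceable_divisible p_pr qs) eff' => [u y ku|].
  have [x ux] := qpi_surj u; have [x' <-] := qpi_surj y.
  move: ku; rewrite -ux => /kq/K'L Lx.
  by rewrite /commute -!gmulfM (LC x' Lx).
split=> [u|u]; have [x <-] := qpi_surj u => /kq K'x.
  have [y K'y Ky] := dv x K'x; exists (qpi _ y); first exact/kq.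
  by rewrite -morX; apply/esym/qpi_eq/(normal_ofP NK).
rewrite -morX => /qpi_kernel/normal_ofP Kxp.
by apply/qpi_kernel/(normal_ofP NK); exact: tf.
Qed.

(** The order of [t] modulo [K] is a power of p; it may be 1, and then there is
    nothing to adjoin. *)
Lemma eff_torsion (K : G -> Prop) (NK : nsub K) t e :
  (forall x, K x -> L x) -> L t -> K (t ^+ (p ^ e))%g ->
  eff_mod (adjoin K t) -> eff_mod K.
Proof.
move=> KL Lt Kte.
have ex : exists k, `[< K (t ^+ (p ^ k))%g >] by exists e; apply/asboolP.
case: (ex_minnP ex) => k /asboolP Kk kmin.
have zord j : K (zpow t j) -> ((p ^ k)%N %| j)%Z.
  move=> Kj; have [m mk dE] : exists2 m, (m <= k)%N & gcdn `|j| (p ^ k) = (p ^ m)%N.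
    by apply/dvdn_pfactor => //; exact: dvdn_gcdr.
  suff : (k <= m)%N.
    move=> km; have {}mk : m = k by apply/eqP; rewrite eqn_leq mk km.
    by rewrite dvdzE absz_nat -{1}mk -dE; exact: dvdn_gcdl.
  apply: kmin; apply/asboolP.
  have [u [v uv]] := Bezoutz j (p ^ k)%N%:Z.
  have -> : (t ^+ (p ^ m) = zpow (zpow t j) u * zpow (t ^+ (p ^ k)) v)%g.
    rewrite -[(t ^+ (p ^ k))%g]/(zpow t (p ^ k)%N%:Z) -!zpowM -zpowD.
    rewrite ![_ * u]mulrC ![_ * v]mulrC uv.
    by rewrite /gcdz /= dE.
  by apply: nsubM => //; exact: nsub_zpow.
case: (posnP k) => [k0|k0].
  apply: eff_mod_ext => x; split=> [[j Kj]|]; last exact: sub_adjoin.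
  rewrite -[x](mulKg (zpow t (- j))); apply: nsubM => //; apply: nsubV => //.
  by apply: nsub_zpow => //; move: Kk; rewrite k0 expg1.
apply: eff_adjoin => //; right; by exists k.
Qed.

(** Generation of [T] by [ts] modulo [K], in the form of an induction
    principle. *)
Definition gen_over (K T : G -> Prop) (ts : seq G) : Prop :=
  forall S : G -> Prop, S 1%g -> (forall x y, S x -> S y -> S (x * y)%g) ->
  (forall x, S x -> S x^-1%g) -> (forall x, K x -> S x) ->
  (forall t, t \in ts -> S t) -> forall x, T x -> S x.

Lemma eff_torsion_seq e (T : G -> Prop) (NT : nsub T) ts :
  (forall x, T x -> L x) -> (forall t, t \in ts -> T t /\ (t ^+ (p ^ e) = 1)%g) ->
  forall K (NK : nsub K), (forall x, K x -> T x) -> gen_over K T ts ->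
  eff_mod T -> eff_mod K.
Proof.
move=> TL; elim: ts => [|t ts IH] tsT K NK KT gKT effT.
  apply: eff_mod_ext effT => x; split; last exact: KT.
  by move=> Tx; apply: (gKT K) => //; [exact: nsub1 | exact: nsubM | exact: nsubV].
have [Tt te] := tsT t (mem_head _ _); have KL x : K x -> L x by move=> /KT/TL.
apply: (@eff_torsion _ NK t e) => //; first exact: TL.
  by rewrite te; exact: nsub1.
apply: IH => // [u uts|||].
- by apply: tsT; rewrite inE uts orbT.
- by apply: adjoin_nsub => //; exact: TL.
- move=> x [k /KT Tx]; rewrite -(mulKg (zpow t (- k)) x).
  by apply: nsubM => //; apply: nsubV => //; exact: nsub_zpow.
move=> S S1 SM SV KS tsS x Tx; apply: gKT Tx => // [y Ky|u].
  by apply: KS; exact: sub_adjoin.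
rewrite inE => /predU1P[->|]; last exact: tsS.
by apply: KS; exact: adjoin_gen.
Qed.

(** The subgroup K L^p. *)
Definition add_powers (K : G -> Prop) x :=
  L x /\ exists2 l, L l & K (x^-1 * l ^+ p)%g.

Lemma commuteL x y : L x -> commute x y. Proof. exact: LC. Qed.

Section AddPowers.
Variables (K : G -> Prop) (NK : nsub K).
Hypothesis KL : forall x, K x -> L x.

Lemma add_powers_nsub : nsub (add_powers K).
Proof.
apply: central_nsub => [x []||x y [Lx [l Ll Kl]] [Ly [m Lm Km]]|
  x [Lx [l Ll Kl]]] //.
- split; first exact: nsub1.
  by exists 1%g; [|rewrite expg1n mulg1 invg1]; exact: nsub1.
- split; [exact: nsubM | exists (l * m)%g; first exact: nsubM].
  have -> : ((x * y)^-1 * (l * m) ^+ p = (x^-1 * l ^+ p) * (y^-1 * m ^+ p))%g.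
    rewrite expgMn; last exact: LC.
    rewrite invgM (commuteL _ (nsubV NL Ly)) -!mulgA; congr (_ * _)%g.
    rewrite !mulgA; congr (_ * _)%g.
    by apply: commuteL; exact: nsubV.
  exact: nsubM.
split; [exact: nsubV | exists l^-1%g; first exact: nsubV].
have -> : (x^-1^-1 * l^-1 ^+ p = (x^-1 * l ^+ p)^-1)%g.
  by rewrite invgM expVgn invgK; apply: commuteL.
exact: nsubV.
Qed.

Lemma sub_add_powers x : K x -> add_powers K x.
Proof.
move=> Kx; split; first exact: KL.
exists 1%g; first exact: nsub1.
by rewrite expg1n mulg1; exact: nsubV.
Qed.

Lemma pow_add_powers l : L l -> add_powers K (l ^+ p)%g.
Proof.
move=> Ll; split; first exact: nsubX.
by exists l => //; rewrite mulVg; exact: nsub1.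
Qed.

Hypothesis Ktf : forall x, L x -> K (x ^+ p)%g -> K x.
Variable y : G.
Hypotheses (Ly : L y) (Sy : ~ add_powers K y).

(** By Bezout, [y] is a product of a power of y^j and a p-th power. *)
Lemma zpow_coprime j : ~~ (p %| `|j|)%N -> ~ add_powers K (zpow y j).
Proof.
move=> pj Syj; apply: Sy.
have [u [v uv]] := Bezoutz j p%:Z.
have cop : coprime `|j| p by rewrite coprime_sym prime_coprime.
have -> : y = (zpow y (j * u) * zpow y v ^+ p)%g.
  rewrite -zpowMn -zpowD -[LHS]zpow1; congr zpow.
  rewrite -[LHS]/(Posz 1) -(eqP cop) -[Posz (gcdn _ _)]/(gcdz j p%:Z) -uv.
  by rewrite mulrC pmulrn mulrzz.
rewrite zpowM; apply: (nsubM add_powers_nsub).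
  exact: (nsub_zpow add_powers_nsub).
by apply: pow_add_powers; exact: nsub_zpow.
Qed.

Lemma zpow_tf n j : K (zpow y (j *+ p ^ n)) -> K (zpow y j).
Proof.
elim: n => [|n IH]; first by rewrite expn0 mulr1n.
rewrite expnSr mulrnA zpowMn => h; apply: IH; apply: Ktf => //.
exact: nsub_zpow.
Qed.

Lemma independent_inf j : K (zpow y j) -> j = 0.
Proof.
move=> Kj; apply/eqP/contraT => j0; exfalso.
have aj0 : (0 < `|j|)%N by rewrite absz_gt0.
have [m pm jE] := pfactor_coprime p_pr aj0.
have jE' : j = ((-1) ^+ (j < 0)%R * m%:Z) *+ p ^ logn p `|j|.
  by rewrite [LHS]intEsign [in LHS]jE PoszM pmulrn mulrzz mulrA.
have := Kj; rewrite jE' => /zpow_tf/sub_add_powers; apply: zpow_coprime.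
by rewrite abszMsign /= -prime_coprime.
Qed.

(** If x^p is y^i modulo [K] then p divides i, since [y] is not in K L^p, and x
    differs from a power of y by an element whose p-th power is in [K]. *)
Lemma adjoin_tf x : L x -> adjoin K y (x ^+ p)%g -> adjoin K y x.
Proof.
move=> Lx [i Ki]; have [/dvdnP[c iE]|npi] := boolP (p %| `|i|)%N; last first.
  exfalso; apply: (zpow_coprime npi).
  have -> : zpow y i = (x ^+ p * (zpow y (- i) * x ^+ p)^-1)%g.
    by rewrite zpowN invgM invgK mulVKg.
  apply: (nsubM add_powers_nsub); first exact: pow_add_powers.
  by apply: (nsubV add_powers_nsub); exact: sub_add_powers.
exists ((-1) ^+ (i < 0)%R * c%:Z); apply: Ktf.
  by apply: nsubM => //; exact: nsub_zpow.
rewrite expgMn; last exact: (commuteL _ (nsub_zpow NL _ Ly)).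
rewrite -zpowMn mulNrn; congr (K (zpow y (- _) * _)%g): Ki.
by rewrite [LHS]intEsign iE PoszM mulrA pmulrn mulrzz.
Qed.
End AddPowers.

(** Each generator either is superfluous or has infinite order. *)
Lemma eff_free_seq ys : (forall y, y \in ys -> L y) ->
  forall K (NK : nsub K), (forall x, K x -> L x) ->
  (forall x, L x -> K (x ^+ p)%g -> K x) ->
  gen_over (add_powers K) L ys -> eff_mod L -> eff_mod K.
Proof.
elim: ys => [|y ys IH] ysL K NK KL Ktf gK effL.
  apply: (eff_divisible NK KL _ _ Ktf effL) => // x Lx.
  suff [_ [l Ll Kl]] : add_powers K x by exists l.
  have NS := add_powers_nsub NK.
  by apply: gK Lx => //; [exact: nsub1 | exact: nsubM | exact: nsubV].
have Ly : L y by apply: ysL; exact: mem_head.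
have ysL' u : u \in ys -> L u by move=> uys; apply: ysL; rewrite inE uys orbT.
have [Sy|Sy] := pselect (add_powers K y).
  apply: IH => // S S1 SM SV KS ysS; apply: gK => // u.
  by rewrite inE => /predU1P[->|]; [exact: KS | exact: ysS].
apply: (eff_adjoin NK Ly).
  by left=> j; exact: independent_inf.
apply: IH => // [|x|x|S S1 SM SV KS ysS].
- exact: adjoin_nsub.
- exact: adjoin_sub.
- exact: adjoin_tf.
have KS' x : adjoin K y x -> S x.
  move=> Ax; apply: KS; apply: sub_add_powers => //; first exact: adjoin_nsub.
  exact: adjoin_sub.
apply: gK => // [x [Lx [l Ll Kl]]|u].
  by apply: KS; split=> //; exists l => //; exact: sub_adjoin.
rewrite inE => /predU1P[->|]; last exact: ysS.
by apply: KS'; exact: adjoin_gen.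
Qed.

End CentralSubgroups.

(** Bounded p-torsion, finitely generated, and finitely many generators modulo
    p-th powers: from bottom to top the kernel is finite, then free of finite
    rank, then uniquely p-divisible. *)
Theorem effaceable_central p (G Q : groupType) (q : {multiplicative G -> Q})
    (e : nat) (ts ys : seq G) :
  prime p -> (forall y, exists x, q x = y) -> centralP (kernel q) ->
  (forall x, kernel q x -> (x ^+ (p ^ e.+1) = 1)%g -> (x ^+ (p ^ e) = 1)%g) ->
  let T x := kernel q x /\ (x ^+ (p ^ e) = 1)%g in
  (forall t, t \in ts -> T t) ->
  gen_over (fun x => x = 1%g) T ts ->
  (forall y, y \in ys -> kernel q y) ->
  gen_over (fun x => exists2 l, kernel q l & x = (l ^+ p)%g) (kernel q) ys ->
  effaceable p Q -> effaceable p G.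
Proof.
move=> p_pr qs LC bT T tsT genT ysL genL effQ.
have NL := kernel_nsub q; pose L := kernel q; rewrite -/L in NL LC.
have NT : nsub T.
  apply: (central_nsub LC) => [x []||x y [Lx x1] [Ly y1]|x [Lx x1]] //.
  - by split; [exact: nsub1 | exact: expg1n].
  - split; first exact: nsubM.
    by rewrite expgMn ?x1 ?y1 ?mulg1 //; exact: LC.
  by split; [exact: nsubV | rewrite expVgn x1 invg1].
have N1 : nsub (fun x : G => x = 1%g).
  apply: (central_nsub LC) => [x ->|//|x y -> ->|x ->].
  - exact: nsub1.
  - by rewrite mulg1.
  - by rewrite invg1.
have effL : eff_mod p L.
  exists NL; have H x : x \in normal_of NL -> q x = 1%g by move=> /normal_ofP.
  apply: (effaceable_iso (q := induced_map H)) effQ => // [y|u].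
    by have [x <-] := qs y; exists (qpi _ x); exact: induced_mapE.
  have [x <-] := qpi_surj u; rewrite [X in X = _](induced_mapE H x) => qx.
  by apply/qpi_kernel/(normal_ofP NL).
have effT : eff_mod p T.
  apply: (eff_free_seq p_pr NL LC ysL NT) effL => [x []//|x Lx [_ xp]|].
    by split=> //; apply: bT => //; rewrite expnS expgnA.
  move=> S S1 SM SV TS ysS; apply: genL => // x [l Ll ->].
  by apply: TS; exact: pow_add_powers.
have [N1' eff1] : eff_mod p (fun x : G => x = 1%g).
  have tsT' t : t \in ts -> T t /\ (t ^+ (p ^ e) = 1)%g.
    by move=> /tsT Tt; split=> //; exact: Tt.2.
  apply: (eff_torsion_seq p_pr NL LC NT _ tsT') genT effT => [x []//|//|x ->].
  exact: (nsub1 NT).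
apply: (effaceable_iso (q := qpi (normal_of N1'))) eff1 => //.
  exact: qpi_surj.
by move=> x /qpi_kernel/normal_ofP.
Qed.

(** * Finite p-rank *)

Lemma prufer_valX q (u : prufer q) n : val (u ^+ n)%g = val u ^+ n.
Proof. by elim: n => [|n IH]; rewrite ?expg0 ?expr0 // expgS exprS -IH. Qed.

Lemma prufer_root q m : prime q ->
  exists u : prufer q, forall n, (u ^+ n)%g = 1%g -> (q ^ m %| n)%N.
Proof.
move=> q_pr; have [|z zP] := @C_prim_root_exists (q ^ m)%N.
  by rewrite expn_gt0 prime_gt0.
have zp : z \in prufer_pred q.
  rewrite unfold_in; apply/andP; split; last first.
    by apply/asboolP; exists m; exact: prim_expr_order zP.
  apply/eqP => z0; have := prim_expr_order zP; rewrite z0 expr0n.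
  rewrite gtn_eqF ?expn_gt0 ?prime_gt0 //= => /eqP.
  by rewrite eq_sym oner_eq0.
exists (PruferElt zp) => n /(congr1 val); rewrite prufer_valX /= => zn.
by rewrite (prim_order_dvd zP); apply/eqP.
Qed.

Lemma sub_valX (G : groupType) (H : groupClosed G) (x : subgroup_type H) n :
  val (x ^+ n)%g = (val x ^+ n)%g.
Proof. by elim: n => [|n IH]; rewrite ?expg0 // !expgS -IH. Qed.

Section Generated.
Variables (A : groupType) (S : A -> Prop).
Hypotheses (S1 : S 1%g) (SM : forall x y, S x -> S y -> S (x * y)%g).
Hypothesis (SV : forall x, S x -> S x^-1%g).

Lemma generated_sub (B : set A) : (forall x, B x -> S x) ->
  forall x, generated B x -> S x.
Proof.
move=> BS x; apply; split; last exact: BS.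
split=> [|y z]; first exact: mem_set.
by move=> /set_mem Sy /set_mem Sz; apply: mem_set; apply: SM => //; exact: SV.
Qed.

Lemma prod_sub m (c : 'I_m -> A) :
  (forall i, S (c i)) -> S (\prod_(i < m) c i)%g.
Proof. by move=> Sc; elim/big_ind: _ => // i _; exact: Sc. Qed.
End Generated.

Section FinitePRank.
Variables (A : groupType) (p : nat).
Hypotheses (p_pr : prime p) (Aab : abelian_group A) (Afr : finite_p_rank A p).

Lemma exp_sub e : 
  [/\ ((1 : A) ^+ (p ^ e) = 1)%g,
     forall x y : A, (x ^+ (p ^ e) = 1 -> y ^+ (p ^ e) = 1 ->
       (x * y) ^+ (p ^ e) = 1)%g &
     forall x : A, (x ^+ (p ^ e) = 1 -> x^-1 ^+ (p ^ e) = 1)%g].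
Proof.
split=> [|x y xe ye|x xe]; first exact: expg1n.
  by rewrite expgMn ?xe ?ye ?mulg1 //; exact: Aab.
by rewrite expVgn xe invg1.
Qed.

(** A quasicyclic summand of the p-torsion is necessarily a p-group: an element
    of order r in it has p-power order. *)
Lemma finite_p_rank_bounded :
  (~ exists C : groupClosed A, isomorphic (subgroup_type C) (prufer p)) ->
  exists e, forall x : A, p_torsion p x -> (x ^+ (p ^ e) = 1)%g.
Proof.
move=> noC; have [m [C [Ccq [CT Cdec]]]] := Afr.
have Cc i : cyclic_subgroup (C i).
  have [//|[r r_pr [f [g fK gK]]]] := Ccq i.
  have [u uP] := prufer_root 1 r_pr.
  have [j] := CT i (val (g u)) (valP (g u)).
  rewrite -sub_valX; have -> : 1%g = val (1%g : subgroup_type (C i)) by [].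
  move=> /val_inj/(congr1 f); rewrite morX mor1 gK => /uP.
  rewrite expn1 Euclid_dvdX // => /andP[]; rewrite dvdn_prime2 // => /eqP rp _.
  case: noC; exists (C i); rewrite -rp; exists f; by exists g.
have [x xP] := choice Cc.
have xC i : x i \in C i.
  suff : [set y : A | y \in C i] (x i) by [].
  by rewrite xP => B [_]; apply.
have [d dP] := choice (fun i => CT i (x i) (xC i)).
exists (\sum_(i < m) d i)%N => y /Cdec[c [[cC ->] _]].
have [s1 sM sV] := exp_sub (\sum_(i < m) d i).
apply: (prod_sub s1 sM) => i.
have : generated [set x i] (c i) by rewrite -xP; exact: cC.
apply: (generated_sub s1 sM sV) => _ ->.
by rewrite (bigD1 i) //= addnC pexp_mul dP expg1n.
Qed.

(** A quasicyclic summand has unbounded exponent. *)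
Lemma finite_p_rank_fg e : (forall x : A, p_torsion p x -> (x ^+ (p ^ e) = 1)%g) ->
  exists xs : seq A, (forall x, x \in xs -> p_torsion p x) /\
    forall S : A -> Prop, S 1%g -> (forall x y, S x -> S y -> S (x * y)%g) ->
    (forall x, S x -> S x^-1%g) -> (forall x, x \in xs -> S x) ->
    forall x, p_torsion p x -> S x.
Proof.
move=> bT; have [m [C [Ccq [CT Cdec]]]] := Afr.
have Cc i : cyclic_subgroup (C i).
  have [//|[r r_pr [f [g fK gK]]]] := Ccq i.
  have [u uP] := prufer_root (p ^ e) r_pr.
  have := bT _ (CT i (val (g u)) (valP (g u))).
  rewrite -sub_valX; have -> : 1%g = val (1%g : subgroup_type (C i)) by [].
  move=> /val_inj/(congr1 f); rewrite morX mor1 gK => /uP/dvdn_leq.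
  rewrite expn_gt0 prime_gt0 // => /(_ isT); rewrite leqNgt.
  by rewrite ltn_expl // prime_gt1.
have [x xP] := choice Cc.
have xC i : x i \in C i.
  suff : [set y : A | y \in C i] (x i) by [].
  by rewrite xP => B [_]; apply.
exists [seq x i | i <- enum 'I_m]; split.
  by move=> _ /mapP[i _ ->]; exact: CT (xC i).
move=> S S1 SM SV xS y /Cdec[c [[cC ->] _]].
apply: (prod_sub S1 SM) => i.
have : generated [set x i] (c i) by rewrite -xP; exact: cC.
apply: (generated_sub S1 SM SV) => _ ->.
by apply: xS; apply: map_f; rewrite mem_enum.
Qed.
End FinitePRank.

Section ImageSubgroup.
Variables (P G : groupType) (F : P -> G).
Hypotheses (FM : {morph F : x y / x * y >-> x * y}%g) (Finj : injective F).

Lemma image1 : F 1%g = 1%g.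
Proof. by apply: (mulgI (F 1%g)); rewrite -FM !mulg1. Qed.

Definition image_pred : {pred G} := fun x => `[< exists u, F u = x >].

Fact image_group : group_closed (fun x => x \in image_pred).
Proof.
split=> [|x y]; rewrite !unfold_in; first by apply/asboolP; exists 1%g; exact: image1.
move=> /asboolP[u <-] /asboolP[v <-]; apply/asboolP; exists (u / v)%g.
apply: (mulIg (F v)); rewrite -FM !mulgVK; by [].
Qed.

(** An injective morphism is an isomorphism onto its image. *)
Lemma embedded_subgroup : exists H : groupClosed G, isomorphic (subgroup_type H) P.
Proof.
pose H : groupClosed G := HB.pack image_pred
  (isMulClosed.Build G image_pred (group_closedM image_group))
  (isMul1Closed.Build G image_pred image_group.1)
  (isInvClosed.Build G image_pred (group_closedV image_group)).
have /choice[f fP] (x : subgroup_type H) : exists u, F u = val x.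
  by have := valP x; rewrite unfold_in => /asboolP.
have fM : {morph f : x y / x * y >-> x * y}%g.
  by move=> x y; apply: Finj; rewrite FM !fP.
exists H; pose f' : {multiplicative subgroup_type H -> P} :=
  HB.pack f (isMultiplicative.Build _ _ f fM).
exists f'.
have FH u : F u \in H by rewrite unfold_in; apply/asboolP; exists u.
exists (fun u => SubgroupElt (FH u)) => [x|u].
  by apply: val_inj; rewrite /= fP.
by apply: Finj; rewrite fP.
Qed.
End ImageSubgroup.

(** * The upper central series *)

Fixpoint ucs (G : groupType) n : G -> Prop :=
  if n is m.+1 then fun x => forall y, ucs m [~ x, y]%g else fun x => x = 1%g.

Lemma commMg (G : groupType) (x y z : G) :
  [~ x * y, z]%g = ([~ x, z] ^ y * [~ y, z])%g.
Proof. by rewrite /commg /conjg !invgM !mulgA !(mulgK, mulgVK). Qed.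

Lemma commVg (G : groupType) (x y : G) :
  [~ x^-1, y]%g = ([~ x, y]^-1 ^ x^-1)%g.
Proof. by rewrite /commg /conjg !invgM !invgK !mulgA !(mulgK, mulgVK). Qed.

Lemma commute_commXg (G : groupType) (x y : G) n :
  (forall z, commute [~ x, y]%g z) -> [~ x ^+ n, y]%g = ([~ x, y] ^+ n)%g.
Proof.
move=> xyC; elim: n => [|n IH]; first by rewrite !expg0 comm1g.
rewrite expgS commMg IH expgS; congr (_ * _)%g.
by rewrite /conjg xyC mulKg.
Qed.

Section UpperCentral.
Variable G : groupType.

Lemma ucs_nsub n : nsub (@ucs G n).
Proof.
elim: n => [|n IH].
  by split=> [|x y -> ->|x ->|x y ->]; rewrite ?mulg1 ?invg1 ?conj1g.
split=> [y|x y Zx Zy z|x Zx z|x y Zx z].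
- by rewrite comm1g; exact: (nsub1 IH).
- by rewrite commMg; apply: (nsubM IH) (Zy z); exact: (nsubJ IH _ (Zx z)).
- by rewrite commVg; apply: (nsubJ IH); exact: (nsubV IH (Zx z)).
by rewrite -[z](conjgKV y) -conjRg; exact: (nsubJ IH _ (Zx _)).
Qed.

Lemma ucsS n x : ucs n x -> @ucs G n.+1 x.
Proof.
move=> Zx y; rewrite /commg; apply: nsubM; [exact: ucs_nsub| |].
  exact: (nsubV (ucs_nsub n)).
exact: (nsubJ (ucs_nsub n)).
Qed.

Lemma ucs_central n x y : @ucs G n.+1 x ->
  commute (qpi (normal_of (ucs_nsub n)) x) (qpi (normal_of (ucs_nsub n)) y).
Proof.
move=> Zx; rewrite /commute -!gmulfM; apply/esym/qpi_eq/(normal_ofP (ucs_nsub n)).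
by have := Zx y; rewrite /commg /conjg invgM !mulgA.
Qed.

Lemma nilpotent_ucs : nilpotent_group G -> exists n, forall x, @ucs G n x.
Proof.
move=> [n Gn]; suff H i k : (k + i = n)%N -> forall x, lower_central k x -> @ucs G i x.
  by exists n => x; exact: (H n 0%N).
elim: i k => [|i IH] k ki x Gx; first by move: Gx; rewrite -[k]addn0 ki Gn.
move=> y; apply: (IH k.+1); first by rewrite addSnnS.
by move=> B [_]; apply; exists x => //; exists y.
Qed.

(** Taking commutators with [y] maps the torsion of a factor to the torsion of
    the factor below, so that a bound for the centre is a bound for all. *)
Lemma ucs_bounded p e :
  (forall x j, @ucs G 1 x -> (x ^+ (p ^ j) = 1)%g -> (x ^+ (p ^ e) = 1)%g) ->
  forall n x j, @ucs G n.+1 x -> ucs n (x ^+ (p ^ j))%g -> ucs n (x ^+ (p ^ e))%g.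
Proof.
move=> H0; elim=> [|n IH] x j Zx Zxj; first exact: H0 Zxj.
move=> y; pose N := normal_of (ucs_nsub n).
have E m : ucs n [~ x ^+ m, y]%g <-> ucs n ([~ x, y] ^+ m)%g.
  have : qpi N [~ x ^+ m, y]%g = qpi N ([~ x, y] ^+ m)%g.
    have morR u v : qpi N [~ u, v]%g = [~ qpi N u, qpi N v]%g.
      by rewrite gmulfM morV morJ.
    rewrite morR !morX commute_commXg -?morR // => z.
    by have [w <-] := qpi_surj z; exact: ucs_central.
  have cong a b : qpi N a = qpi N b -> ucs n a -> ucs n b.
    move=> /qpi_eq/normal_ofP ab Za; rewrite -[b](mulVKg a).
    exact: (nsubM (ucs_nsub n)).
  by move=> qE; split; exact: cong.
by apply/E; apply: (IH _ j) => //; apply/E.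
Qed.

End UpperCentral.

(** * Nilpotent groups of finite abelian section rank *)

(** The p-rank hypothesis concerns abelian sections H/K; here it is transferred
    to statements about the elements of H. *)
Section Sections.
Variables (G : groupType) (p : nat).
Hypotheses (p_pr : prime p) (G_FAR : FAR_group G).
Variables (H : normal_subgroup G) (K : normal_subgroup (subgroup_type H)).
Hypothesis HK : forall x y : subgroup_type H, [~ x, y]%g \in K.

Lemma section_abelian : abelian_group (quotient_group K).
Proof.
move=> u v; have [x <-] := qpi_surj u; have [y <-] := qpi_surj v.
rewrite /commute -!gmulfM; apply/esym/qpi_eq.
by have := HK x y; rewrite /commg /conjg invgM !mulgA.
Qed.

Lemma section_rank : finite_p_rank (quotient_group K) p.
Proof. exact: (G_FAR section_abelian).2. Qed.

Lemma section_torsion h j :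
  (h ^+ (p ^ j))%g \in K <-> (qpi K h ^+ (p ^ j) = 1)%g.
Proof. by rewrite -morX -qpi_kernel. Qed.

Lemma section_gen e :
  (forall h j, (h ^+ (p ^ j))%g \in K -> (h ^+ (p ^ e))%g \in K) ->
  exists hs : seq (subgroup_type H), (forall h, h \in hs -> (h ^+ (p ^ e))%g \in K) /\
    forall S : subgroup_type H -> Prop, S 1%g ->
      (forall x y, S x -> S y -> S (x * y)%g) -> (forall x, S x -> S x^-1%g) ->
      (forall x, x \in K -> S x) -> (forall h, h \in hs -> S h) ->
      forall h, (h ^+ (p ^ e))%g \in K -> S h.
Proof.
move=> bK.
have bT (u : quotient_group K) : p_torsion p u -> (u ^+ (p ^ e) = 1)%g.
  have [h <-] := qpi_surj u.
  by move=> [j /section_torsion/bK/section_torsion].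
have [xs [xsT gxs]] := finite_p_rank_fg p_pr section_rank bT.
exists [seq repr x | x <- xs]; split=> [_ /mapP[x /xsT/bT xe ->]|].
  by apply/section_torsion; rewrite qpiK.
move=> S S1 SM SV KS xsS h /section_torsion he.
have reprE x : S (repr (qpi K x)) <-> S x.
  have Sx : S (x^-1 * repr (qpi K x))%g by apply: KS; exact: repr_coset.
  split=> [Sr|Sx']; last by rewrite -[repr _](mulVKg x); exact: SM.
  rewrite -[x](mulgK (x^-1 * repr (qpi K x))%g) mulVKg.
  by apply: SM => //; exact: SV.
apply/reprE; apply: (gxs (fun u => S (repr u))) (ex_intro _ e he) =>
  [|u v Su Sv|u Su|x xxs].
- by rewrite -[1%g]/(qpi K 1%g); apply/reprE.
- rewrite -[u]qpiK -[v]qpiK -gmulfM; apply/reprE; exact: SM.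
- by rewrite -[u]qpiK -morV; apply/reprE; exact: SV.
by apply: xsS; apply: map_f.
Qed.
End Sections.

Section NilpotentFAR.
Variables (G : groupType) (p : nat).
Hypotheses (p_pr : prime p) (G_FAR : FAR_group G).
Hypothesis no_prufer : ~ exists H : groupClosed G,
  isomorphic (subgroup_type H) (prufer p).

Local Notation Z n := (normal_of (@ucs_nsub G n)).

Lemma sub_nsub (S : G -> Prop) (H : groupClosed G) : nsub S ->
  nsub (fun h : subgroup_type H => S (val h)).
Proof.
move=> NS; split=> [|x y Sx Sy|x Sx|x y Sx].
- exact: nsub1.
- exact: (nsubM NS).
- exact: (nsubV NS).
exact: (nsubJ NS).
Qed.

Lemma repr_trivM (L : groupType) (K : normalClosed L) :
  (forall x, x \in K -> x = 1%g) ->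
  {morph (repr : quotient_group K -> L) : u v / u * v >-> u * v}%g.
Proof.
move=> K1 u v; apply: (mulgI (repr (u * v)%g)^-1%g); rewrite mulVg.
apply: esym; apply: K1; apply/qpi_eq.
by rewrite qpi_mul !qpiK.
Qed.

(** The centre is isomorphic to a section of [G], and a quasicyclic p-subgroup
    of that section would be one of [G]. *)
Lemma center_bounded : exists e, forall (x : G) j,
  ucs 1 x -> (x ^+ (p ^ j) = 1)%g -> (x ^+ (p ^ e) = 1)%g.
Proof.
pose K := normal_of (sub_nsub (Z 1) (@ucs_nsub G 0)).
have HK (x y : subgroup_type (Z 1)) : [~ x, y]%g \in K.
  by apply/normal_ofP; have /normal_ofP := valP x; apply.
have K1 x : x \in K -> x = 1%g.
  by move=> /normal_ofP x1; apply: val_inj.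
have rM := repr_trivM K1.
have [|e eP] := finite_p_rank_bounded p_pr (section_abelian HK)
  (section_rank p_pr G_FAR HK).
  move=> [C [f [g fK gK]]]; apply: no_prufer.
  pose F u := val (repr (val (g u))).
  apply: (@embedded_subgroup _ _ F) => [u v|u v].
    have gM : g (u * v)%g = (g u * g v)%g.
      by rewrite -[RHS]fK gmulfM !gK.
    by rewrite /F gM /= rM.
  move=> /val_inj/(can_inj (@qpiK _ K))/val_inj.
  exact: (can_inj gK).
exists e => x j Zx xj; have Hx : x \in Z 1 by apply/normal_ofP.
pose h : subgroup_type (Z 1) := SubgroupElt Hx.
have hE i : (h ^+ (p ^ i))%g \in K <-> (x ^+ (p ^ i) = 1)%g.
  by rewrite normal_ofP /= sub_valX.
by apply/hE/section_torsion/eP; exists j; apply/section_torsion/hE.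
Qed.

Lemma effaceable_trivial (Q : groupType) : (forall x : Q, x = 1%g) ->
  effaceable p Q.
Proof.
move=> Q1 M a _ n f df.
pose s : gset Q unit := @GSet Q unit (fun _ x => x) (fun=> erefl) (fun _ _ _ => erefl).
have [|||||c _ bf] := @level_dies_level Q (fun=> True) M a unit s (fun=> 1%g) n f.
- by split.
- by move=> x m _; rewrite (Q1 x) gact1.
- by [].
- by move=> g h _; congr f; apply/funext => i; rewrite (Q1 (g i)) (Q1 (h i)).
- exact: df.
by exists unit, s; split; [exists 0%N | split | exists c].
Qed.

Theorem nilpotent_FAR_effaceable : nilpotent_group G -> effaceable p G.
Proof.
move=> /nilpotent_ucs[n Gn]; have [e e_bound] := center_bounded.
have bnd := ucs_bounded e_bound.
suff H k i : (k + i = n)%N -> effaceable p (quotient_group (Z i)).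
  apply: (effaceable_iso (q := qpi (Z 0))) (H n 0%N _) => // [|x|].
  - exact: qpi_surj.
  - by move=> /qpi_kernel/normal_ofP.
  by rewrite addn0.
elim: k i => [|k IH] i ki.
  apply: effaceable_trivial => u; have [x <-] := qpi_surj u.
  by apply/qpi_kernel/normal_ofP; move: ki; rewrite add0n => ->.
have [q [qs qE kq]] := quotient_step (@ucs_nsub G i) (@ucs_nsub G i.+1) (@ucsS G i).
pose H := Z i.+1; have HP x : x \in H <-> ucs i.+1 x by exact: normal_ofP.
pose pr (h : subgroup_type H) := qpi (Z i) (val h).
have prM : {morph pr : x y / x * y >-> x * y}%g by move=> x y; exact: gmulfM.
have pr1 : pr 1%g = 1%g by exact: mor1.
have prV x : pr x^-1%g = (pr x)^-1%g by exact: morV.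
have prX x j : pr (x ^+ j)%g = (pr x ^+ j)%g by rewrite /pr sub_valX morX.
have prK x : pr x = 1%g <-> ucs i (val x).
  by rewrite -(normal_ofP (@ucs_nsub G i)) -qpi_kernel.
have kpr h : kernel q (pr h) by apply/kq/HP/(valP h).
have prS u : kernel q u -> exists h, pr h = u.
  have [x <-] := qpi_surj u; move=> /kq/HP Hx.
  by exists (SubgroupElt Hx).
have HK (x y : subgroup_type H) : ucs i (val [~ x, y]%g).
  by have /HP := valP x; apply.
pose K1 := normal_of (sub_nsub H (@ucs_nsub G i)).
have K1P h : h \in K1 <-> pr h = 1%g by rewrite normal_ofP prK.
have [||hs [hsK ghs]] := @section_gen G p p_pr G_FAR H K1 _ e.
- by move=> x y; apply/normal_ofP; exact: HK.
- move=> h j; rewrite !normal_ofP /= !sub_valX; apply: bnd.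
  exact/HP/(valP h).
(* The second section is the factor modulo its p-th powers: all of it is
   p-torsion of exponent p, hence finite. *)
have N2 : nsub (fun h : subgroup_type H => exists l, pr h = (pr l ^+ p)%g).
  have pC x y : commute (pr x) (pr y).
    by apply: ucs_central; apply/HP; exact: valP.
  split=> [|x y [l xl] [m ym]|x [l xl]|x y [l xl]].
  - by exists 1%g; rewrite pr1 expg1n.
  - by exists (l * m)%g; rewrite !prM xl ym expgMn.
  - by exists l^-1%g; rewrite !prV xl expVgn.
  by exists l; rewrite /conjg !prM prV (pC x y) mulKg.
pose K2 := normal_of N2.
have [||ks [ksK gks]] := @section_gen G p p_pr G_FAR H K2 _ 1.
- move=> x y; apply/normal_ofP; exists 1%g; rewrite pr1 expg1n.
  by apply/prK; exact: HK.
- move=> h j _; apply/normal_ofP; exists h; by rewrite prX expn1.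
apply: (@effaceable_central p _ _ q e [seq pr h | h <- hs] [seq pr h | h <- ks]
  p_pr qs) (IH i.+1 _).
- move=> u v ku; have [x <-] := qpi_surj v.
  have [h <-] := prS u ku.
  by apply: ucs_central; apply/HP; exact: valP.
- move=> u /prS[h <-]; rewrite -!prX => /prK; rewrite sub_valX => he.
  apply/prK; rewrite sub_valX; apply: (bnd _ _ e.+1) => //.
  by apply/HP; exact: valP.
- move=> _ /mapP[h /hsK/K1P he ->]; split; first exact: kpr.
  by rewrite -prX.
- move=> S S1 SM SV _ hsS u [/prS[h <-]]; rewrite -prX => /K1P he.
  apply: (ghs (fun h => S (pr h))) he => [|x y|x|x /K1P ->|x xhs].
  + by rewrite pr1.
  + by rewrite prM; exact: SM.
  + by rewrite prV; exact: SV.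
  + by [].
  by apply: hsS; exact: map_f.
- by move=> _ /mapP[h _ ->]; exact: kpr.
- move=> S S1 SM SV LS ksS u /prS[h <-].
  have he : (h ^+ (p ^ 1))%g \in K2.
    by apply/normal_ofP; exists h; rewrite prX expn1.
  apply: (gks (fun h => S (pr h))) he => [|x y|x|x /normal_ofP[l ->]|x xks].
  + by rewrite pr1.
  + by rewrite prM; exact: SM.
  + by rewrite prV; exact: SV.
  + by apply: LS; exists (pr l).
  by apply: ksS; exact: map_f.
by rewrite addnS -addSn.
Qed.
End NilpotentFAR.

(** * Normal subgroups of p-power index and finite p-sets *)

Section PermutationImage.
Variables (G : groupType) (X : finType) (s : gset G X).

Fact sact_inj g : injective (s g).
Proof. by apply: (can_inj (g := s g^-1%g)) => x; rewrite -sactM mulVg sact1. Qed.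

Definition gperm g : {perm X} := perm (@sact_inj g).

Lemma gpermM g h : gperm (g * h)%g = (gperm h * gperm g)%g.
Proof. by apply/perm.permP => x; rewrite permM !permE sactM. Qed.

Lemma gperm1 : gperm 1%g = 1%g.
Proof. by apply/perm.permP => x; rewrite perm1 permE sact1. Qed.

Lemma gpermX g n : gperm (g ^+ n)%g = (gperm g ^+ n)%g.
Proof. by elim: n => [|n IH]; rewrite ?gperm1 // expgSr gpermM IH expgS. Qed.

Definition perm_image : {set {perm X}} := [set u | `[< exists g, gperm g = u >]]%SET.

Lemma perm_imageP u : reflect (exists g, gperm g = u) (u \in perm_image).
Proof. by rewrite inE; exact: asboolP. Qed.

Fact perm_image_group : group_set perm_image.
Proof.
apply/group_setP; split; first by apply/perm_imageP; exists 1%g; exact: gperm1.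
move=> _ _ /perm_imageP[g <-] /perm_imageP[h <-].
by apply/perm_imageP; exists (h * g)%g; exact: gpermM.
Qed.
Canonical perm_image_gr := fingroup.Group perm_image_group.

Lemma perm_image_pgroup p : prime p -> pset p s -> (p.-group perm_image)%g.
Proof.
move=> p_pr [k sk]; apply/pgroupP => q q_pr /(Cauchy q_pr)[_ /perm_imageP[g <-]].
move=> oq; have : (gperm g ^+ (p ^ k) = 1)%g.
  by rewrite -gpermX; apply/perm.permP => x; rewrite permE sk perm1.
move/eqP; rewrite -order_dvdn oq Euclid_dvdX // => /andP[].
by rewrite dvdn_prime2 // => /eqP -> _; rewrite inE.
Qed.
End PermutationImage.

Section PNormal.
Variables (G : groupType) (p : nat).
Hypothesis p_pr : prime p.

(** The quotient by the kernel is isomorphic to the group of the permutations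
    by which [G] acts, a p-group by Cauchy's theorem. *)
Lemma pset_kernel (X : finType) (s : gset G X) : pset p s ->
  exists N : p_normal G p, forall g x, g \in N -> s g x = x.
Proof.
move=> ps; have NK : nsub (fun g => forall x, s g x = x).
  split=> [x|g h sg sh x|g sg x|g h sg x].
  - exact: sact1.
  - by rewrite sactM sh.
  - by rewrite -{1}[x]sg -sactM mulVg sact1.
  by rewrite /conjg !sactM sg -sactM mulVg sact1.
have idx : exists k, ([set: quotient_group (normal_of NK)] #= `I_(p ^ k))%card.
  have [k kE] := p_natP (perm_image_pgroup p_pr ps).
  exists k; rewrite -kE.
  pose f (u : quotient_group (normal_of NK)) :=
    index (gperm s (repr u)) (enum (perm_image s)).
  have fE (u : quotient_group (normal_of NK)) :
      gperm s (repr u) \in enum (perm_image s).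
    by rewrite mem_enum; apply/perm_imageP; exists (repr u).
  have finj : {in [set: quotient_group (normal_of NK)] &, injective f}.
    move=> u v _ _ fuv; rewrite -[u]qpiK -[v]qpiK.
    have /perm.permP guv : gperm s (repr u) = gperm s (repr v).
      by rewrite -(nth_index 1%g (fE u)) -/(f u) fuv nth_index.
    apply/qpi_eq/(normal_ofP NK) => x.
    by have := guv x; rewrite !permE sactM => <-; rewrite -sactM mulVg sact1.
  have := inj_card_eq finj; rewrite card_eq_sym; congr (_ #= _)%card.
  apply/seteqP; split=> [_ [u _ <-]|i ic] /=.
    by rewrite cardE index_mem.
  have /perm_imageP[g gE] : nth 1%g (enum (perm_image s)) i \in perm_image s.
    by rewrite -mem_enum mem_nth // -cardE.
  exists (qpi _ g) => //; rewrite /f.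
  have -> : gperm s (repr (qpi (normal_of NK) g)) = gperm s g.
    have /normal_ofP h := repr_coset (normal_of NK) g.
    rewrite -[repr _](mulVKg g) gpermM.
    by apply/perm.permP => x; rewrite permM !permE h.
  by rewrite gE index_uniq ?enum_uniq // -cardE.
by exists (PNormal idx) => g x /normal_ofP.
Qed.

(** The p-set of the cosets of [N]; an element of [G] acts on it with p-power
    order because the image of [G] is a regular permutation group. *)
Lemma pn_gset (N : p_normal G p) : exists (X : finType) (s : gset G X) (rep : X -> G),
  [/\ pset p s, inhabited X & forall g x, ((g * rep x)^-1 * rep (s g x))%g \in N].
Proof.
have [k /card_set_bijP[f [fI finj fsurj]]] := pn_index N.
have fk u : (f u < p ^ k)%N by exact: fI.
pose fw u : 'I_(p ^ k) := Ordinal (fk u).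
have /choice[bk bkP] (i : 'I_(p ^ k)) : exists u, f u = i.
  by have [u _ ui] := fsurj i (ltn_ord i); exists u.
have bkK : cancel bk fw by move=> i; apply: val_inj; exact: bkP.
have fwK : cancel fw bk.
  by move=> u; apply: finj; rewrite ?inE // bkP.
have act1 i : fw (qpi N 1%g * bk i)%g = i.
  by rewrite -[qpi N 1%g]/(1%g : quotient_group N) mul1g bkK.
have actM g h i : fw (qpi N (g * h)%g * bk i)%g =
    fw (qpi N g * bk (fw (qpi N h * bk i)))%g.
  by rewrite fwK mulgA gmulfM.
pose s := @GSet G 'I_(p ^ k) (fun g i => fw (qpi N g * bk i)%g) act1 actM.
have sE g i : bk (s g i) = (qpi N g * bk i)%g by exact: fwK.
have i0 : inhabited 'I_(p ^ k).
  by split; apply: (@Ordinal _ 0); rewrite expn_gt0 prime_gt0.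
exists 'I_(p ^ k), s, (fun i => repr (bk i)); split=> [|//|g i]; last first.
  by apply/qpi_eq; rewrite qpi_mul !qpiK sE.
have [i] := i0.
have imE : #|perm_image s| = (p ^ k)%N.
  rewrite -[RHS]card_ord -cardsT.
  have -> : [set: 'I_(p ^ k)]%SET =
      [set (u : {perm 'I_(p ^ k)}) i | u in perm_image s]%SET.
    apply/setP => j; rewrite inE; apply/esym/imsetP.
    have [g gE] := qpi_surj (bk j * (bk i)^-1)%g.
    exists (gperm s g); first by apply/perm_imageP; exists g.
    by rewrite permE; apply: (can_inj bkK); rewrite sE gE mulgVK.
  rewrite card_in_imset // => _ _ /perm_imageP[g <-] /perm_imageP[h <-].
  rewrite !permE => /(congr1 bk); rewrite !sE => /mulIg gh.
  by apply/perm.permP => j; rewrite !permE; apply: (can_inj bkK); rewrite !sE gh.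
exists k => g j.
have gR : gperm s g \in perm_image_gr s by apply/perm_imageP; exists g.
have := expg_cardG gR; rewrite /= imE -gpermX => /perm.permP/(_ j).
by rewrite permE perm1.
Qed.

Lemma pn_gset_kernel (N : p_normal G p) (X : finType) (s : gset G X)
    (rep : X -> G) :
  (forall g x, ((g * rep x)^-1 * rep (s g x))%g \in N) -> inhabited X ->
  forall g, (forall x, s g x = x) -> g \in N.
Proof.
move=> repE [x] g sg; have := repE g x; rewrite sg invgM => h.
have := gpredJ_normal _ (rep x)^-1%g h.
by rewrite /conjg invgK mulgK mulVKg gpredV.
Qed.

Lemma pn_exponent (N : p_normal G p) :
  exists k, forall g, (g ^+ (p ^ k))%g \in N.
Proof.
have [X [s [rep [[k sk] X0 repE]]]] := pn_gset N.
by exists k => g; apply: (pn_gset_kernel repE X0).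
Qed.

Lemma pn_inter (N1 N2 : p_normal G p) : exists N : p_normal G p,
  {subset N <= N1} /\ {subset N <= N2}.
Proof.
have [X1 [s1 [r1 [p1 i1 rE1]]]] := pn_gset N1.
have [X2 [s2 [r2 [p2 i2 rE2]]]] := pn_gset N2.
have [N NP] := pset_kernel (pset_prod p1 p2).
exists N; split=> g gN; have E u := NP g u gN.
  have [x2] := i2; apply: (pn_gset_kernel rE1 i1) => x1.
  by have [] := E (x1, x2).
have [x1] := i1; apply: (pn_gset_kernel rE2 i2) => x2.
by have [] := E (x1, x2).
Qed.

Lemma pmod_kernel (M : finZmodType) (a : gmodule G M) : pmod p a ->
  exists N : p_normal G p, forall g m, g \in N -> a g m = m.
Proof.
move=> [k [_ ak]].
have [|N NP] := @pset_kernel M (@GSet G M a (gact1 a) (gactM a)).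
  by exists k.
by exists N.
Qed.

Lemma pn_ex : inhabited (p_normal G p).
Proof.
have [|N _] := @pset_kernel unit
  (@GSet G unit (fun _ x => x) (fun=> erefl) (fun _ _ _ => erefl)).
  by exists 0%N.
by [].
Qed.

(** * Uniform cochains *)

(** These are the cochains of the finite p-quotients of [G], inflated to [G]. *)
Definition uniform (V : Type) n (f : ('I_n -> G) -> V) : Prop :=
  exists N : p_normal G p, level (fun x => x \in N) f.

Lemma uniform_comp (V W : Type) n (f : ('I_n -> G) -> V) (j : V -> W) :
  uniform f -> uniform (fun g => j (f g)).
Proof. by move=> [N LN]; exists N => g h /LN ->. Qed.

Lemma uniform2 (V W Y : Type) n (f : ('I_n -> G) -> V) (h : ('I_n -> G) -> W)
    (j : V -> W -> Y) :
  uniform f -> uniform h -> uniform (fun g => j (f g) (h g)).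
Proof.
move=> [N1 L1] [N2 L2]; have [N [NN1 NN2]] := pn_inter N1 N2.
exists N => g g' gg'.
by rewrite (L1 g g') ?(L2 g g') // => i; [exact: NN2 | exact: NN1].
Qed.

Lemma uniform0 (V : Type) (f : ('I_0 -> G) -> V) : uniform f.
Proof. by have [N] := pn_ex; exists N; exact: level0. Qed.

Lemma uniform_dif (M : finZmodType) (a : gmodule G M) n (f : cochain G M n) :
  pmod p a -> uniform f -> uniform (dif a f).
Proof.
move=> pa [N1 L1]; have [N2 N2a] := pmod_kernel pa.
have [N [NN1 NN2]] := pn_inter N1 N2; exists N.
apply: level_dif; first exact: nsub_normal.
  move=> x y v xy; rewrite -[y](mulVKg x) nactM; congr (a x _).
  by apply/esym/N2a/NN2.
exact: level_sub L1.
Qed.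
End PNormal.

(** * The cokernel of the constants in a coinduced module *)

Section Reduced.
Variables (G : groupType) (X : finType) (s : gset G X) (x0 : X).
Variables (M : finZmodType) (a : gmodule G M).

Definition vanishing (psi : {ffun X -> M}) : bool := psi x0 == 0.

Fact vanishing_closed : zmod_closed vanishing.
Proof.
split=> [|f g]; rewrite !unfold_in; first by rewrite ffunE.
by move=> /eqP f0 /eqP g0; rewrite !ffunE f0 g0 subrr.
Qed.

Local Notation red_mod := (sub_zmod vanishing_closed).

Fact red_subproof (psi : {ffun X -> M}) : vanishing (psi - constf (psi x0)).
Proof. by apply/eqP; rewrite !ffunE subrr. Qed.

Definition red (psi : {ffun X -> M}) : red_mod := SubZmod _ (red_subproof psi).

Lemma redD : {morph red : f g / f + g}.
Proof.
move=> f g; apply: val_inj; apply/ffunP => x; rewrite /= !ffunE opprD.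
by rewrite addrACA.
Qed.

Lemma red_const m : red (constf m) = 0.
Proof. by apply: val_inj; apply/ffunP => x; rewrite /= !ffunE subrr. Qed.

Lemma red_eq0 psi : red psi = 0 -> psi = constf (psi x0).
Proof. by move/(congr1 val)/eqP; rewrite /= subr_eq0 => /eqP. Qed.

Lemma red_val (u : red_mod) : red (val u) = u.
Proof.
apply: val_inj; apply/ffunP => x; have /eqP u0 := valP u.
by rewrite /= !ffunE u0 subr0.
Qed.

Lemma val_red psi : val (red psi) = psi - constf (psi x0).
Proof. by []. Qed.

Definition red_act g (u : red_mod) : red_mod := red (coind s a g (val u)).

Lemma red_actE g psi : red_act g (red psi) = red (coind s a g psi).
Proof.
rewrite /red_act val_red gactB (addfB redD).
have [_ cE] := constf_equivariant s a.
by rewrite [gact _ g (constf _)](cE g) red_const subr0.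
Qed.

Fact red_act1 u : red_act 1%g u = u.
Proof. by rewrite /red_act gact1 red_val. Qed.

Fact red_actM g h u : red_act (g * h)%g u = red_act g (red_act h u).
Proof. by rewrite [red_act h u]/red_act red_actE -gactM. Qed.

Fact red_actD g u v : red_act g (u + v) = red_act g u + red_act g v.
Proof. by rewrite /red_act [val (u + v)]raddfD gactD redD. Qed.

Definition red_gmodule : gmodule G red_mod := GModule red_act1 red_actM red_actD.

Lemma red_equivariant : equivariant id (coind s a) red_gmodule red.
Proof. by split=> [|g psi]; [exact: redD | exact: red_actE]. Qed.

Lemma pmod_red p : pset p s -> pmod p a -> pmod p red_gmodule.
Proof.
move=> ps pa; have [k [Mk ak]] := pmod_coind ps pa.
exists k; split=> [u|g u].
  by apply: val_inj; rewrite raddfMn Mk.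
by rewrite /= /red_act ak red_val.
Qed.
End Reduced.

(** * Comparing all cochains with the uniform ones *)

Section Comparison.
Variables (G : groupType) (p : nat).
Hypotheses (p_pr : prime p) (effG : effaceable p G).

Definition uniform_bdry (V : zmodType) (a : nmod G V) n :
    cochain G V n -> Prop :=
  match n with
  | 0 => fun f => f = 0
  | m.+1 => fun f => exists2 c : cochain G V m, uniform p c & f = dif a c
  end.

Lemma cocycle_of_bdry (V : zmodType) (a : nmod G V) n (f F : cochain G V n) :
  dif a f = 0 -> bdry a (f - F) -> dif a F = 0.
Proof.
move=> df bF; have := bdry_dif bF; rewrite difB df sub0r.
by move=> /(congr1 -%R); rewrite opprK oppr0.
Qed.

Section Lifting.
Variables (M : finZmodType) (a : gmodule G M).
Variables (X : finType) (s : gset G X) (x0 : X).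

Lemma red_dif_val n (e : cochain G (sub_zmod (@vanishing_closed X x0 M)) n) g :
  red x0 (dif (coind s a) (fun k => val (e k)) g) = dif (red_gmodule s x0 a) e g.
Proof.
have := dif_map (fun k => val (e k)) (red_equivariant s x0 a).
have -> : (fun k => red x0 (val (e k))) = e by apply/funext => k; exact: red_val.
by move=> /(congr1 (fun u => u g)) /= <-.
Qed.

Lemma bdry_lift n (h : cochain G (sub_zmod (@vanishing_closed X x0 M)) n) :
  bdry (red_gmodule s x0 a) h ->
  exists2 h', bdry (coind s a) h' & forall g, red x0 (h' g) = h g.
Proof.
case: n h => [|n] h /= => [->|[e ->]].
  by exists 0 => // g; exact: (addf0 (@redD _ x0 _)).
by exists (dif (coind s a) (fun g => val (e g))); [eexists | exact: red_dif_val].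
Qed.

(** Cochains with values in the cokernel lift to functions vanishing at [x0],
    and the lift of a uniform cochain is uniform. *)
Lemma uniform_bdry_lift n (h : cochain G (sub_zmod (@vanishing_closed X x0 M)) n) :
  pset p s -> pmod p a -> uniform_bdry (red_gmodule s x0 a) h ->
  exists h', [/\ uniform p h', bdry (coind s a) h' & forall g, red x0 (h' g) = h g].
Proof.
move=> ps pa; case: n h => [|n] h /= => [->|[e ue ->]].
  exists 0; split=> // [|g]; first exact: uniform0.
  exact: (addf0 (@redD _ x0 _)).
exists (dif (coind s a) (fun g => val (e g))); split.
- by apply: uniform_dif; [| exact: pmod_coind | exact: uniform_comp].
- by eexists.
exact: red_dif_val.
Qed.
End Lifting.

(** Dimension shifting: the class of [f] dies in a coinduced module, hence
    comes from a class of one degree less in the cokernel. *)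
Theorem uniform_representative n : forall (M : finZmodType) (a : gmodule G M)
    (f : cochain G M n), pmod p a -> dif a f = 0 ->
  exists2 F, uniform p F & bdry a (f - F).
Proof.
elim: n => [|n IH] M a f pa df.
  by exists f; [exact: uniform0 | rewrite subrr; exact: bdry0].
have [X [s [ps [x0] [c cE]]]] := effG pa df.
have rE := red_equivariant s x0 a.
have [||Z uZ bZ] := IH _ (red_gmodule s x0 a) (fun g => red x0 (c g)).
- exact: pmod_red.
- rewrite (dif_map _ rE) -cE; apply/funext => g; exact: red_const.
have [h bh hE] := bdry_lift bZ.
pose vZ : cochain G {ffun X -> M} n := fun g => val (Z g).
pose m : cochain G M n := fun g => (c - vZ - h) g x0.
have mE : (fun g => constf (m g)) = c - vZ - h.
  apply/funext => g; apply/esym; apply: red_eq0.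
  rewrite -[(c - vZ - h) g]/(c g - val (Z g) - h g).
  by rewrite !(addfB (@redD _ x0 _)) red_val hE subrr.
have fm : (fun g => constf ((f - dif a m) g)) = dif (coind s a) vZ.
  have := dif_map m (constf_equivariant s a); rewrite mE !difB -cE (bdry_dif bh) subr0.
  move=> /eqP; rewrite subr_eq => /eqP h1; apply/funext => g.
  have := congr1 (fun u => u g) h1; rewrite /= => h2.
  rewrite -[(f - _) g]/(f g - dif a m g) (addfB (constf_equivariant s a).1).
  by rewrite h2 funE addrC addKr.
exists (f - dif a m); last by rewrite opprB addrC subrK; exists m.
have -> : f - dif a m = (fun g => dif (coind s a) vZ g x0).
  by apply/funext => g; rewrite -fm ffunE.
apply: (@uniform_comp _ _ _ _ _ _ (fun psi : {ffun X -> M} => psi x0)).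
apply: uniform_dif => //; first exact: pmod_coind.
exact: uniform_comp.
Qed.

(** Dimension shifting once more.  A uniform cocycle f dies in a coinduced
    module through a uniform cochain c1, and if f is also the differential of c
    then c1 - c is a cocycle; correcting c1 by a uniform cocycle makes it
    cohomologous to c, and the induction hypothesis in the cokernel then moves
    it, by a uniform coboundary, into the constants. *)
Theorem uniform_injective n : forall (M : finZmodType) (a : gmodule G M)
    (f : cochain G M n), pmod p a -> uniform p f -> bdry a f ->
  uniform_bdry a f.
Proof.
elim: n => [|n IH] M a f pa uf //= [c cE].
have df : dif a f = 0 by rewrite cE dif_dif.
have [N1 L1] := uf; have [N2 N2a] := pmod_kernel p_pr pa.
have [N [NN1 NN2]] := pn_inter p_pr N1 N2.
have [X [s [rep [ps [x0] repE]]]] := pn_gset p_pr N.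
have [|||||c1 Lc1 c1E] := @level_dies_level G (fun x => x \in N) M a X s rep n f.
- exact: nsub_normal.
- by move=> x m xN; apply/N2a/NN2.
- exact: repE.
- exact: level_sub L1.
- exact: df.
pose cc : cochain G {ffun X -> M} n := fun g => constf (c g).
have cE' := constf_equivariant s a; have rE := red_equivariant s x0 a.
have pb := pmod_coind ps pa.
have dcc : dif (coind s a) (c1 - cc) = 0.
  by rewrite difB -c1E (dif_map _ cE') -cE subrr.
have [W uW bW] := uniform_representative pb dcc.
pose rW : cochain G _ n := fun g => red x0 ((c1 - W) g).
have uc1 : uniform p c1 by exists N.
have ucW : uniform p (c1 - W) by exact: (uniform2 p_pr (fun x y => x - y) uc1 uW).
have urW : uniform_bdry (red_gmodule s x0 a) rW.
  apply: IH; [exact: pmod_red | exact: uniform_comp |].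
  have := bdry_map rE bW; congr bdry; apply/funext => g.
  rewrite -[(c1 - cc - W) g]/(c1 g - constf (c g) - W g).
  by rewrite !(addfB (@redD _ x0 _)) red_const subr0 -(addfB (@redD _ x0 _)).
have [h [uh bh hE]] := uniform_bdry_lift ps pa urW.
exists (fun g => (c1 - W - h) g x0).
  apply: (@uniform_comp _ _ _ _ _ _ (fun psi : {ffun X -> M} => psi x0)).
  exact: (uniform2 p_pr (fun x y => x - y) ucW uh).
have mE : (fun g => constf ((c1 - W - h) g x0)) = c1 - W - h.
  apply/funext => g; apply/esym; apply: red_eq0.
  rewrite -[(c1 - W - h) g]/((c1 - W) g - h g).
  by rewrite (addfB (@redD _ x0 _)) hE subrr.
have := dif_map (fun g => (c1 - W - h) g x0) cE'.
rewrite mE !difB -c1E (bdry_dif bh) subr0 (cocycle_of_bdry dcc bW) subr0.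
move=> h1; apply/funext => g.
have := congr1 (fun u : cochain G {ffun X -> M} n.+1 => (u g : {ffun X -> M}) x0) h1.
by rewrite !ffunE.
Qed.

End Comparison.

(** * Continuous cochains of the completion *)

Section Completion.
Variables (G : groupType) (p : nat).
Hypothesis p_pr : prime p.

Local Notation Gh := (pro_completion G p).
Local Notation phi := (@completion_map G p).

Lemma pro_valM (x y : Gh) N : pro_val (x * y)%g N = (pro_val x N * pro_val y N)%g.
Proof. by []. Qed.
Lemma pro_valV (x : Gh) N : pro_val x^-1%g N = (pro_val x N)^-1%g.
Proof. by []. Qed.

Lemma pro_compat (x : Gh) (N N' : p_normal G p) : {subset N <= N'} ->
  pro_val x N' = qpi N' (repr (pro_val x N)).
Proof. by move=> NN'; have /asboolP -> := pro_valP x. Qed.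

Lemma pro_val_sub (x y : Gh) (N N' : p_normal G p) : {subset N <= N'} ->
  pro_val x N = pro_val y N -> pro_val x N' = pro_val y N'.
Proof. by move=> NN' xy; rewrite !(pro_compat _ NN') xy. Qed.

Definition proker (N : p_normal G p) (x : Gh) : Prop := pro_val x N = 1%g.

Lemma proker_nsub N : nsub (proker N).
Proof.
split=> [|x y|x|x y]; rewrite /proker //.
- by rewrite pro_valM => -> ->; rewrite mulg1.
- by rewrite pro_valV => ->; rewrite invg1.
by rewrite /conjg !pro_valM pro_valV => ->; rewrite mul1g mulVg.
Qed.

Lemma prokerE N (x y : Gh) : proker N (x^-1 * y)%g <-> pro_val x N = pro_val y N.
Proof.
rewrite /proker pro_valM pro_valV; split=> [h|->]; last exact: mulVg.
by rewrite -[RHS](mulVKg (pro_val x N)) h mulg1.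
Qed.

(** An ultrafilter of ever smaller normal subgroups, used in place of nets. *)
Lemma pn_ultra : exists F : set_system (p_normal G p),
  UltraFilter F /\
  forall N : p_normal G p, F [set N' : p_normal G p | {subset N' <= N}].
Proof.
apply: (@directed_ultra _ (fun N N' : p_normal G p => {subset N' <= N})).
- exact: pn_ex.
- by move=> N x.
move=> N1 N2; have [N [N1N N2N]] := pn_inter p_pr N1 N2.
by exists N => N' NN'; split=> x /NN'; [exact: N1N | exact: N2N].
Qed.

(** Otherwise points outside of [U] that agree with [x] on smaller and smaller
    subgroups would converge to [x]. *)
Lemma nbhs_proker (x : Gh) (U : set Gh) : nbhs x U ->
  exists N, forall y : Gh, pro_val y N = pro_val x N -> U y.
Proof.
move=> xU; apply: contrapT => noN.
have /choice[y yP] : forall N, exists y : Gh, pro_val y N = pro_val x N /\ ~ U y.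
  move=> N; apply: contrapT => noy; apply: noN; exists N => y yx.
  by apply: contrapT => nUy; apply: noy; exists y.
have [F [FU FN]] := pn_ultra.
have yx : y @ F --> x.
  apply: pro_cvg => N; apply: filterS (FN N) => N' N'N.
  exact: pro_val_sub N'N (yP N').1.
have [N UN] := @filter_ex _ F _ _ (yx U xU).
by case: (yP N) => _; apply.
Qed.

(** By continuity at (1, m), each element m is fixed by an open subgroup, and
    [M] is finite. *)
Lemma discrete_kernel (M : finZmodType) (a : gmodule Gh M) :
  discrete_gmodule a ->
  exists N : p_normal G p, forall x m, proker N x -> a x m = m.
Proof.
move=> ca.
have /choice[Nm NmP] (m : M) : exists N : p_normal G p,
    forall x, proker N x -> a x m = m.
  have := ca (1%g, m) _ (@discrete_set1 (discrete_topology M) (a 1%g m)).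
  case=> -[U V] /= [U1 Vm] UV; have [N NP] := nbhs_proker U1.
  exists N => x xN; have := UV (x, m); rewrite /= gact1; apply; split.
    exact: NP.
  exact: (@nbhs_singleton (discrete_topology M)).
suff [N NP] : exists N : p_normal G p, forall m, m \in enum M -> {subset N <= Nm m}.
  exists N => x m xN; apply: NmP.
  have NNm : {subset N <= Nm m} by apply: NP; rewrite mem_enum.
  by rewrite /proker (pro_compat x NNm) xN; exact: (qpi_repr 1%g NNm).
elim: (enum M) => [|m s [N NP]]; first by have [N] := pn_ex G p_pr; exists N.
have [N' [N'm N'N]] := pn_inter p_pr (Nm m) N.
exists N' => m'; rewrite inE => /predU1P[-> //|m's] x /N'N.
exact: NP.
Qed.

(** Compactness of the completion: a net of counterexamples would converge,
    coordinate by coordinate, to a point at which [f] is not continuous. *)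
Lemma continuous_level (M : finZmodType) n (f : cochain Gh M n) :
  f \in @continuous_cochains Gh M n ->
  exists N, level (proker N) f.
Proof.
move=> /asboolP cf; apply: contrapT => noN.
have /choice[xy xyP] : forall N, exists xy : ('I_n -> Gh) * ('I_n -> Gh),
    (forall i, pro_val (xy.1 i) N = pro_val (xy.2 i) N) /\ f xy.1 <> f xy.2.
  move=> N; apply: contrapT => noxy; apply: noN; exists N => g h gh.
  apply: contrapT => nf; apply: noxy; exists (g, h); split=> // i.
  exact/prokerE/gh.
have [F [FU FN]] := pn_ultra.
have lim (N : p_normal G p) (h : p_normal G p -> quotient_group N) :
    exists v : quotient_group N, F [set t : p_normal G p | h t = v].
  have [k /card_set_bijP[c [cI cinj _]]] := pn_index N.
  have ck u : (c u < p ^ k)%N by exact: cI.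
  have [i Fi] := ultra_finite (fun t => Ordinal (ck (h t))).
  have [t /= ti] := filter_ex Fi; exists (h t); apply: filterS Fi => t' /=.
  by rewrite -ti => -[] /cinj; apply; rewrite inE.
have /choice[z zP] : forall i : 'I_n,
    exists z : forall N : p_normal G p, quotient_group N,
    forall N, F [set t : p_normal G p | pro_val ((xy t).1 i) N = z N].
  move=> i; exists (fun N => sval (cid (lim N (fun t => pro_val ((xy t).1 i) N)))).
  by move=> N; case: cid.
have zC i : `[< compatible (z i) >].
  apply/asboolP => N N' NN'.
  have [t /= [<- <-]] := filter_ex (filterI (zP i N) (zP i N')).
  by rewrite -(pro_compat _ NN').
pose zz : {ptws 'I_n -> Gh} := fun i => ProCompletion (zC i).
have cvg (w : p_normal G p -> 'I_n -> Gh) :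
    (forall i N, F [set t : p_normal G p | pro_val (w t i) N = z i N]) ->
    F [set t : p_normal G p | f (w t) = f zz].
  move=> wP; have wz : (w : p_normal G p -> {ptws 'I_n -> Gh}) @ F --> zz.
    apply/cvg_sup => i U [/= _ [[V oV <-] Vx]] sVU.
    have wi : (fun t => w t i) @ F --> zz i.
      by apply: pro_cvg => N; exact: wP.
    have Fi := wi V (open_nbhs_nbhs (conj oV Vx)).
    exact: (@filterS _ F _ _ _ (fun t Vt => sVU (w t) Vt) Fi).
  have := cf zz _ (@discrete_set1 (discrete_topology M) (f zz)).
  by move=> /wz.
have F1 := cvg (fun t => (xy t).1) zP.
have F2 : F [set t : p_normal G p | f (xy t).2 = f zz].
  apply: cvg => i N; apply: filterS (filterI (zP i N) (FN N)) => t /= [<- tN].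
  exact/esym/(pro_val_sub tN)/(xyP t).1.
have [t /= [f1 f2]] := filter_ex (filterI F1 F2).
by apply: (xyP t).2; rewrite f1 f2.
Qed.

Lemma level_continuous (M : finZmodType) n (f : cochain Gh M n) N :
  level (proker N) f -> f \in @continuous_cochains Gh M n.
Proof.
move=> Lf; apply/asboolP => x U fxU.
have near_i (i : 'I_n) : nbhs (x : {ptws 'I_n -> Gh})
    [set y | pro_val (y i) N = pro_val (x i) N].
  have ci := @proj_continuous _ (fun _ : 'I_n => Gh : topologicalType) i x.
  exact: (ci _ (pro_near (x i) N)).
have all_i : nbhs (x : {ptws 'I_n -> Gh})
    [set y | forall i, pro_val (y i) N = pro_val (x i) N].
  exact: (@filter_forall _ _ (fun i y => pro_val (y i) N = pro_val (x i) N) _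
    (nbhs_filter (x : {ptws 'I_n -> Gh})) near_i).
apply: (@filterS _ _ (nbhs_filter (x : {ptws 'I_n -> Gh})) _ _ _ all_i) => y yx /=.
have -> : f y = f x.
  by apply: Lf => i; apply/prokerE.
exact: (@nbhs_singleton (discrete_topology M)).
Qed.

(** Cochains constant along open subgroups are determined by their values on the
    dense image of [G]. *)
Lemma completion_dense (V : Type) n (f h : ('I_n -> Gh) -> V) N N' :
  level (proker N) f -> level (proker N') h ->
  (forall g : 'I_n -> G, f (phi \o g) = h (phi \o g)) -> f = h.
Proof.
move=> Lf Lh fh; apply/funext => x.
have [N'' [N''N N''N']] := pn_inter p_pr N N'.
pose g i := repr (pro_val (x i) N'').
have gx i : pro_val (phi (g i)) N'' = pro_val (x i) N'' by exact: qpiK.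
rewrite (Lf x (phi \o g)) => [|i]; last first.
  by apply/prokerE; rewrite -(pro_val_sub N''N (gx i)).
rewrite (Lh x (phi \o g)) => [|i]; first exact: fh.
by apply/prokerE; rewrite -(pro_val_sub N''N' (gx i)).
Qed.

Lemma level_pullback (V : Type) n (f : ('I_n -> Gh) -> V) N :
  level (proker N) f -> uniform p (fun g => f (phi \o g)).
Proof.
move=> Lf; exists N => g h gh; apply: Lf => i /=.
by rewrite /proker -morV -gmulfM; apply/qpi_kernel.
Qed.

Lemma uniform_extend (V : Type) n (f : ('I_n -> G) -> V) : uniform p f ->
  exists N (fh : ('I_n -> Gh) -> V), level (proker N) fh /\
    forall g, fh (phi \o g) = f g.
Proof.
move=> [N Lf]; exists N, (fun x => f (fun i => repr (pro_val (x i) N))).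
split=> [x y xy|g]; first by congr f; apply/funext => i; congr repr; apply/prokerE.
apply/esym; apply: Lf => i; exact: repr_coset.
Qed.
End Completion.

Lemma bijective_of_inj_surj (T U : Type) (f : T -> U) :
  injective f -> (forall y, exists x, f x = y) -> bijective f.
Proof.
move=> fI /choice[g gP]; exists g => // x; exact/fI/gP.
Qed.

(** * The comparison theorem *)

Section Discrete.
Variables (G : groupType) (p : nat).
Hypothesis p_pr : prime p.
Local Notation Gh := (pro_completion G p).
Local Notation phi := (@completion_map G p).
Variables (M : finZmodType) (a : gmodule Gh M).
Hypothesis ca : discrete_gmodule a.

Lemma coboundary_level n (f : cochain Gh M n) N : level (proker N) f ->
  exists N', level (proker (p := p) N') (coboundary a f).
Proof.
move=> Lf; have [N1 N1a] := discrete_kernel p_pr ca.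
have [N' [N'N N'N1]] := pn_inter p_pr N N1; exists N'.
have sub (N2 : p_normal G p) x : {subset N' <= N2} -> proker N' x -> proker N2 x.
  by move=> NN xN'; rewrite /proker (pro_val_sub (y := 1%g) NN).
apply: (@level_dif Gh (proker N') (proker_nsub N') M (nmod_of a) n f).
- move=> x y v xy; rewrite -[y](mulVKg x) nactM; congr (a x _).
  by apply/esym/N1a/sub/xy.
apply: level_sub Lf => x; exact: sub.
Qed.

Lemma pmod_pullback : (exists k, #|M| = (p ^ k)%N) ->
  pmod p (pullback_gmodule phi a).
Proof.
move=> [k Mk]; have [N Na] := discrete_kernel p_pr ca.
have [l lN] := pn_exponent p_pr N; exists (k + l)%N; split=> [m|g m].
  rewrite expnD mulrnA.
  have := @expg_cardG M [set: M]%G m (finset.in_setT m).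
  by rewrite cardsT Mk FinRing.zmodXgE => ->; rewrite mul0rn.
apply: Na; rewrite /proker /= addnC expnD expgM.
apply/qpi_kernel; elim: (p ^ k)%N => [|i IH]; first by rewrite expg0 gpred1.
by rewrite expgS gpredM.
Qed.
End Discrete.

(** Both halves use the dictionary between continuous and uniform cochains;
    identities between continuous cochains are checked on the dense image of
    [G]. *)
Theorem theorem1p2 (G : groupType) (p : nat)
    (G_nilpotent : nilpotent_group G) (G_FAR : FAR_group G)
    (p_prime : prime p)
    (no_prufer : ~ exists H : groupClosed G,
                     isomorphic (subgroup_type H) (prufer p))
    (M : finZmodType) (a : gmodule (pro_completion G p) M)
    (M_discrete : discrete_gmodule a)
    (M_order : exists k : nat, #|M| = (p ^ k)%N) (n : nat) :
  zmod_isomorphism (@cohomology_map G (pro_completion G p)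
                      (@completion_map G p) M a n).
Proof.
split; first exact: cohomology_map_zmod_morphism.
have effG := nilpotent_FAR_effaceable p_prime G_FAR no_prufer G_nilpotent.
have pa := pmod_pullback p_prime M_discrete M_order.
apply: bijective_of_inj_surj => [x y|y].
  rewrite -[x]reprK -[y]reprK -!/(cohomology_class _) !cohomology_map_class.
  move: {x y}(repr x) (repr y) => z w /cohomology_classP zw; apply/cohomology_classP.
  have /andP[cz _] := cocycleP z; have /andP[cw _] := cocycleP w.
  have [N Lu] := continuous_level p_prime (rpredB cz cw).
  have := uniform_injective p_prime effG pa (level_pullback Lu).
  case: n z w zw cz cw Lu => [|m] z w zw cz cw Lu /= ub.
    apply: (completion_dense (N' := N) p_prime Lu) => [|g].
      by [].
    by have := ub zw => /(congr1 (fun c => c g)).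
  have [|c uc cE] := ub; first by case: zw => c _ cE; exists c.
  have [N' [ch [Lc chE]]] := uniform_extend uc.
  exists ch; first exact: level_continuous Lc.
  have [N'' Ldc] := coboundary_level p_prime M_discrete Lc.
  apply: (completion_dense p_prime Lu Ldc) => g.
  have chc : pullback_cochain (@completion_map G p) ch = c.
    by apply/funext => h; exact: chE.
  rewrite -[RHS]/(pullback_cochain (@completion_map G p) (coboundary a ch) g).
  by rewrite pullback_coboundary chc; have /(congr1 (fun c => c g)) := cE.
rewrite -[y]reprK -/(cohomology_class _); move: {y}(repr y) => w.
have /andP[_ /eqP dw] := cocycleP w.
have [F uF bF] := uniform_representative p_prime effG pa dw.
have [N [Fh [LF FhE]]] := uniform_extend uF.
have FhF : pullback_cochain (@completion_map G p) Fh = F.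
  by apply/funext => h; exact: FhE.
have zF : (Fh \in @continuous_cochains (pro_completion G p) M n) &&
    (coboundary a Fh == 0).
  rewrite (level_continuous LF) /=; apply/eqP.
  have [N' LdF] := coboundary_level p_prime M_discrete LF.
  apply: (completion_dense (N' := N) p_prime LdF) => [|g].
    by [].
  rewrite -[LHS]/(pullback_cochain (@completion_map G p) (coboundary a Fh) g).
  rewrite pullback_coboundary FhF.
  have dF := @cocycle_of_bdry G M (pullback_gmodule (@completion_map G p) a)
    n (val w) F dw bF.
  exact: (congr1 (fun c => c g) dF).
exists (cohomology_class (Cocycle zF)); rewrite cohomology_map_class.
apply/esym/cohomology_classP; rewrite /= FhF.
case: n w F bF {dw uF Fh LF FhE FhF zF N} => [|m] w F //= [c cE].
by exists c.
Qed.
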